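(* Let $Q=Q^1\sqcup Q^2$ be a deconcatenation at the source $v$ and assume that there are regular exact Borel subalgebras $B^1\subset A^1$ and $B^2\subset A^2$. Then $A$ admits a regular exact Borel subalgebra.
   Context: $K$ is an algebraically closed field, $Q$ a finite connected quiver, $I\subset KQ$ an admissible ideal, $A=KQ/I$; modules are finite-dimensional left modules. $L(i),P(i)$ are the simple and its projective cover at $i\in Q_0$. For a partial order $\trianglelefteq$ on $Q_0$, the standard module $\Delta(i)$ is the largest quotient of $P(i)$ with all composition factors $L(j)$ satisfying $j\trianglelefteq i$. $(A,\trianglelefteq)$ is quasi-hereditary if for each $i$ the kernel of $P(i)\twoheadrightarrow\Delta(i)$ has a filtration with subquotients $\Delta(j)$, $j\triangleright i$, and the kernel of $\Delta(i)\twoheadrightarrow L(i)$ has a filtration with subquotients $L(j)$, $j\triangleleft i$. A deconcatenation $Q=Q^1\sqcup Q^2$ at a sink or source $v$: $Q^1,Q^2$ are connected full subquivers of $Q$ with $Q_0=Q^1_0\cup Q^2_0$, $Q^1_0\cap Q^2_0=\{v\}$, and no arrows in $Q$ between vertices of $Q^1_0\setminus\{v\}$ and of $Q^2_0\setminus\{v\}$. Put $A^\ell=A/\langle e_u\mid u\in Q_0\setminus Q_0^\ell\rangle$ for $\ell=1,2$. A partial order $\trianglelefteq$ on $Q_0$ is fixed with $(A,\trianglelefteq)$ quasi-hereditary; $\trianglelefteq^\ell$ is its restriction to $Q_0^\ell$, for which $A^\ell$ is quasi-hereditary. Regular exact Borel subalgebras of $A$, $A^\ell$ are with respect to $\trianglelefteq$,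 $\trianglelefteq^\ell$. Regular exact Borel subalgebra: let $(\Lambda,\trianglelefteq)$ be quasi-hereditary with $n$ simple modules up to isomorphism. A subalgebra $B\subset\Lambda$ is an exact Borel subalgebra if (i) $B$ also has $n$ simple modules $L_B(i)$ up to isomorphism, indexed by the same set, and $(B,\trianglelefteq)$ is quasi-hereditary with simple standard modules; (ii) $\Lambda\otimes_B-$ is exact; (iii) $\Lambda\otimes_B L_B(i)\cong\Delta_\Lambda(i)$ for all $i$. It is regular if moreover the maps $\operatorname{Ext}_B^k(L_B(i),L_B(j))\to\operatorname{Ext}_\Lambda^k(\Lambda\otimes_BL_B(i),\Lambda\otimes_BL_B(j))$ induced by $\Lambda\otimes_B-$ are isomorphisms for all $k\ge 1$ and all $i,j$. *)

(* Defs.v *)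
From HB Require Import structures.
From mathcomp Require Import all_boot all_order all_algebra falgebra.
From mathcomp Require Import finmap.
From mathcomp.multinomials Require Import monalg.
From mathcomp Require Import boolp.

Set Implicit Arguments.
Unset Strict Implicit.
Unset Printing Implicit Defensive.

Import GRing.Theory.
Local Open Scope ring_scope.

(* Modules over an algebra A are objects of [lmodType A], i.e. left modules;
   the field K acts through k%:A. *)

Record quiver := Quiver {
  vertex : finType;
  arrow : finType;
  source : arrow -> vertex;
  target : arrow -> vertex;
  vertex_gt0 : (0 < #|vertex|)%N
}.

Section Paths.
Variable Q : quiver.

Fixpoint is_path (x : vertex Q) (s : seq (arrow Q)) : bool :=
  if s is a :: s' then (source a == x) && is_path (target a) s' else true.

Fixpoint path_end (x : vertex Q) (s : seq (arrow Q)) : vertex Q :=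
  if s is a :: s' then path_end (target a) s' else x.

(* A path is its starting vertex and its arrows in order of traversal. *)
Definition qpath := {p : vertex Q * seq (arrow Q) | is_path p.1 p.2}.

HB.instance Definition _ := Choice.on qpath.

Definition qstart (p : qpath) : vertex Q := (val p).1.
Definition qarrows (p : qpath) : seq (arrow Q) := (val p).2.
Definition qend (p : qpath) : vertex Q := path_end (qstart p) (qarrows p).

Definition trivial_path (x : vertex Q) : qpath :=
  exist (fun p => is_path p.1 p.2) (x, [::]) isT.

Lemma arrow_path_proof (a : arrow Q) :
  is_path (source a, [:: a]).1 (source a, [:: a]).2.
Proof. by rewrite /= eqxx. Qed.

Definition arrow_path (a : arrow Q) : qpath :=
  exist (fun p => is_path p.1 p.2) (source a, [:: a]) (arrow_path_proof a).

Lemma is_path_cat x s t :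
  is_path x (s ++ t) = is_path x s && is_path (path_end x s) t.
Proof. by elim: s x => //= a s IH x; rewrite IH andbA. Qed.

Lemma path_end_cat x s t :
  path_end x (s ++ t) = path_end (path_end x s) t.
Proof. by elim: s x => //= a s IH x. Qed.

(* Paths compose like functions: [p] after [q]. *)
Definition qcomp (p q : qpath) : option qpath :=
  if qend q == qstart p then
    insub (qstart q, qarrows q ++ qarrows p)
      : option {p : vertex Q * seq (arrow Q) | is_path p.1 p.2}
  else None.

End Paths.

Section LinearExtension.
Variables (K : fieldType) (T : choiceType) (V : lmodType K).
Implicit Types (f : T -> V) (g h : {malg K[T]}).

Definition malg_lin f g : V := \sum_(k <- msupp g) g@_k *: f k.

Lemma malg_linEw (d : {fset T}) f g : (msupp g `<=` d)%fset ->
  malg_lin f g = \sum_(k <- d) g@_k *: f k.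
Proof.
move=> le_d; rewrite /malg_lin (big_fset_incl _ le_d) //=.
by move=> k _ /mcoeff_outdom ->; rewrite scale0r.
Qed.

Lemma malg_linD f g h : malg_lin f (g + h) = malg_lin f g + malg_lin f h.
Proof.
rewrite (malg_linEw _ (msuppD_le g h)).
rewrite (malg_linEw f (fsubsetUl (msupp g) (msupp h))).
rewrite (malg_linEw f (fsubsetUr (msupp g) (msupp h))).
by rewrite -big_split; apply: eq_bigr => k _; rewrite mcoeffD scalerDl.
Qed.

Lemma malg_linDf f1 f2 g :
  malg_lin (fun k => f1 k + f2 k) g = malg_lin f1 g + malg_lin f2 g.
Proof.
by rewrite /malg_lin -big_split; apply: eq_bigr => k _; rewrite scalerDr.
Qed.

Lemma malg_linZf c f g :
  malg_lin (fun k => c *: f k) g = c *: malg_lin f g.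
Proof.
by rewrite /malg_lin scaler_sumr; apply: eq_bigr => k _; rewrite !scalerA mulrC.
Qed.

Lemma malg_lin0 f : malg_lin f 0 = 0.
Proof. by rewrite /malg_lin msupp0 big_seq_fset0. Qed.

Lemma malg_linZ f c g : malg_lin f (c *: g) = c *: malg_lin f g.
Proof.
rewrite (malg_linEw _ (msuppZ_le c g)) /malg_lin scaler_sumr.
by apply: eq_bigr => k _; rewrite mcoeffZ scalerA.
Qed.

Lemma malg_linU f c k : malg_lin f << c *g k >> = c *: f k.
Proof.
by rewrite (malg_linEw _ (@msuppU_le T K k c)) big_seq_fset1 mcoeffUU.
Qed.

Lemma malg_lin_sum f (I : Type) (r : seq I) (P : pred I) (F : I -> {malg K[T]}) :
  malg_lin f (\sum_(i <- r | P i) F i) = \sum_(i <- r | P i) malg_lin f (F i).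
Proof. exact: (big_morph _ (malg_linD f) (malg_lin0 f)). Qed.

Lemma malgE_lin g : g = \sum_(k <- msupp g) g@_k *: << k >>.
Proof.
rewrite [LHS]monalgE; apply: eq_bigr => k _; apply/malgP => l.
by rewrite mcoeffZ !mcoeffU mulr_natr.
Qed.

Lemma malg_sumU_neq0 (J : finType) (j : J) (e : J -> T) : injective e ->
  \sum_i << e i >> != 0 :> {malg K[T]}.
Proof.
move=> eI; apply/eqP => /malgP/(_ (e j)) /eqP.
rewrite raddf_sum mcoeff0 /= (bigD1 j) //= mcoeffUU big1 ?addr0 ?oner_eq0 //.
by move=> i /negbTE ne; rewrite mcoeffU (inj_eq eI) ne.
Qed.

End LinearExtension.

Definition path_algebra (K : fieldType) (Q : quiver) : Type := {malg K[qpath Q]}.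

HB.instance Definition _ (K : fieldType) (Q : quiver) :=
  GRing.Lmodule.on (path_algebra K Q).

HB.lock Definition path_elt (K : fieldType) (Q : quiver) (p : qpath Q) :
  path_algebra K Q := << 1 *g p >>.

Arguments path_elt K {Q} p.

Definition path_mul (K : fieldType) (Q : quiver) (p q : qpath Q) :
    path_algebra K Q :=
  if qcomp p q is Some r then path_elt K r else 0.

HB.lock Definition pa_mul (K : fieldType) (Q : quiver) (g h : path_algebra K Q) :
    path_algebra K Q :=
  \sum_(p <- msupp g) \sum_(q <- msupp h) (g@_p * h@_q) *: path_mul K p q.

Arguments pa_mul {K Q} g h.

Section PathAlgebra.
Variables (K : fieldType) (Q : quiver).
Local Notation path_algebra := (path_algebra K Q).
Local Notation path_elt := (path_elt K).
Local Notation path_mul := (path_mul K).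
Local Notation pa_mul := (@pa_mul K Q).

Implicit Types (g h : path_algebra) (p q r : qpath Q).

Definition pa_one : path_algebra :=
  \sum_(x : vertex Q) path_elt (trivial_path x).

Lemma pa_mulE g h :
  pa_mul g h = malg_lin (fun p => malg_lin (path_mul p) h) g.
Proof.
rewrite pa_mul.unlock; apply: eq_bigr => p _; rewrite scaler_sumr.
by apply: eq_bigr => q _; rewrite scalerA.
Qed.

Lemma pa_mulDl : left_distributive pa_mul +%R.
Proof. by move=> g h k; rewrite !pa_mulE malg_linD. Qed.

Lemma pa_mulDr : right_distributive pa_mul +%R.
Proof.
by move=> g h k; rewrite !pa_mulE -malg_linDf; apply: eq_bigr => p _; rewrite malg_linD.
Qed.

Lemma pa_mulZl c g h : pa_mul (c *: g) h = c *: pa_mul g h.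
Proof. by rewrite !pa_mulE malg_linZ. Qed.

Lemma pa_mulZr c g h : pa_mul g (c *: h) = c *: pa_mul g h.
Proof.
rewrite !pa_mulE -malg_linZf.
by apply: eq_bigr => p _; rewrite malg_linZ.
Qed.

Lemma pa_mul0l g : pa_mul 0 g = 0.
Proof. by rewrite pa_mulE malg_lin0. Qed.

Lemma pa_mul0r g : pa_mul g 0 = 0.
Proof.
by rewrite pa_mulE /malg_lin big1 // => p _; rewrite msupp0 big_seq_fset0 scaler0.
Qed.

Lemma pa_mul_suml (I : Type) (r : seq I) (P : pred I) F h :
  pa_mul (\sum_(i <- r | P i) F i) h = \sum_(i <- r | P i) pa_mul (F i) h.
Proof.
exact: (big_morph (pa_mul^~ h) (fun x y => pa_mulDl x y h) (pa_mul0l h)).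
Qed.

Lemma pa_mul_sumr (I : Type) (r : seq I) (P : pred I) F g :
  pa_mul g (\sum_(i <- r | P i) F i) = \sum_(i <- r | P i) pa_mul g (F i).
Proof. exact: (big_morph (pa_mul g) (pa_mulDr g) (pa_mul0r g)). Qed.

Lemma path_algebraE g : g = \sum_(p <- msupp g) g@_p *: path_elt p.
Proof.
rewrite path_elt.unlock; exact: malgE_lin.
Qed.

Lemma pa_mulUU p q : pa_mul (path_elt p) (path_elt q) = path_mul p q.
Proof.
by rewrite pa_mulE path_elt.unlock malg_linU malg_linU !scale1r.
Qed.

Lemma qcompP p q r :
  reflect (qend q = qstart p /\ val r = (qstart q, qarrows q ++ qarrows p))
          (qcomp p q == Some r).
Proof.
rewrite /qcomp; case: (qend q =P qstart p) => [e|ne]; last first.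
  by apply: (iffP idP) => [/eqP|[]].
case: insubP => [u _ uE|]; last first.
  rewrite /= is_path_cat; case/negP; apply/andP; split; first exact: (valP q).
  by rewrite -/(qend q) e; exact: (valP p).
apply: (iffP eqP) => [[<-]|[_ rE]]; first by split.
by congr Some; apply: val_inj; rewrite rE.
Qed.

Lemma qcomp_end p q r : qcomp p q = Some r -> qend r = qend p.
Proof.
move/eqP/qcompP => [e rE].
by rewrite /qend /qstart /qarrows rE /= path_end_cat -/(qend q) e.
Qed.

Lemma qcomp_start p q r : qcomp p q = Some r -> qstart r = qstart q.
Proof. by move/eqP/qcompP => [_ rE]; rewrite /qstart rE. Qed.

Lemma qcomp_isSome p q : qcomp p q = (qend q == qstart p) :> bool.
Proof.
case E: (qcomp p q) => [r|]; first by have /eqP/qcompP[-> _] := E; rewrite eqxx.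
apply/esym/negbTE/negP => e.
have h : is_path (qstart q) (qarrows q ++ qarrows p).
  by rewrite is_path_cat (valP q) /= -/(qend q) (eqP e); exact: (valP p).
suff: qcomp p q == Some (exist (fun u => is_path u.1 u.2)
                             (qstart q, qarrows q ++ qarrows p) h).
  by rewrite E.
by apply/qcompP; split; first exact/eqP.
Qed.

Lemma path_mul_comp p q r : qcomp p q = Some r -> path_mul p q = path_elt r.
Proof. by rewrite /path_mul => ->. Qed.

Lemma path_mul_none p q : qcomp p q = None -> path_mul p q = 0.
Proof. by rewrite /path_mul => ->. Qed.

Lemma path_mul_eq0 p q : (qend q == qstart p) = false -> path_mul p q = 0.
Proof.
by rewrite /path_mul => ne; have := qcomp_isSome p q; rewrite ne; case: qcomp.
Qed.

Lemma path_mulA p q r :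
  pa_mul (path_elt p) (path_mul q r) = pa_mul (path_mul p q) (path_elt r).
Proof.
case E1: (qcomp q r) => [s|]; case E2: (qcomp p q) => [t|].
- rewrite (path_mul_comp E1) (path_mul_comp E2).
  refine (etrans (pa_mulUU p s) (etrans _ (esym (pa_mulUU t r)))).
  have /eqP/qcompP[e1 sE] := E1; have /eqP/qcompP[e2 tE] := E2.
  have e3 := qcomp_end E1; have e4 := qcomp_start E2.
  have := qcomp_isSome p s; have := qcomp_isSome t r.
  rewrite e3 e4 e1 e2 !eqxx.
  case F1: (qcomp t r) => [u|] // _; case F2: (qcomp p s) => [w|] // _.
  rewrite (path_mul_comp F1) (path_mul_comp F2).
  congr path_elt; apply: val_inj.
  have /eqP/qcompP[_ ->] := F1; have /eqP/qcompP[_ ->] := F2.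
  by rewrite /qstart /qarrows sE tE /= catA.
- rewrite (path_mul_comp E1) (path_mul_none E2).
  refine (etrans (pa_mulUU p s) (etrans _ (esym (pa_mul0l _)))).
  by apply: path_mul_eq0; rewrite (qcomp_end E1) -qcomp_isSome E2.
- rewrite (path_mul_comp E2) (path_mul_none E1).
  refine (etrans (pa_mul0r _) (etrans _ (esym (pa_mulUU t r)))).
  by apply/esym/path_mul_eq0; rewrite (qcomp_start E2) -qcomp_isSome E1.
- rewrite (path_mul_none E1) (path_mul_none E2).
  exact: (etrans (pa_mul0r _) (esym (pa_mul0l _))).
Qed.

Lemma pa_linear_ext (F G : path_algebra -> path_algebra) :
  {morph F : x y / x + y} -> (forall c, {morph F : x / c *: x}) ->
  {morph G : x y / x + y} -> (forall c, {morph G : x / c *: x}) ->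
  (forall p, F (path_elt p) = G (path_elt p)) -> F =1 G.
Proof.
move=> FD FZ GD GZ FG g.
have F0 : F 0 = 0 by rewrite -[X in F X](scale0r 0) FZ scale0r.
have G0 : G 0 = 0 by rewrite -[X in G X](scale0r 0) GZ scale0r.
rewrite (path_algebraE g) (big_morph F FD F0) (big_morph G GD G0).
by apply: eq_bigr => p _; rewrite FZ GZ FG.
Qed.

Lemma pa_mulA : associative pa_mul.
Proof.
move=> g h k; move: g; apply: pa_linear_ext.
- by move=> x y; rewrite pa_mulDl.
- by move=> c x; rewrite pa_mulZl.
- by move=> x y; rewrite !pa_mulDl.
- by move=> c x; rewrite !pa_mulZl.
move=> p; move: h; apply: pa_linear_ext.
- by move=> x y; rewrite pa_mulDl pa_mulDr.
- by move=> c x; rewrite pa_mulZl pa_mulZr.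
- by move=> x y; rewrite pa_mulDr pa_mulDl.
- by move=> c x; rewrite pa_mulZr pa_mulZl.
move=> q; move: k; apply: pa_linear_ext.
- by move=> x y; rewrite !pa_mulDr.
- by move=> c x; rewrite !pa_mulZr.
- by move=> x y; rewrite pa_mulDr.
- by move=> c x; rewrite pa_mulZr.
move=> r.
refine (etrans (congr1 (pa_mul _) (pa_mulUU q r)) (etrans (path_mulA p q r) _)).
exact: (congr1 (pa_mul^~ _) (esym (pa_mulUU p q))).
Qed.

Lemma path_mul_trivial_l x p :
  path_mul (trivial_path x) p = if qend p == x then path_elt p else 0.
Proof.
case: eqP => [e|/eqP/negbTE ne]; last by apply: path_mul_eq0.
apply: path_mul_comp; apply/eqP/qcompP; split; first exact: e.
rewrite (_ : qarrows (trivial_path x) = [::]) // cats0.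
exact: surjective_pairing.
Qed.

Lemma path_mul_trivial_r x p :
  path_mul p (trivial_path x) = if x == qstart p then path_elt p else 0.
Proof.
case: eqP => [e|/eqP/negbTE ne]; last by apply: path_mul_eq0.
apply: path_mul_comp; apply/eqP/qcompP; split; first exact: e.
rewrite (_ : qstart (trivial_path x) = qstart p) //.
exact: surjective_pairing.
Qed.

Lemma pa_mul1l : left_id pa_one pa_mul.
Proof.
apply: (@pa_linear_ext (pa_mul pa_one) id) => // [x y|c x|p] /=;
  rewrite ?pa_mulDr ?pa_mulZr //.
rewrite pa_mul_suml (bigD1 (qend p)) //= big1 ?addr0 => [|x /negbTE nx].
  by rewrite (pa_mulUU (trivial_path _) p) path_mul_trivial_l eqxx.
by rewrite (pa_mulUU (trivial_path x) p) path_mul_trivial_l eq_sym nx.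
Qed.

Lemma pa_mul1r : right_id pa_one pa_mul.
Proof.
apply: (@pa_linear_ext (pa_mul^~ pa_one) id) => // [x y|c x|p] /=;
  rewrite ?pa_mulDl ?pa_mulZl //.
rewrite pa_mul_sumr (bigD1 (qstart p)) //= big1 ?addr0 => [|x /negbTE nx].
  by rewrite (pa_mulUU p (trivial_path _)) path_mul_trivial_r eqxx.
by rewrite (pa_mulUU p (trivial_path x)) path_mul_trivial_r nx.
Qed.

Lemma pa_one_neq0 : pa_one != 0.
Proof.
have /card_gt0P[x _] := vertex_gt0 Q.
rewrite /pa_one path_elt.unlock; apply: (malg_sumU_neq0 K x) => y z.
by move/(congr1 (@qstart Q)).
Qed.

HB.instance Definition _ := GRing.Zmodule_isNzRing.Build path_algebra
  pa_mulA pa_mul1l pa_mul1r pa_mulDl pa_mulDr pa_one_neq0.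

Fact pa_scaleAl (c : K) (g h : path_algebra) : c *: (g * h) = (c *: g) * h.
Proof. exact/esym/pa_mulZl. Qed.

Fact pa_scaleAr (c : K) (g h : path_algebra) : c *: (g * h) = g * (c *: h).
Proof. exact/esym/pa_mulZr. Qed.

HB.instance Definition _ :=
  GRing.Lmodule_isLalgebra.Build K path_algebra pa_scaleAl.
HB.instance Definition _ :=
  GRing.Lalgebra_isAlgebra.Build K path_algebra pa_scaleAr.

End PathAlgebra.

Section Ideals.
Variable R : nzRingType.

Definition two_sided_ideal (J : R -> Prop) : Prop :=
  [/\ J 0, forall x y, J x -> J y -> J (x + y) &
      forall a x b, J x -> J (a * x * b)].

Definition ideal_generated (X : R -> Prop) (x : R) : Prop :=
  forall J, two_sided_ideal J -> (forall y, X y -> J y) -> J x.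

(* [f] exhibits [S] as the quotient ring [R / J]. *)
Definition quotient_by (S : nzRingType) (f : R -> S) (J : R -> Prop) : Prop :=
  (forall s, exists r, f r = s) /\ (forall r, f r = 0 <-> J r).

End Ideals.

Section BoundQuivers.
Variables (K : fieldType) (Q : quiver).

Definition vertex_idem (x : vertex Q) : path_algebra K Q :=
  path_elt K (trivial_path x).
Definition arrow_elt (a : arrow Q) : path_algebra K Q :=
  path_elt K (arrow_path a).

(* The m-th power of the arrow ideal, i.e. the span of the paths of length at
   least m. *)
Definition arrow_ideal_pow (m : nat) (x : path_algebra K Q) : Prop :=
  forall p, p \in msupp x -> (m <= size (qarrows p))%N.

Definition admissible (J : path_algebra K Q -> Prop) : Prop :=
  [/\ two_sided_ideal J,
      forall x, J x -> arrow_ideal_pow 2 x &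
      exists2 m, (2 <= m)%N & forall x, arrow_ideal_pow m x -> J x].

End BoundQuivers.

Section Deconcatenation.
Variable Q : quiver.
Implicit Types V : {set vertex Q}.

Definition adjacent_in V : rel (vertex Q) := fun x y =>
  [&& x \in V, y \in V &
    [exists a, (source a == x) && (target a == y)
            || (source a == y) && (target a == x)]].

(* The full subquiver on V is nonempty and connected, arrows being traversed in
   either direction. *)
Definition full_subquiver_connected V : Prop :=
  V != set0 /\ {in V &, forall x y, connect (adjacent_in V) x y}.

Definition quiver_connected : Prop := full_subquiver_connected [set: vertex Q].

Definition deconcatenation V1 V2 (v : vertex Q) : Prop :=
  [/\ full_subquiver_connected V1, full_subquiver_connected V2,
      V1 :|: V2 = [set: vertex Q], V1 :&: V2 = [set v] &
      forall a : arrow Q,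
        ~~ (((source a \in V1 :\ v) && (target a \in V2 :\ v))
         || ((source a \in V2 :\ v) && (target a \in V1 :\ v)))].

Definition is_source (v : vertex Q) : Prop := forall a : arrow Q, target a != v.

End Deconcatenation.

Section Modules.
Variables (K : fieldType) (A : falgType K).

Definition fin_dim (M : lmodType A) : Prop :=
  exists s : seq M, forall x : M, exists c : 'I_(size s) -> K,
    x = \sum_(i < size s) (c i)%:A *: s`_i.

Definition surj (X Y : Type) (f : X -> Y) : Prop := forall y, exists x, f x = y.

Definition exact_at (X Y Z : lmodType A) (f : X -> Y) (g : Y -> Z) : Prop :=
  forall y, g y = 0 <-> exists x, f x = y.

Definition short_exact (X Y Z : lmodType A) (f : X -> Y) (g : Y -> Z) : Prop :=
  [/\ injective f, exact_at f g & surj g].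

Definition isomorphic (M N : lmodType A) : Prop :=
  exists f : {linear M -> N}, bijective f.

Definition simple_module (M : lmodType A) : Prop :=
  (exists x : M, x != 0) /\
  forall S : {pred M}, submod_closed S -> S =i pred1 0 \/ S =i predT.

Definition projective (P : lmodType A) : Prop :=
  fin_dim P /\
  forall (X Y : lmodType A) (g : {linear X -> Y}) (h : {linear P -> Y}),
    fin_dim X -> fin_dim Y -> surj g ->
    exists h' : {linear P -> X}, forall x, g (h' x) = h x.

(* The last condition says that ker p is superfluous: S + ker p = P implies
   S = P. *)
Definition projective_cover (P M : lmodType A) (p : {linear P -> M}) : Prop :=
  [/\ projective P, surj p &
      forall S : {pred P}, submod_closed S ->
        (forall x, exists2 y, y \in S & p (x - y) = 0) -> S =i predT].

(* M has a finite filtration with subquotients in the class C, S being the top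
   one and X the next largest submodule. *)
Inductive filtered (C : lmodType A -> Prop) : lmodType A -> Prop :=
| Filtered0 (M : lmodType A) : (forall x : M, x = 0) -> filtered C M
| FilteredS (X M S : lmodType A) (f : {linear X -> M}) (g : {linear M -> S}) :
    short_exact f g -> C S -> filtered C X -> filtered C M.

Section Standard.
Variables (I : finType) (L : I -> lmodType A) (le : rel I).

Definition simple_labelling : Prop :=
  [/\ forall i, simple_module (L i),
      forall i j, isomorphic (L i) (L j) -> i = j &
      forall S : lmodType A, simple_module S -> exists i, isomorphic S (L i)].

(* As the L j are simple, such a filtration is a composition series; by
   Jordan-Hoelder its factors do not depend on the choice. *)
Definition factors_below (i : I) (M : lmodType A) : Prop :=
  filtered (fun S => exists2 j, le j i & isomorphic S (L j)) M.

Definition standard_quotient (i : I) (P D : lmodType A) (q : {linear P -> D})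
    : Prop :=
  [/\ surj q, factors_below i D &
      forall (D' : lmodType A) (q' : {linear P -> D'}),
        surj q' -> factors_below i D' -> forall x, q x = 0 -> q' x = 0].

(* The standard module of label i, up to isomorphism. *)
Definition standard_module (i : I) (D : lmodType A) : Prop :=
  exists (P : lmodType A) (p : {linear P -> L i}) (q : {linear P -> D}),
    projective_cover p /\ standard_quotient i q.

Definition quasi_hereditary : Prop :=
  forall i, exists (P D : lmodType A) (p : {linear P -> L i})
      (q : {linear P -> D}) (r : {linear D -> L i}),
    [/\ projective_cover p, standard_quotient i q, forall x, p x = r (q x),
        exists (X : lmodType A) (f : {linear X -> P}), short_exact f q /\
          filtered (fun S => exists j, [/\ le i j, i != j & standard_module j S])
            X &
        exists (Y : lmodType A) (f : {linear Y -> D}), short_exact f r /\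
          filtered (fun S => exists j, [/\ le j i, j != i & isomorphic S (L j)])
            Y].

End Standard.

Record resolution (M : lmodType A) := Resolution {
  res_mod : nat -> lmodType A;
  res_diff : forall k, {linear res_mod k.+1 -> res_mod k};
  res_aug : {linear res_mod 0%N -> M};
  res_projective : forall k, projective (res_mod k);
  res_aug_surj : surj res_aug;
  res_exact0 : exact_at (res_diff 0%N) res_aug;
  res_exactS : forall k, exact_at (res_diff k.+1) (res_diff k)
}.

(* Degree m.+1 cocycles and coboundaries of Hom(P, N), for P a projective
   resolution of M; their quotient is Ext^(m.+1)(M, N). *)
Definition cocycle (M N : lmodType A) (P : resolution M) (m : nat)
    (f : res_mod P m.+1 -> N) : Prop :=
  forall x, f (res_diff P m.+1 x) = 0.

Definition coboundary (M N : lmodType A) (P : resolution M) (m : nat)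
    (f : res_mod P m.+1 -> N) : Prop :=
  exists h : {linear res_mod P m -> N}, forall x, f x = h (res_diff P m x).

End Modules.

(* The simple at the vertex x of an algebra S that is a quotient, via phi, of
   the path algebra. *)
Definition vertex_simple (K : fieldType) (Q : quiver) (S : falgType K)
    (phi : path_algebra K Q -> S) (x : vertex Q) (L : lmodType S) : Prop :=
  [/\ exists2 l : L, l != 0 & forall m, exists c : K, m = c%:A *: l,
      forall m : L, phi (vertex_idem K x) *: m = m &
      forall (a : arrow Q) (m : L), phi (arrow_elt K a) *: m = 0].

Section IntegralExtension.
Variables (T : choiceType) (V : zmodType).
Implicit Types (f : T -> V) (g h : {malg int[T]}).

Definition malg_add f g : V := \sum_(k <- msupp g) f k *~ g@_k.

Lemma malg_addEw (d : {fset T}) f g : (msupp g `<=` d)%fset ->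
  malg_add f g = \sum_(k <- d) f k *~ g@_k.
Proof.
move=> le_d; rewrite /malg_add (big_fset_incl _ le_d) //=.
by move=> k _ /mcoeff_outdom ->; rewrite mulr0z.
Qed.

Lemma malg_addB f : zmod_morphism (malg_add f).
Proof.
move=> g h; rewrite (malg_addEw _ (msuppB_le g h)).
rewrite (malg_addEw f (fsubsetUl (msupp g) (msupp h))).
rewrite (malg_addEw f (fsubsetUr (msupp g) (msupp h))).
by rewrite -sumrB; apply: eq_bigr => k _; rewrite mcoeffB mulrzBr.
Qed.

HB.instance Definition _ f :=
  GRing.isZmodMorphism.Build {malg int[T]} V (malg_add f) (malg_addB f).

Lemma malg_addU f k : malg_add f << k >> = f k.
Proof.
by rewrite (malg_addEw _ (@msuppU_le T int k 1)) big_seq_fset1 mcoeffUU.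
Qed.

End IntegralExtension.

Section Tensor.
Variables (K : fieldType) (A : falgType K) (B : {aspace A}).
Variable N : lmodType (subvs_of B).

(* The subgroup of the free abelian group on A * N by which one divides to
   obtain the tensor product. *)
Inductive tensor_rel : {malg int[(A * N)%type]} -> Prop :=
| TensorRel0 : tensor_rel 0
| TensorRelB x y : tensor_rel x -> tensor_rel y -> tensor_rel (x - y)
| TensorRelDl a a' n :
    tensor_rel (<< (a + a', n) >> - << (a, n) >> - << (a', n) >>)
| TensorRelDr a n n' :
    tensor_rel (<< (a, n + n') >> - << (a, n) >> - << (a, n') >>)
| TensorRelM a (b : subvs_of B) n :
    tensor_rel (<< (a * vsval b, n) >> - << (a, b *: n) >>).

Definition tensor_relb : {pred {malg int[(A * N)%type]}} := fun x => `[< tensor_rel x >].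

Fact tensor_relb_zmod_closed : zmod_closed tensor_relb.
Proof.
split; first exact/asboolP/TensorRel0.
by move=> x y /asboolP xT /asboolP yT; apply/asboolP/TensorRelB.
Qed.

HB.instance Definition _ := GRing.isZmodClosed.Build {malg int[(A * N)%type]}
  tensor_relb tensor_relb_zmod_closed.

Definition tensor : Type := {ideal_quot tensor_relb}.

HB.instance Definition _ := GRing.Zmodule.on tensor.

Definition tensor_pi (x : {malg int[(A * N)%type]}) : tensor :=
  \pi_({ideal_quot tensor_relb})%qT x.

Definition pure (a : A) (n : N) : tensor := tensor_pi << (a, n) >>.

Lemma tensor_pi_zmod_morphism : zmod_morphism tensor_pi.
Proof. exact: (raddfB (\pi_({ideal_quot tensor_relb})%qT)). Qed.

HB.instance Definition _ := GRing.isZmodMorphism.Build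
  {malg int[(A * N)%type]} tensor tensor_pi tensor_pi_zmod_morphism.

Lemma tensor_pi_eq0 x : tensor_pi x = 0 <-> tensor_rel x.
Proof.
have -> : 0 = tensor_pi 0 by rewrite raddf0.
rewrite -[X in tensor_rel X]subr0; split => [/eqP|xT].
  by rewrite -Quotient.idealrBE => /asboolP.
by apply/eqP; rewrite -Quotient.idealrBE; apply/asboolP.
Qed.

Lemma tensor_repr (t : tensor) : exists x, t = tensor_pi x.
Proof. by exists (repr t); rewrite /tensor_pi reprK. Qed.

Section Lift.
Variables (V : zmodType) (f : A -> N -> V).

Definition balanced : Prop :=
  [/\ forall a a' n, f (a + a') n = f a n + f a' n,
      forall a n n', f a (n + n') = f a n + f a n' &
      forall a (b : subvs_of B) n, f (a * vsval b) n = f a (b *: n)].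

Definition tensor_lift (t : tensor) : V :=
  malg_add (fun k => f k.1 k.2) (repr t).

Hypothesis fB : balanced.

Lemma tensor_lift_pi x :
  tensor_lift (tensor_pi x) = malg_add (fun k => f k.1 k.2) x.
Proof.
have [fDl fDr fM] := fB.
apply/eqP; rewrite -subr_eq0 -raddfB /=; apply/eqP.
have : tensor_rel (repr (tensor_pi x) - x).
  by apply/tensor_pi_eq0; rewrite raddfB /= {1}/tensor_pi reprK subrr.
elim=> [|y z _ yE _ zE|a a' n|a n n'|a b n]; rewrite ?raddf0 //.
- by rewrite raddfB /= yE zE subrr.
- by rewrite !raddfB /= !malg_addU /= fDl -addrA -opprD subrr.
- by rewrite !raddfB /= !malg_addU /= fDr -addrA -opprD subrr.
- by rewrite !raddfB /= !malg_addU /= fM subrr.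
Qed.

Lemma tensor_lift_pure a n : tensor_lift (pure a n) = f a n.
Proof. by rewrite tensor_lift_pi malg_addU. Qed.

Lemma tensor_liftB : zmod_morphism tensor_lift.
Proof.
move=> s t; have [x ->] := tensor_repr s; have [y ->] := tensor_repr t.
by rewrite -raddfB !tensor_lift_pi raddfB.
Qed.

End Lift.

Lemma tensor_pi_eq x y : tensor_rel (x - y) -> tensor_pi x = tensor_pi y.
Proof. by move/tensor_pi_eq0; rewrite raddfB => /eqP; rewrite subr_eq0 => /eqP. Qed.

Lemma pure_balanced : balanced pure.
Proof.
split=> [a a' n|a n n'|a b n].
- refine (etrans (tensor_pi_eq _) (raddfD tensor_pi _ _)).
  by rewrite opprD addrA; apply: TensorRelDl.
- refine (etrans (tensor_pi_eq _) (raddfD tensor_pi _ _)).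
  by rewrite opprD addrA; apply: TensorRelDr.
- exact/tensor_pi_eq/TensorRelM.
Qed.

Lemma tensor_ext (V : zmodType) (f g : tensor -> V) :
  zmod_morphism f -> zmod_morphism g ->
  (forall a n, f (pure a n) = g (pure a n)) -> f =1 g.
Proof.
move=> fB gB fg t; have [x ->] := tensor_repr t.
pose F := GRing.isZmodMorphism.Build _ _ f fB.
pose G := GRing.isZmodMorphism.Build _ _ g gB.
pose f' : {additive tensor -> V} := HB.pack f F.
pose g' : {additive tensor -> V} := HB.pack g G.
rewrite -[f]/(f' : _ -> _) -[g]/(g' : _ -> _).
rewrite [x]monalgE !raddf_sum; apply: eq_bigr => -[a n] _.
have -> c : << c *g (a, n) >> = << (a, n) >> *~ c :> {malg int[(A * N)%type]}.
  by rewrite -[in LHS](intz c) -raddfMz.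
by rewrite !raddfMz /=; congr (_ *~ _); exact: fg.
Qed.

Definition tensor_scale (c : A) : tensor -> tensor :=
  tensor_lift (fun a n => pure (c * a) n).

Lemma tensor_scale_balanced c : balanced (fun a n => pure (c * a) n).
Proof.
have [pDl pDr pM] := pure_balanced.
by split=> [a a' n|a n n'|a b n]; rewrite ?mulrDr ?mulrA ?pDl ?pDr ?pM.
Qed.

Lemma tensor_scale_pure c a n : tensor_scale c (pure a n) = pure (c * a) n.
Proof. exact/tensor_lift_pure/tensor_scale_balanced. Qed.

Lemma tensor_scaleB c : zmod_morphism (tensor_scale c).
Proof. exact/tensor_liftB/tensor_scale_balanced. Qed.

Fact tensor_scaleA c d t :
  tensor_scale c (tensor_scale d t) = tensor_scale (c * d) t.
Proof.
move: t; apply: tensor_ext => [s t|s t|a n]; rewrite ?tensor_scaleB //.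
by rewrite !tensor_scale_pure mulrA.
Qed.

Fact tensor_scale1 t : tensor_scale 1 t = t.
Proof.
move: t; apply: tensor_ext => [s t|s t|a n]; rewrite ?tensor_scaleB //.
by rewrite tensor_scale_pure mul1r.
Qed.

Lemma tensor_scaleD c : {morph tensor_scale c : s t / s + t}.
Proof.
pose F := GRing.isZmodMorphism.Build _ _ _ (tensor_scaleB c).
pose f : {additive tensor -> tensor} := HB.pack (tensor_scale c) F.
exact: (raddfD f).
Qed.

Fact tensor_scaleDr : right_distributive tensor_scale +%R.
Proof. by move=> c s t; rewrite tensor_scaleD. Qed.

Fact tensor_scaleDl t : {morph tensor_scale^~ t : c d / c + d}.
Proof.
have [pDl _ _] := pure_balanced.
move=> c d; move: t; apply: tensor_ext => [s t|s t|a n] /=.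
- by rewrite tensor_scaleB.
- by rewrite !tensor_scaleB opprD addrACA.
- by rewrite !tensor_scale_pure mulrDl pDl.
Qed.

HB.instance Definition _ := GRing.Zmodule_isLmodule.Build A tensor
  tensor_scaleA tensor_scale1 tensor_scaleDr tensor_scaleDl.

End Tensor.

Definition induced (K : fieldType) (A : falgType K) (B : {aspace A})
  (N : lmodType (subvs_of B)) : lmodType A := tensor N.

Section InducedMap.
Variables (K : fieldType) (A : falgType K) (B : {aspace A}).
Variables (M N : lmodType (subvs_of B)) (h : {linear M -> N}).

Definition induced_map : induced M -> induced N :=
  tensor_lift (fun a n => pure a (h n)).

Lemma induced_map_balanced : balanced (fun a n => pure a (h n)).
Proof.
have [pDl pDr pM] := @pure_balanced _ _ _ N.
by split=> [a a' n|a n n'|a b n]; rewrite ?linearD ?linearZ /= ?pDl ?pDr ?pM.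
Qed.

Lemma induced_map_pure a n : induced_map (pure a n) = pure a (h n).
Proof. exact/tensor_lift_pure/induced_map_balanced. Qed.

Fact induced_map_zmod_morphism : zmod_morphism induced_map.
Proof. exact/tensor_liftB/induced_map_balanced. Qed.

HB.instance Definition _ := GRing.isZmodMorphism.Build (induced M) (induced N)
  induced_map induced_map_zmod_morphism.

Fact induced_map_scalable : scalable induced_map.
Proof.
move=> c; apply: tensor_ext => [s t|s t|a n].
- by rewrite scalerBr raddfB.
- by rewrite raddfB scalerBr.
- have scaleE (L : lmodType (subvs_of B)) a' (l : L) :
    c *: (pure a' l : induced L) = pure (c * a') l by exact: tensor_scale_pure.
  by rewrite scaleE !induced_map_pure scaleE.
Qed.

HB.instance Definition _ := GRing.isScalable.Build A (induced M) (induced N)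
  *:%R induced_map induced_map_scalable.

End InducedMap.

Section ExactBorel.
Variables (K : fieldType) (A : falgType K) (I : finType).
Variables (L : I -> lmodType A) (le : rel I) (B : {aspace A}).

Definition induction_exact : Prop :=
  forall (X Y Z : lmodType (subvs_of B))
      (f : {linear X -> Y}) (g : {linear Y -> Z}),
    fin_dim X -> fin_dim Y -> fin_dim Z ->
    short_exact f g -> short_exact (induced_map f) (induced_map g).

(* The map Ext_B^k(M, N) -> Ext_A^k(induced M, induced N) is bijective for all
   k = m.+1. It is computed from projective resolutions P of M and R of
   induced M and a chain map phi from R to the induced complex of P that lifts
   the identity of induced M: it sends the class of f to that of
   (induced_map f) o phi. *)
Definition ext_induction_iso (M N : lmodType (subvs_of B)) : Prop :=
  forall (P : resolution M) (R : resolution (induced M))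
      (phi : forall k, {linear res_mod R k -> induced (res_mod P k)}),
    (forall x, induced_map (res_aug P) (phi 0%N x) = res_aug R x) ->
    (forall k x, induced_map (res_diff P k) (phi k.+1 x)
                   = phi k (res_diff R k x)) ->
    forall m,
      (forall f : {linear res_mod P m.+1 -> N}, cocycle f ->
         coboundary (fun x => induced_map f (phi m.+1 x)) -> coboundary f) /\
      (forall g : {linear res_mod R m.+1 -> induced N}, cocycle g ->
         exists f : {linear res_mod P m.+1 -> N}, cocycle f /\
           coboundary (fun x => g x - induced_map f (phi m.+1 x))).

Definition exact_borel_with (LB : I -> lmodType (subvs_of B)) : Prop :=
  [/\ simple_labelling LB,
      quasi_hereditary LB le /\
        (forall i D, standard_module LB le i D -> simple_module D),
      induction_exact &
      forall i, exists2 D, standard_module L le i D &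
        isomorphic (induced (LB i)) D].

(* An [aspace] may have a unit other than 1, hence the first conjunct. *)
Definition regular_exact_borel : Prop :=
  1 \in B /\
  exists LB : I -> lmodType (subvs_of B),
    exact_borel_with LB /\ forall i j, ext_induction_iso (LB i) (LB j).

End ExactBorel.

(* Main.v *)
(* Since v is a source, A is the fibre product of A1 and A2 over K = e_v A e_v:
   with orthogonal idempotents 1 = e_v + E1 + E2 one has e_v A = K e_v, and the
   kernels of A -> A1 and A -> A2 are the right ideals E2 A and E1 A. Exactness of
   induction from B1 forces the kernel M1 of the character B1 -> K to satisfy
   m in M1 m for each m in M1, so M1 is a right ideal generated by an idempotent.
   Hence the fibre product B of B1 and B2 over K has the same shape as A. A module
   over A or B is recovered from its reductions modulo the two ideals, and these
   reductions are exact, preserve projectives and commute with induction. Exactness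
   of induction, the standard modules and Ext into the standard modules other than
   that at v therefore come from B1 and B2. The simple B-module at v is injective,
   and so Ext into it and into its induced module vanish. *)
From HB Require Import structures.
Require Import Defs.
From mathcomp Require Import all_boot all_order all_algebra falgebra.
From mathcomp Require Import boolp.

Set Implicit Arguments.
Unset Strict Implicit.
Unset Printing Implicit Defensive.

Import GRing.Theory.
Local Open Scope ring_scope.

(** * Modules and filtrations *)

(** The subalgebra B1 need not contain the image of e_v, so vertex idempotents cannot be used to
    split it. Only the character at v restricts to B1; the role of 1 - e_v is taken by a left
    identity of its kernel, which is why an idempotent has to be extracted from exactness of
    induction. Once the kernel of R -> S is gR, the right R-module S is isomorphic to the projective
    (1 - g)R. So reduction, that is tensoring with S, is the exact functor M -> (1 - g)M, left
    adjoint to restriction. This applies to A and to B alike.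

    If g kills N, maps into N factor through the reduction, so Ext into N is computed on one side.
    This may fail for the module induced from the simple at v, which is glued from both sides: a
    cocycle then has a primitive on each side, and the two must first be made to agree over K. The
    standard modules meet the same obstacle: the projections chosen on the two sides agree over K
    only up to a scalar. *)

Definition mk_linear (R : nzRingType) (M N : lmodType R) (f : M -> N)
    (fL : linear f) : {linear M -> N} :=
  HB.pack f (GRing.isLinear.Build R M N *:%R f fL).

Definition lmap_comp (R : nzRingType) (M N P : lmodType R) (g : {linear N -> P})
  (f : {linear M -> N}) : {linear M -> P} := g \o f.

Definition lmap_id (R : nzRingType) (M : lmodType R) : {linear M -> M} := idfun.

Definition lmap_zero (R : nzRingType) (M N : lmodType R) : {linear M -> N} := \0.

Definition lmap_sub (R : nzRingType) (M N : lmodType R) (f g : {linear M -> N}) :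
  {linear M -> N} := f \- g.

Lemma lmap_subE (R : nzRingType) (M N : lmodType R) (f g : {linear M -> N}) x :
  lmap_sub f g x = f x - g x.
Proof. by []. Qed.

Lemma surj_fun (X Y : Type) (f : X -> Y) : surj f -> exists g : Y -> X, cancel g f.
Proof.
move=> fS; exists (fun y => projT1 (cid (fS y))) => y.
exact: (projT2 (cid (fS y))).
Qed.

Section SubModule.
Variables (R : nzRingType) (M : lmodType R) (S : submodClosed M).

Definition sub_mod : Type := {x : M | x \in S}.
HB.instance Definition _ := SubType.on sub_mod.
HB.instance Definition _ := [Choice of sub_mod by <:].
HB.instance Definition _ := [SubChoice_isSubLmodule of sub_mod by <:].

Definition sub_val : {linear sub_mod -> M} := (val : sub_mod -> M).

Lemma sub_val_inj : injective sub_val.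
Proof. exact: val_inj. Qed.

Lemma sub_valP x : x \in S <-> exists y, sub_val y = x.
Proof. by split=> [xS|[y <-]]; [exists (Sub x xS) | exact: valP]. Qed.
End SubModule.

Definition mk_sub (R : nzRingType) (M : lmodType R) (S : {pred M})
    (SC : submod_closed S) : submodClosed M :=
  HB.pack S (GRing.isSubmodClosed.Build R M S SC).

Lemma submodule_type (R : nzRingType) (M : lmodType R) (S : M -> Prop) :
  S 0 -> (forall a x y, S x -> S y -> S (a *: x + y)) ->
  exists (U : lmodType R) (u : {linear U -> M}),
    injective u /\ forall x, S x <-> exists y, u y = x.
Proof.
move=> S0 SD.
pose T : {pred M} := fun x => `[< S x >].
have SC : submod_closed T.
  split=> [|a x y /asboolP Sx /asboolP Sy]; apply/asboolP => //.
  exact: SD.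
exists (sub_mod (mk_sub SC)), (sub_val (mk_sub SC)); split.
  exact: sub_val_inj.
by move=> x; rewrite -sub_valP; split=> [/asboolP|/asboolP].
Qed.

Lemma kernel_type (R : nzRingType) (M N : lmodType R) (f : {linear M -> N}) :
  exists (U : lmodType R) (u : {linear U -> M}),
    injective u /\ forall x, f x = 0 <-> exists y, u y = x.
Proof.
apply: submodule_type => [|a x y fx fy]; first exact: linear0.
by rewrite linearP fx fy scaler0 addr0.
Qed.

Lemma factor_inj (R : nzRingType) (M N P : lmodType R) (u : {linear N -> P})
    (f : {linear M -> P}) :
  injective u -> (forall x, exists y, u y = f x) ->
  exists g : {linear M -> N}, forall x, u (g x) = f x.
Proof.
move=> uI fu; pose g x := projT1 (cid (fu x)).
have gE x : u (g x) = f x by exact: projT2 (cid (fu x)).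
have gL : linear g by move=> a x y; apply: uI; rewrite linearP !gE linearP.
by exists (mk_linear gL).
Qed.

Lemma factor_surj (R : nzRingType) (M N P : lmodType R) (q : {linear M -> N})
    (f : {linear M -> P}) :
  surj q -> (forall x, q x = 0 -> f x = 0) ->
  exists g : {linear N -> P}, forall x, g (q x) = f x.
Proof.
move=> qS qf; have [s sK] := surj_fun qS.
have gE x : f (s (q x)) = f x.
  by apply/eqP; rewrite -subr_eq0 -linearB qf // linearB /= sK subrr.
have gL : linear (f \o s).
  move=> a x y /=; rewrite -linearP -[RHS]gE; congr (f (s _)).
  by rewrite linearP !sK.
by exists (mk_linear gL).
Qed.

Section Quotient.
Variables (R : nzRingType) (M : lmodType R) (S : submodClosed M).

Definition quot_pred : {pred M} := fun x => x \in S.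

Fact quot_pred_closed : zmod_closed quot_pred.
Proof.
split=> [|x y xS yS]; first exact: rpred0.
by rewrite -[- y]scaleN1r; apply/rpredD => //; apply/rpredZ.
Qed.
HB.instance Definition _ := GRing.isZmodClosed.Build M quot_pred quot_pred_closed.

Definition quot_mod : Type := {ideal_quot quot_pred}.
HB.instance Definition _ := GRing.Zmodule.on quot_mod.

Definition quot_pi (x : M) : quot_mod := \pi_({ideal_quot quot_pred})%qT x.

Lemma quot_piB : zmod_morphism quot_pi.
Proof. exact: (raddfB (\pi_({ideal_quot quot_pred})%qT)). Qed.
HB.instance Definition _ :=
  GRing.isZmodMorphism.Build M quot_mod quot_pi quot_piB.

Lemma quot_pi_eq x y : quot_pi x = quot_pi y <-> x - y \in S.
Proof.
by split=> [/eqP|h]; [rewrite -Quotient.idealrBE | apply/eqP; rewrite -Quotient.idealrBE].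
Qed.

Lemma quot_repr (t : quot_mod) : quot_pi (repr t) = t.
Proof. by rewrite /quot_pi reprK. Qed.

Definition quot_scale (a : R) (t : quot_mod) : quot_mod := quot_pi (a *: repr t).

Lemma quot_scale_pi a x : quot_scale a (quot_pi x) = quot_pi (a *: x).
Proof.
apply/quot_pi_eq; rewrite -scalerBr; apply: rpredZ.
by apply/quot_pi_eq; rewrite quot_repr.
Qed.

Fact quot_scaleA a b t : quot_scale a (quot_scale b t) = quot_scale (a * b) t.
Proof. by rewrite -(quot_repr t) !quot_scale_pi scalerA. Qed.
Fact quot_scale1 : left_id 1 quot_scale.
Proof. by move=> t; rewrite -(quot_repr t) !quot_scale_pi scale1r. Qed.
Fact quot_scaleDr : right_distributive quot_scale +%R.
Proof.
move=> a s t; rewrite -(quot_repr t) -(quot_repr s).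
by rewrite -raddfD !quot_scale_pi -raddfD scalerDr.
Qed.
Fact quot_scaleDl t : {morph quot_scale^~ t : a b / a + b}.
Proof.
by move=> a b; rewrite -(quot_repr t) !quot_scale_pi -raddfD scalerDl.
Qed.
HB.instance Definition _ := GRing.Zmodule_isLmodule.Build R quot_mod
  quot_scaleA quot_scale1 quot_scaleDr quot_scaleDl.

Fact quot_piZ : linear quot_pi.
Proof. by move=> a x y; rewrite raddfD /= -quot_scale_pi. Qed.
End Quotient.

Lemma quotient_type (R : nzRingType) (M : lmodType R) (S : M -> Prop) :
  S 0 -> (forall a x y, S x -> S y -> S (a *: x + y)) ->
  exists (U : lmodType R) (u : {linear M -> U}),
    surj u /\ forall x, u x = 0 <-> S x.
Proof.
move=> S0 SD.
pose T : {pred M} := fun x => `[< S x >].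
have SC : submod_closed T.
  split=> [|a x y /asboolP Sx /asboolP Sy]; apply/asboolP => //.
  exact: SD.
exists (quot_mod (mk_sub SC)), (mk_linear (@quot_piZ _ _ (mk_sub SC))); split.
  by move=> t; exists (repr t); exact: quot_repr.
move=> x; have := quot_pi_eq (mk_sub SC) x 0; rewrite raddf0 subr0 => e.
by apply: (iff_trans e); split=> /asboolP.
Qed.

Section ModuleTheory.
Variables (K : fieldType) (A : falgType K).
Implicit Types (M N P S X Y Z : lmodType A) (C : lmodType A -> Prop).

Lemma isomorphic_bij M N (f : {linear M -> N}) :
  injective f -> surj f -> isomorphic M N.
Proof.
move=> fI fS; exists f; have [g gK] := surj_fun fS.
by exists g => // x; apply: fI; rewrite gK.
Qed.

Lemma isomorphic_refl M : isomorphic M M.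
Proof. by exists (lmap_id M); exists id. Qed.

Lemma isomorphicP M N : isomorphic M N ->
  exists (f : {linear M -> N}) (g : {linear N -> M}), cancel f g /\ cancel g f.
Proof.
case=> f [g fK gK].
have [h hE] : exists h : {linear N -> M}, forall x, f (h x) = lmap_id N x.
  by apply: factor_inj => [|x]; [exact: can_inj fK | exists (g x); rewrite gK].
by exists f, h; split=> x; [apply: (can_inj fK) |]; rewrite hE.
Qed.

Lemma isomorphic_sym M N : isomorphic M N -> isomorphic N M.
Proof. by case/isomorphicP=> f [g [fK gK]]; exists g; exists f. Qed.

Lemma isomorphic_trans M N P :
  isomorphic M N -> isomorphic N P -> isomorphic M P.
Proof.
case=> f fB [g gB]; exists (lmap_comp g f); exact: bij_comp.
Qed.

Lemma short_exact_ker0 X M S (f : {linear X -> M}) (g : {linear M -> S}) :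
  short_exact f g -> forall x, g (f x) = 0.
Proof. by case=> _ e _ x; apply/e; exists x. Qed.

Lemma short_exact_isoM X M N S (f : {linear X -> M}) (g : {linear M -> S})
    (h : {linear M -> N}) (k : {linear N -> M}) : cancel h k -> cancel k h ->
  short_exact f g -> short_exact (lmap_comp h f) (lmap_comp g k).
Proof.
move=> hK kK [fI fg gS]; split=> /=.
- exact: inj_comp (can_inj hK) fI.
- move=> y; rewrite /= fg; split=> -[x xE]; exists x.
    by rewrite /= xE kK.
  by rewrite -xE /= hK.
- by move=> s; have [m <-] := gS s; exists (h m); rewrite /= hK.
Qed.

Lemma filtered_iso C M N : isomorphic M N -> filtered C M -> filtered C N.
Proof.
case/isomorphicP=> h [k [hK kK]] MF; case: MF h k hK kK.
  move=> {}M M0 h k hK kK; apply: Filtered0 => x.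
  by rewrite -(kK x) (M0 (k x)) linear0.
move=> X {}M S f g fg SC XF h k hK kK.
exact: FilteredS (short_exact_isoM hK kK fg) SC XF.
Qed.

Lemma filtered_sub C C' M : (forall S, C S -> C' S) -> filtered C M -> filtered C' M.
Proof.
move=> CC'; elim=> [N N0|X N S f g fg /CC' SC _ XF]; first exact: Filtered0.
exact: FilteredS fg SC XF.
Qed.

Lemma filtered1 C S : C S -> filtered C S.
Proof.
move=> CS; have Z0 : forall x : 'rV[A]_0, x = 0 by move=> x; apply: thinmx0.
apply: (FilteredS (f := lmap_zero _ S) (g := lmap_id S)) (CS) (Filtered0 C Z0).
split=> [x y _|y|y].
- by rewrite (Z0 x) (Z0 y).
- by split=> [/= ->|[x <-]] //; exists 0.
- by exists y.
Qed.

(** Induction on the filtration of N: if Y is the kernel of its top factor N -> S, the preimage V of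
    Y in M is an extension of Y by X. *)
Lemma filtered_extension C X M N (f : {linear X -> M}) (g : {linear M -> N}) :
  short_exact f g -> filtered C X -> filtered C N -> filtered C M.
Proof.
move=> fg XF NF; elim: NF M f g fg => [{}N N0|Y {}N S u w uw CS _ IH] M f g [fI fg gS].
  apply: filtered_iso XF; apply: (isomorphic_bij fI) => y.
  by apply/fg; exact: N0.
have [uI uw0 wS] := uw.
have [V [i [iI iE]]] := kernel_type (lmap_comp w g).
have [j jE] : exists j : {linear V -> Y}, forall x, u (j x) = lmap_comp g i x.
  apply: factor_inj uI _ => x; apply/uw0.
  by apply/(iE (i x)); exists x.
have [k kE] : exists k : {linear X -> V}, forall x, i (k x) = f x.
  apply: factor_inj iI _ => x; apply/iE => /=.
  by rewrite (short_exact_ker0 (And3 fI fg gS)) linear0.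
apply: (FilteredS (f := i) (g := lmap_comp w g)) CS _.
  split=> // s; have [n <-] := wS s; have [m <-] := gS n.
  by exists m.
apply: (IH V k j); split.
- by move=> x y xy; apply: fI; rewrite -!kE xy.
- move=> y; split=> [jy|[x <-]].
    have /fg[x xE] : g (i y) = 0 by rewrite -[g _]jE jy linear0.
    by exists x; apply: iI; rewrite kE.
  apply: uI; rewrite jE /= kE linear0.
  exact: short_exact_ker0 (And3 fI fg gS) _.
- move=> y; have [m mE] := gS (u y).
  have /iE[x xE] : lmap_comp w g m = 0 by rewrite /= mE; apply/uw0; exists y.
  by exists x; apply: uI; rewrite jE /= xE.
Qed.

Lemma simple_modP M : simple_module M -> forall S : M -> Prop,
  S 0 -> (forall a x y, S x -> S y -> S (a *: x + y)) ->
  (forall x, S x -> x = 0) \/ (forall x, S x).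
Proof.
move=> [_ sM] S S0 SD; pose T : {pred M} := fun x => `[< S x >].
have SC : submod_closed T.
  split=> [|a x y /asboolP Sx /asboolP Sy]; apply/asboolP => //.
  exact: SD.
case: (sM T SC) => TE; [left=> x Sx|right=> x].
  by apply/eqP; have := TE x; rewrite inE => <-; apply/asboolP.
by have := TE x; rewrite [RHS]inE => /asboolP.
Qed.

Lemma simple_generator M (l : M) :
  simple_module M -> l != 0 -> forall m, exists a, m = a *: l.
Proof.
move=> sM l0 m.
have [||S0|//] := simple_modP sM (S := fun m => exists a, m = a *: l).
- by exists 0; rewrite scale0r.
- by move=> a x y [b ->] [c ->]; exists (a * b + c); rewrite scalerDl scalerA.
by rewrite (S0 l) ?eqxx // in l0; exists 1; rewrite scale1r.
Qed.

Lemma simple_modI M : (exists x : M, x != 0) ->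
  (forall S : M -> Prop, S 0 -> (forall a x y, S x -> S y -> S (a *: x + y)) ->
    (forall x, S x -> x = 0) \/ (forall x, S x)) -> simple_module M.
Proof.
move=> nz sM; split=> // S [S0 SD].
have [|S0'|ST] := sM (fun x => x \in S) S0; first by move=> a x y; exact: SD.
  left=> x; rewrite inE; apply/idP/eqP => [/S0'//|->]; exact: S0.
by right=> x; rewrite (ST x).
Qed.

Lemma simple_hom_inj M N (f : {linear M -> N}) : simple_module M ->
  (exists x, f x != 0) -> injective f.
Proof.
move=> sM [x fx].
have [||f0|f0] := simple_modP sM (S := fun x => f x = 0).
- exact: linear0.
- by move=> a y z fy fz; rewrite linearP fy fz scaler0 addr0.
- by move=> y z /eqP; rewrite -subr_eq0 -linearB => /eqP/f0/eqP; rewrite subr_eq0 => /eqP.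
- by rewrite f0 eqxx in fx.
Qed.

Lemma simple_hom_surj M N (f : {linear M -> N}) : simple_module N ->
  (exists x, f x != 0) -> surj f.
Proof.
move=> sN [x fx].
have [||f0|f0] := simple_modP sN (S := fun y => exists x, f x = y).
- by exists 0; rewrite linear0.
- by move=> a y z [y' <-] [z' <-]; exists (a *: y' + z'); rewrite linearP.
- by rewrite (f0 (f x)) ?eqxx // in fx; exists x.
- exact: f0.
Qed.

Lemma schur M N (f : {linear M -> N}) : simple_module M -> simple_module N ->
  (exists x, f x != 0) -> isomorphic M N.
Proof.
by move=> sM sN fx; apply: (isomorphic_bij (simple_hom_inj sM fx)); apply: simple_hom_surj.
Qed.

Lemma simple_iso M N : isomorphic M N -> simple_module M -> simple_module N.
Proof.
case/isomorphicP=> f [g [fK gK]] sM; apply: simple_modI => [|S S0 SD].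
  have [[x x0] _] := sM; exists (f x); apply: contra_neq x0 => fx.
  by rewrite -(fK x) fx linear0.
have [||S'|S'] := simple_modP sM (S := fun x => S (f x)).
- by rewrite linear0.
- by move=> a x y; rewrite linearP; exact: SD.
- left=> x Sx; rewrite -(gK x) (S' (g x)) ?linear0 //.
  by rewrite gK.
- by right=> x; rewrite -(gK x).
Qed.

(** Dévissage, first in the source and then in the target. It is applied to modules without a common
    composition factor. *)
Lemma hom_filtered0 C C' M N (f : {linear M -> N}) :
  (forall S S' (h : {linear S -> S'}), C S -> C' S' -> forall x, h x = 0) ->
  filtered C M -> filtered C' N -> forall x, f x = 0.
Proof.
move=> CC' MF NF; elim: MF f => [{}M M0|X {}M S u w uw CS _ IH] f.
  by move=> x; rewrite (M0 x) linear0.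
have [_ uw0 wS] := uw.
have fu0 x : f (u x) = 0 by exact: (IH (lmap_comp f u)).
have [g gE] : exists g : {linear S -> N}, forall x, g (w x) = f x.
  by apply: factor_surj wS _ => x /uw0[y <-].
move=> x; rewrite -gE; move: (w x) => s {f u w uw uw0 wS IH fu0 gE x X M}.
elim: NF g s => [{}N N0|Y {}N S' u w [uI uw0 _] CS' _ IH] g s //.
have [h hE] : exists h : {linear S -> Y}, forall x, u (h x) = g x.
  by apply: factor_inj uI _ => x; apply/uw0; exact: CC' _ _ (lmap_comp w g) CS CS' x.
by rewrite -hE IH linear0.
Qed.

(** The filtration is intersected with N. As the factors are simple, each of them contributes either
    entirely or not at all. *)
Lemma filtered_submodule C M : (forall S, C S -> simple_module S) ->
  (forall S S', isomorphic S S' -> C S -> C S') ->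
  filtered C M -> forall N (f : {linear N -> M}), injective f -> filtered C N.
Proof.
move=> sC iC; elim=> [{}M M0|X {}M S u w uw CS _ IH] N f fI.
  by apply: Filtered0 => x; apply: fI; rewrite (M0 (f x)) (M0 (f 0)).
have [uI uw0 wS] := uw.
have [V [i [iI iE]]] := kernel_type (lmap_comp w f).
have VF : filtered C V.
  have [j jE] : exists j : {linear V -> X}, forall x, u (j x) = lmap_comp f i x.
    by apply: factor_inj uI _ => x; apply/uw0/(iE (i x)); exists x.
  apply: (IH _ j) => x y xy; apply: iI; apply: fI.
  by rewrite -[f _]jE -[RHS]jE xy.
have [[x nx]|nwf] := pselect (exists x, w (f x) != 0).
  apply: (FilteredS (f := i) (g := lmap_comp w f)) (CS) VF; split=> //.
  by apply: (simple_hom_surj (sC _ CS)); exists x.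
apply: filtered_iso VF; apply: (isomorphic_bij iI) => x.
by apply/iE/eqP/negPn/negP => nx; apply: nwf; exists x.
Qed.

Lemma fin_dim_span M (T : finType) (s : T -> M) :
  (forall x, exists c : T -> K, x = \sum_i (c i)%:A *: s i) -> fin_dim M.
Proof.
move=> sM; exists [seq s i | i <- enum T] => x; have [c ->] := sM x.
have sz : size [seq s i | i <- enum T] = #|T| by rewrite size_map -cardE.
exists (fun i => c (enum_val (cast_ord sz i))).
rewrite (reindex (fun i : 'I_(size [seq s i | i <- enum T]) => enum_val (cast_ord sz i))) /=.
  apply: eq_bigr => i _; congr (_ *: _).
  (* [nth_map] needs a default element of T; if T is empty there is no index to treat. *)
  have [x0 _ | e] := pickP [pred _ : T | true].
    rewrite (nth_map x0); last by rewrite -cardE -sz.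
    by rewrite (enum_val_nth x0).
  by have := e (enum_val (cast_ord sz i)).
exists (fun t => cast_ord (esym sz) (enum_rank t)) => t _.
  by rewrite enum_valK cast_ordK.
by rewrite cast_ordKV enum_rankK.
Qed.
End ModuleTheory.

Lemma fin_dim_image (K : fieldType) (R S : falgType K) (M : lmodType R)
    (N : lmodType S) (f : {additive M -> N}) :
  (forall (k : K) x, f (k%:A *: x) = k%:A *: f x) -> surj f ->
  fin_dim M -> fin_dim N.
Proof.
move=> fZ fS [s sM]; apply: (@fin_dim_span _ _ _ 'I_(size s) (fun i => f s`_i)).
move=> y; have [x <-] := fS y; have [c ->] := sM x; exists c.
by rewrite raddf_sum; apply: eq_bigr => i _; rewrite fZ.
Qed.

Lemma fin_dim_surj (K : fieldType) (R : falgType K) (M N : lmodType R)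
    (f : {linear M -> N}) : surj f -> fin_dim M -> fin_dim N.
Proof. by move=> fS; apply: (fin_dim_image _ fS) => k x; exact: (linearZZ f). Qed.

Lemma fin_dim_regular (K : fieldType) (R : falgType K) : fin_dim (R^o).
Proof.
pose s (i : 'I_(\dim {:R})) : R^o := ((vbasis {:R})`_i : R).
apply: (@fin_dim_span _ R R^o _ s) => x.
exists (fun i => coord (vbasis {:R}) i x).
rewrite [LHS](coord_vbasis (memvf (x : R))); apply: eq_bigr => i _.
by rewrite -[LHS]mulr_algl.
Qed.

(** * Projective covers and standard modules *)

Section ProjectiveCovers.
Variables (K : fieldType) (A : falgType K).
Implicit Types (M N P : lmodType A).

Lemma cover_superfluous P M (p : {linear P -> M}) : projective_cover p ->
  forall S : P -> Prop, S 0 -> (forall a x y, S x -> S y -> S (a *: x + y)) ->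
  (forall x, exists2 y, S y & p (x - y) = 0) -> forall x, S x.
Proof.
move=> [_ _ pS] S S0 SD Sp; pose T : {pred P} := fun x => `[< S x >].
have SC : submod_closed T.
  split=> [|a x y /asboolP Sx /asboolP Sy]; apply/asboolP => //.
  exact: SD.
have TE : T =i predT.
  by apply: pS SC _ => x; have [y Sy pxy] := Sp x; exists y => //; apply/asboolP.
by move=> x; have := TE x; rewrite [RHS]inE => /asboolP.
Qed.

Lemma coverI P M (p : {linear P -> M}) : projective P -> surj p ->
  (forall S : P -> Prop, S 0 -> (forall a x y, S x -> S y -> S (a *: x + y)) ->
    (forall x, exists2 y, S y & p (x - y) = 0) -> forall x, S x) ->
  projective_cover p.
Proof.
move=> Pp pS sup; split=> // S [S0 SD] Sp x.
by rewrite (sup (fun x => x \in S)).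
Qed.

Lemma cover_unique P P' M (p : {linear P -> M}) (p' : {linear P' -> M}) :
  projective_cover p -> projective_cover p' ->
  exists (h : {linear P -> P'}) (k : {linear P' -> P}),
    [/\ cancel h k, cancel k h & forall x, p' (h x) = p x].
Proof.
move=> cp cp'; have [[Pf Pp] pS _] := cp; have [[Pf' Pp'] pS' _] := cp'.
have [h hE] := Pp _ _ p' p Pf' (fin_dim_surj pS Pf) pS'.
have hS : surj h.
  apply: (cover_superfluous cp') => [|a x y [x' <-] [y' <-]|x].
  - by exists 0; rewrite linear0.
  - by exists (a *: x' + y'); rewrite linearP.
  - have [y yE] := pS (p' x); exists (h y); first by exists y.
    by rewrite linearB /= hE yE subrr.
have [k kE] := Pp' _ _ h (lmap_id P') Pf Pf' hS.
have kK : cancel k h by move=> x; rewrite kE.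
have kS : surj k.
  apply: (cover_superfluous cp) => [|a x y [x' <-] [y' <-]|x].
  - by exists 0; rewrite linear0.
  - by exists (a *: x' + y'); rewrite linearP.
  - by exists (k (h x)); [exists (h x) | rewrite linearB /= -!hE kK subrr].
exists h, k; split=> // x.
by have [y <-] := kS x; rewrite kK.
Qed.

Lemma cover_iso P M N (p : {linear P -> M}) (h : {linear M -> N}) :
  bijective h -> projective_cover p -> projective_cover (lmap_comp h p).
Proof.
move=> [g hK gK] cp; have [Pp pS _] := cp.
apply: coverI => // [y|S S0 SD Sp].
  by have [x xE] := pS (g y); exists x; rewrite /= xE gK.
apply: (cover_superfluous cp) => // x; have [y Sy pxy] := Sp x; exists y => //.
by apply: (can_inj hK); rewrite linear0.
Qed.
End ProjectiveCovers.

(** * Quasi-hereditary algebras with simple standard modules *)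

Section SimpleStandards.
Variables (K : fieldType) (A : falgType K) (I : finType).
Variables (L : I -> lmodType A) (le : rel I).
Implicit Types (M N P D X : lmodType A).

Lemma standard_module_cover i D P (p : {linear P -> L i}) :
  standard_module L le i D -> projective_cover p ->
  exists q : {linear P -> D}, standard_quotient L le i q.
Proof.
move=> [P' [p' [q' [cp' [q'S q'F q'U]]]]] cp.
have [h [k [hK kK _]]] := cover_unique cp cp'.
exists (lmap_comp q' h); split=> // [y|D' q'' q''S D'F x /= qx].
  by have [x xE] := q'S y; exists (k x); rewrite /= kK.
rewrite -(hK x); apply: (q'U _ (lmap_comp q'' k)) qx => // y.
by have [z <-] := q''S y; exists (h z); rewrite /= hK.
Qed.

Lemma standard_quotient_iso i D D' P (q : {linear P -> D}) (h : {linear D -> D'}) :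
  bijective h -> standard_quotient L le i q ->
  standard_quotient L le i (lmap_comp h q).
Proof.
move=> hB [qS DF qU]; have [g hK gK] := hB; split=> [y||].
- by have [x xE] := qS (g y); exists x; rewrite /= xE gK.
- by apply: filtered_iso DF; exists h.
- by move=> X q' q'S XF x /= hqx; apply: qU => //; apply: (can_inj hK); rewrite linear0.
Qed.

Lemma standard_module_iso i D D' : isomorphic D D' ->
  standard_module L le i D -> standard_module L le i D'.
Proof.
move=> [h hB] [P [p [q [cp qq]]]]; exists P, p, (lmap_comp h q).
by split=> //; exact: standard_quotient_iso.
Qed.

Definition strictly_above (i : I) (S : lmodType A) : Prop :=
  exists j, [/\ le i j, i != j & isomorphic S (L j)].

(** Quasi-heredity with simple standard modules, phrased through covers and simples only
    ([simple_stratifiedP], [stratified_qh]). In this form it can be moved between B and its two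
    quotients. *)
Definition simple_stratified : Prop :=
  forall i, exists (P X : lmodType A) (p : {linear P -> L i}) (f : {linear X -> P}),
    [/\ projective_cover p, short_exact f p & filtered (strictly_above i) X].

Hypothesis le_refl : reflexive le.
Hypothesis L_simple : forall i, simple_module (L i).

(** By reflexivity [L i] is itself a quotient of P with factors below i, so P -> [L i] factors
    through D, and Schur's lemma applies. *)
Lemma standard_simple_iso i D : standard_module L le i D -> simple_module D ->
  isomorphic D (L i).
Proof.
move=> [P [p [q [[_ pS _] [qS _ qU]]]]] sD.
have [r rE] : exists r : {linear D -> L i}, forall x, r (q x) = p x.
  apply: factor_surj qS _; apply: qU => //.
  by apply: filtered1; exists i => //; exact: isomorphic_refl.
apply: (schur (f := r)) => //.
have [[y y0] _] := L_simple i; have [x xE] := pS y.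
by exists (q x); rewrite rE xE.
Qed.

Lemma simple_stratifiedP : quasi_hereditary L le ->
  (forall i D, standard_module L le i D -> simple_module D) -> simple_stratified.
Proof.
move=> qh sD i; have [P [D [p [q [r [cp qD pE [X [f [fq XF]]] _]]]]]] := qh i.
have Dstd : standard_module L le i D by exists P, p, q.
exists P, X, p, f; split=> //; last first.
  apply: filtered_sub XF => S [j [ij nij Sj]]; exists j; split=> //.
  by apply: standard_simple_iso => //; exact: sD Sj.
have [fI fq0 qS] := fq; have [_ pS _] := cp.
have rI : injective r.
  apply: simple_hom_inj; first exact: sD Dstd.
  have [[y y0] _] := L_simple i; have [x xE] := pS y.
  by exists (q x); rewrite -pE xE.
split=> // x; rewrite -fq0 pE; split=> [|->]; last by rewrite linear0.
by rewrite -[X in _ = X](linear0 r) => /rI.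
Qed.

Lemma stratified_any_cover i P X (p : {linear P -> L i}) (f : {linear X -> P}) :
  simple_stratified -> projective_cover p -> short_exact f p ->
  filtered (strictly_above i) X.
Proof.
move=> /(_ i)[P' [X' [p' [f' [cp' [fI' fp' pS'] XF']]]]] cp [fI fp pS].
have [h [k [hK kK hE]]] := cover_unique cp' cp.
apply: filtered_iso XF'.
have [g gE] : exists g : {linear X' -> X}, forall x, f (g x) = lmap_comp h f' x.
  by apply: factor_inj fI _ => x; apply/fp; rewrite /= hE; apply/fp'; exists x.
apply: (isomorphic_bij (f := g)) => [x y xy|y].
  by apply: fI'; apply: (can_inj hK); rewrite -[h _]gE xy gE.
have /fp'[x xE] : p' (k (f y)) = 0 by rewrite -hE kK; apply/fp; exists y.
by exists x; apply: fI; rewrite gE /= xE kK.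
Qed.

Lemma stratified_qh : antisymmetric le -> (forall i j, isomorphic (L i) (L j) -> i = j) ->
  simple_stratified -> quasi_hereditary L le /\
    forall i D, standard_module L le i D -> simple_module D.
Proof.
move=> le_anti L_inj strat.
have below1 i : factors_below L le i (L i).
  by apply: filtered1; exists i => //; exact: isomorphic_refl.
(* The kernel of p has factors strictly above i and D' has factors below i. By antisymmetry they
   share none, so every admissible quotient map kills the kernel. *)
have stdq i P (p : {linear P -> L i}) : projective_cover p -> standard_quotient L le i p.
  move=> cp; have [_ pS _] := cp; split=> // D' q' q'S D'F.
  have [X [f [fI fp]]] := kernel_type p.
  have XF := stratified_any_cover strat cp (And3 fI fp pS).
  move=> x /fp[y <-]; apply: (hom_filtered0 (lmap_comp q' f) _ XF D'F).
  move=> S S' h [j [ij nij Sj]] [j' j'i S'j'] s; apply/eqP/negPn/negP => hs.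
  have SS' : isomorphic S S'.
    apply: (schur (f := h)); last by exists s.
      exact: simple_iso (isomorphic_sym Sj) (L_simple j).
    exact: simple_iso (isomorphic_sym S'j') (L_simple j').
  have jj' := L_inj _ _ (isomorphic_trans (isomorphic_sym Sj) (isomorphic_trans SS' S'j')).
  by move: nij; rewrite (le_anti i j) ?eqxx // ij jj'.
have std i S : isomorphic S (L i) -> standard_module L le i S.
  move=> Si; have [P [X [p [f [cp _ _]]]]] := strat i.
  have [h hB] := isomorphic_sym Si.
  by exists P, p, (lmap_comp h p); split=> //; apply: standard_quotient_iso => //; exact: stdq.
split=> [i|i D [P [p [q [cp [qS DF qU]]]]]].
  have [P [X [p [f [cp fp XF]]]]] := strat i.
  exists P, (L i), p, p, (lmap_id (L i)); split=> //.
  - exact: stdq.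
  - exists X, f; split=> //; apply: filtered_sub XF => S [j [ij nij Sj]].
    by exists j; split=> //; exact: std.
  - exists ('rV[A]_0), (lmap_zero _ _); split; last first.
      by apply: Filtered0 => x; exact: thinmx0.
    split=> [x y _|y|y]; [by rewrite (thinmx0 x) (thinmx0 y)| |by exists y].
    by split=> [/= ->|[x <-]] //; exists 0.
have [pS _ pU] := stdq _ _ _ cp.
have [r rE] : exists r : {linear L i -> D}, forall x, r (p x) = q x.
  by apply: factor_surj pS _; exact: pU.
apply: simple_iso (L_simple i); apply: (isomorphic_bij (f := r)); last first.
  by move=> y; have [x <-] := qS y; exists (p x).
move=> x y; have [x' <-] := pS x; have [y' <-] := pS y => /eqP.
rewrite -subr_eq0 -linearB -[_ - _]linearB rE => /eqP /(qU _ _ pS (below1 i))/eqP.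
by rewrite linearB subr_eq0 => /eqP.
Qed.
End SimpleStandards.

(** * Restriction and reduction along a quotient *)

Definition res (K : fieldType) (R S : falgType K) (rho : {lrmorphism R -> S})
  (N : lmodType S) : Type := N.

Section Restriction.
Variables (K : fieldType) (R S : falgType K) (rho : {lrmorphism R -> S}).
Local Notation res := (res rho).

Section Instance.
Variable N : lmodType S.
HB.instance Definition _ := GRing.Zmodule.on (res N).

Definition res_scale (a : R) (x : res N) : res N := rho a *: (x : N).

Fact res_scaleA a b x : res_scale a (res_scale b x) = res_scale (a * b) x.
Proof. by rewrite /res_scale scalerA rmorphM. Qed.
Fact res_scale1 : left_id 1 res_scale.
Proof. by move=> x; rewrite /res_scale rmorph1 scale1r. Qed.
Fact res_scaleDr : right_distributive res_scale +%R.
Proof. by move=> a x y; rewrite /res_scale scalerDr. Qed.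
Fact res_scaleDl x : {morph res_scale^~ x : a b / a + b}.
Proof. by move=> a b; rewrite /res_scale rmorphD scalerDl. Qed.
HB.instance Definition _ := GRing.Zmodule_isLmodule.Build R (res N)
  res_scaleA res_scale1 res_scaleDr res_scaleDl.
End Instance.

Lemma res_scaleE (N : lmodType S) a (x : res N) : a *: x = rho a *: (x : N).
Proof. by []. Qed.

Lemma res_linear (M N : lmodType S) (f : {linear M -> N}) :
  exists g : {linear res M -> res N}, forall x, g x = f x.
Proof.
have fL : linear (f : res M -> res N).
  by move=> a x y; rewrite !res_scaleE linearP.
by exists (mk_linear fL).
Qed.

Definition res_map (M N : lmodType S) (f : {linear M -> N}) :
  {linear res M -> res N} := projT1 (cid (res_linear f)).

Lemma res_mapE (M N : lmodType S) (f : {linear M -> N}) x : res_map f x = f x.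
Proof. exact: (projT2 (cid (res_linear f))). Qed.

Lemma res_iso (M N : lmodType S) : isomorphic M N -> isomorphic (res M) (res N).
Proof.
case/isomorphicP=> f [g [fK gK]].
by exists (res_map f), (res_map g) => x; rewrite !res_mapE.
Qed.

Lemma res_short_exact (X M N : lmodType S) (f : {linear X -> M}) (g : {linear M -> N}) :
  short_exact f g -> short_exact (res_map f) (res_map g).
Proof.
move=> [fI fg gS]; split=> [x y|y|y].
- by rewrite !res_mapE => /fI.
- rewrite res_mapE; apply: (iff_trans (fg y)).
  by split=> -[x xE]; exists x; rewrite res_mapE in xE *.
- by have [x xE] := gS y; exists x; rewrite res_mapE.
Qed.

Lemma res_filtered (C : lmodType S -> Prop) (C' : lmodType R -> Prop) (M : lmodType S) :
  (forall N, C N -> C' (res N)) -> filtered C M -> filtered C' (res M).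
Proof.
move=> CC'; elim=> [N N0|X N T f g fg /CC' CT _ XF]; first exact: Filtered0.
exact: FilteredS (res_short_exact fg) CT XF.
Qed.

Hypothesis rhoS : surj rho.

Lemma fin_dim_res (N : lmodType S) : fin_dim N -> fin_dim (res N).
Proof.
apply: (fin_dim_image (f := idfun : {additive N -> res N})) => [k x|x].
  by rewrite res_scaleE /= linearZ /= rmorph1.
by exists x.
Qed.

(** Restriction along a surjection is full. *)
Lemma linear_res (M N : lmodType S) (g : {linear res M -> res N}) :
  exists f : {linear M -> N}, forall x, f x = g x.
Proof.
have gL : linear (g : M -> N).
  by move=> a x y; have [b <-] := rhoS a; exact: (linearP g b x y).
by exists (mk_linear gL).
Qed.

Lemma iso_res (M N : lmodType S) : isomorphic (res M) (res N) -> isomorphic M N.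
Proof.
case=> g gB; have [f fE] := linear_res g.
by exists f; apply: (eq_bij gB) => x; rewrite fE.
Qed.

Lemma simple_res (M : lmodType S) : simple_module M -> simple_module (res M).
Proof.
move=> sM; apply: simple_modI => [|T T0 TD]; first by have [] := sM.
apply: (simple_modP sM T0) => a x y; have [b <-] := rhoS a; exact: TD.
Qed.

Lemma res_simple (M : lmodType S) : simple_module (res M) -> simple_module M.
Proof.
move=> sM; apply: simple_modI => [|T T0 TD]; first by have [] := sM.
exact: (simple_modP sM T0 (fun a x y => TD (rho a) x y)).
Qed.
End Restriction.

Definition base_alg (K : fieldType) : falgType K := K^o.

(* By iq_ker the kernel is the right ideal generated by the idempotent. *)
Record idem_quot (K : fieldType) (R S : falgType K) := IdemQuot {
  iq_map :> {lrmorphism R -> S};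
  iq_idem : R;
  iq_surj : surj iq_map;
  iq_idemK : iq_idem * iq_idem = iq_idem;
  iq_ker : forall x, iq_map x = 0 <-> iq_idem * x = x
}.

Section Reduction.
Variables (K : fieldType) (R S : falgType K) (q : idem_quot R S).
Local Notation g := (iq_idem q).

Lemma iq_map_idem : q g = 0.
Proof. exact/iq_ker/iq_idemK. Qed.

(** The right ideal gR is a kernel, hence also a left ideal. This is what makes the fixed points gM
    of g a submodule, see [idem_fixedP]. *)
Lemma iq_idemM a : g * (a * g) = a * g.
Proof. by apply/iq_ker; rewrite rmorphM /= iq_map_idem mulr0. Qed.

Lemma idem_fixedP (M : lmodType R) a (x y : M) :
  g *: x = x -> g *: y = y -> g *: (a *: x + y) = a *: x + y.
Proof.
move=> gx gy; rewrite scalerDr gy -{1}gx !scalerA -mulrA iq_idemM.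
by rewrite -scalerA gx.
Qed.

Lemma idem_dichotomy (M : lmodType R) : simple_module M ->
  (forall m : M, g *: m = 0) \/ (forall m : M, g *: m = m).
Proof.
move=> sM; have [||g0|g1] := simple_modP sM (S := fun m => g *: m = m).
- exact: scaler0.
- exact: idem_fixedP.
- by left=> m; apply: g0; rewrite scalerA iq_idemK.
- by right.
Qed.

Definition iq_lift (s : S) : R := projT1 (cid (iq_surj q s)).

Lemma iq_liftK : cancel iq_lift q.
Proof. by move=> s; exact: projT2 (cid (iq_surj q s)). Qed.

Lemma res_idem0 (N : lmodType S) (x : res q N) : g *: x = 0.
Proof. by rewrite res_scaleE iq_map_idem; exact: (scale0r (x : N)). Qed.

Definition red_pred (M : lmodType R) : {pred M} := fun m => g *: m == 0.
Arguments red_pred : clear implicits.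

(* M / gM, realised as the complement (1 - g)M, with the action transported. *)
Definition red (M : lmodType R) : Type := {m : M | m \in red_pred M}.

Section Instance.
Variable M : lmodType R.

Fact red_pred_closed : zmod_closed (red_pred M).
Proof.
split=> [|x y /eqP gx /eqP gy]; rewrite -topredE /= /red_pred ?scaler0 //.
by rewrite scalerBr gx gy subrr.
Qed.
HB.instance Definition _ := GRing.isZmodClosed.Build M (red_pred M) red_pred_closed.

HB.instance Definition _ := SubType.on (red M).
HB.instance Definition _ := [Choice of red M by <:].
HB.instance Definition _ := [SubChoice_isSubZmodule of red M by <:].

Fact eta_proof (m : M) : m - g *: m \in red_pred M.
Proof. by rewrite -topredE /= /red_pred scalerBr scalerA iq_idemK subrr. Qed.

Definition eta (m : M) : red M := Sub (m - g *: m) (eta_proof m).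

Lemma val_eta m : val (eta m) = m - g *: m.
Proof. by []. Qed.

Fact etaB : zmod_morphism eta.
Proof.
move=> x y; apply: val_inj; rewrite raddfB /=.
by rewrite scalerBr !opprD !opprK addrACA.
Qed.
HB.instance Definition _ := GRing.isZmodMorphism.Build M (red M) eta etaB.

Lemma val_redD (x y : red M) : val (x + y) = val x + val y.
Proof. by []. Qed.

Lemma red_val0 (x : red M) : g *: val x = 0.
Proof. exact/eqP/(valP x). Qed.

Lemma eta_val (x : red M) : eta (val x) = x.
Proof. by apply: val_inj; rewrite val_eta red_val0 subr0. Qed.

Lemma eta_eq0 m : eta m = 0 <-> g *: m = m.
Proof.
split=> [/(congr1 val)/=/eqP|gm]; first by rewrite subr_eq0 => /eqP.
by apply: val_inj; rewrite val_eta gm subrr.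
Qed.

Lemma eta_ker a m : q a = 0 -> eta (a *: m) = 0.
Proof. by move/iq_ker=> ga; apply/eta_eq0; rewrite scalerA ga. Qed.

Lemma eta_idem m : eta (g *: m) = 0.
Proof. exact/eta_ker/iq_map_idem. Qed.

Definition red_scale (s : S) (x : red M) : red M := eta (iq_lift s *: val x).

Lemma red_scale_eta a m : red_scale (q a) (eta m) = eta (a *: m).
Proof.
apply/eqP; rewrite -subr_eq0 -raddfB /=; apply/eqP.
rewrite scalerBr addrAC -scalerBl raddfB /= eta_ker ?sub0r; last first.
  by rewrite rmorphB /= iq_liftK subrr.
by rewrite scalerA eta_ker ?oppr0 // rmorphM /= iq_map_idem mulr0.
Qed.

Fact red_scaleA a b x : red_scale a (red_scale b x) = red_scale (a * b) x.
Proof.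
rewrite -(iq_liftK a) -(iq_liftK b) -(eta_val x) -rmorphM !red_scale_eta.
by rewrite scalerA.
Qed.
Fact red_scale1 : left_id 1 red_scale.
Proof.
by move=> x; rewrite -(eta_val x) -(rmorph1 q) red_scale_eta scale1r.
Qed.
Fact red_scaleDr : right_distributive red_scale +%R.
Proof. by move=> a x y; rewrite /red_scale val_redD scalerDr raddfD. Qed.
Fact red_scaleDl x : {morph red_scale^~ x : a b / a + b}.
Proof.
move=> a b /=; rewrite -(iq_liftK a) -(iq_liftK b) -rmorphD -(eta_val x).
by rewrite !red_scale_eta scalerDl raddfD.
Qed.
HB.instance Definition _ := GRing.Zmodule_isLmodule.Build S (red M)
  red_scaleA red_scale1 red_scaleDr red_scaleDl.

Lemma etaZ a m : eta (a *: m) = q a *: eta m.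
Proof. exact/esym/red_scale_eta. Qed.

Lemma val_redZ a (x : red M) : val (q a *: x) = a *: val x - g *: (a *: val x).
Proof. by rewrite -{1}(eta_val x) -etaZ val_eta. Qed.

Lemma val_resB (x y : res q (red M)) : val (x - y) = val x - val y.
Proof. by []. Qed.

Lemma eta_surj : surj eta.
Proof. by move=> x; exists (val x); exact: eta_val. Qed.

Fact eta_linear : linear (eta : M -> res q (red M)).
Proof. by move=> a x y; rewrite raddfD /= etaZ. Qed.

Definition unit_map : {linear M -> res q (red M)} := mk_linear eta_linear.

Lemma unit_mapE m : unit_map m = eta m. Proof. by []. Qed.

Lemma fin_dim_red : fin_dim M -> fin_dim (red M).
Proof.
apply: (fin_dim_image (f := eta : {additive M -> red M})) eta_surj => k x /=.
by rewrite etaZ linearZ /= rmorph1.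
Qed.

(** Reduction is left adjoint to restriction; [red_untranspose] is the other direction. *)
Lemma red_transpose (N : lmodType S) (f : {linear M -> res q N}) :
  exists h : {linear red M -> N}, forall x, h (eta x) = f x.
Proof.
have fE x : f (val (eta x)) = f x.
  rewrite val_eta linearB linearZ /= res_scaleE iq_map_idem.
  by rewrite [X in _ - X](scale0r (f x : N)) subr0.
have fL : linear ((fun x => f (val x)) : red M -> N).
  move=> a x y; rewrite -(iq_liftK a) -{1}(eta_val x) -etaZ -{1}(eta_val y).
  by rewrite -raddfD fE linearD linearZ.
by exists (mk_linear fL).
Qed.
End Instance.

Lemma red_untranspose (M : lmodType R) (N : lmodType S) (f : {linear red M -> N}) :
  exists h : {linear M -> res q N}, forall x, h x = f (eta x).
Proof.
have hL : linear ((fun x => f (eta x)) : M -> res q N).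
  by move=> a x y; rewrite raddfD /= etaZ linearD linearZ.
by exists (mk_linear hL).
Qed.

Lemma eta_iq_inj (M : lmodType R) : (forall x : M, g *: x = 0) -> injective (@eta M).
Proof. by move=> gM x y /(congr1 val); rewrite !val_eta !gM !subr0. Qed.

Lemma red_map_exists (M N : lmodType R) (f : {linear M -> N}) :
  exists h : {linear red M -> red N}, forall x, h (eta x) = eta (f x).
Proof. exact: (red_transpose (lmap_comp (unit_map N) f)). Qed.

Definition red_map (M N : lmodType R) (f : {linear M -> N}) :
  {linear red M -> red N} := projT1 (cid (red_map_exists f)).

Lemma red_mapE (M N : lmodType R) (f : {linear M -> N}) x :
  red_map f (eta x) = eta (f x).
Proof. exact: (projT2 (cid (red_map_exists f))). Qed.

Lemma val_red_map (M N : lmodType R) (f : {linear M -> N}) x :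
  val (red_map f x) = f (val x).
Proof.
by rewrite -{1}(eta_val x) red_mapE val_eta -linearZ red_val0 linear0 subr0.
Qed.

(** On underlying groups [red] cuts out the summand (1 - g)M, and maps are computed on
    representatives, so exactness in the middle is inherited. *)
Lemma red_exact (X Y Z : lmodType R) (f : {linear X -> Y}) (h : {linear Y -> Z}) :
  exact_at f h -> exact_at (red_map f) (red_map h).
Proof.
move=> fh y; split=> [hy|[x <-]].
  have /fh[x xE] : h (val y) = 0 by rewrite -val_red_map hy.
  by exists (eta x); rewrite red_mapE xE eta_val.
rewrite -(eta_val x) !red_mapE (_ : h _ = 0) ?raddf0 //.
by apply/fh; exists (val x).
Qed.

Lemma red_surj (X Y : lmodType R) (f : {linear X -> Y}) : surj f -> surj (red_map f).
Proof.
by move=> fS y; have [x xE] := fS (val y); exists (eta x); rewrite red_mapE xE eta_val.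
Qed.

Lemma red_inj (X Y : lmodType R) (f : {linear X -> Y}) :
  injective f -> injective (red_map f).
Proof. by move=> fI x y /(congr1 val); rewrite !val_red_map => /fI/val_inj. Qed.

Lemma red_short_exact (X Y Z : lmodType R) (f : {linear X -> Y}) (h : {linear Y -> Z}) :
  short_exact f h -> short_exact (red_map f) (red_map h).
Proof.
by move=> [fI fh hS]; split; [exact: red_inj|exact: red_exact|exact: red_surj].
Qed.

Lemma red_iso (M N : lmodType R) : isomorphic M N -> isomorphic (red M) (red N).
Proof.
case=> f [h fK hK]; apply: (isomorphic_bij (f := red_map f)).
  exact/red_inj/(can_inj fK).
by apply: red_surj => y; exists (h y).
Qed.

Lemma red_res (N : lmodType S) : isomorphic (red (res q N)) N.
Proof.
have [h hE] := red_transpose (lmap_id (res q N)).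
apply: (isomorphic_bij (f := h)) => [x y|y]; last by exists (eta (y : res q N)); rewrite hE.
by rewrite -(eta_val x) -(eta_val y) !hE /= => ->.
Qed.

Lemma res_red (M : lmodType R) : (forall x : M, g *: x = 0) ->
  isomorphic M (res q (red M)).
Proof.
move=> gM; apply: (isomorphic_bij (f := unit_map M)) => [x y|y].
  by move/(congr1 val); rewrite !val_eta !gM !subr0.
exact: eta_surj.
Qed.

Lemma red_eq0 (M : lmodType R) : (forall x : M, g *: x = x) -> forall x : red M, x = 0.
Proof. by move=> gM x; rewrite -(eta_val x); apply/eta_eq0. Qed.

(** A left adjoint of an exact functor preserves projectives; restriction also keeps the test
    modules finite-dimensional. *)
Lemma red_projective (P : lmodType R) : projective P -> projective (red P).
Proof.
move=> [Pf Pp]; split=> [|X Y f h Xf Yf fS]; first exact: fin_dim_red.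
have [|||k kE] := Pp _ _ (res_map q f) (lmap_comp (res_map q h) (unit_map P)).
- exact: fin_dim_res.
- exact: fin_dim_res.
- by move=> y; have [x xE] := fS y; exists x; rewrite res_mapE.
have [k' k'E] := red_transpose k.
by exists k' => x; rewrite -(eta_val x) k'E -(@res_mapE _ _ _ q _ _ f) kE /= res_mapE.
Qed.

(** Superfluity is tested on the preimage in P of a submodule of [red P]. Since g kills M, an
    equality in [red M] is already one in M. *)
Lemma red_cover (P M : lmodType R) (p : {linear P -> M}) :
  (forall x : M, g *: x = 0) -> projective_cover p -> projective_cover (red_map p).
Proof.
move=> gM cp; have [Pp pS _] := cp; apply: coverI.
- exact: red_projective.
- exact: red_surj.
move=> T T0 TD Tp x; rewrite -(eta_val x); move: (val x).
apply: (cover_superfluous cp (S := fun y => T (eta y))) => [|a y z Ty Tz|y].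
- by rewrite raddf0.
- by rewrite raddfD /= etaZ; exact: TD.
have [z Tz pz] := Tp (eta y); exists (val z); first by rewrite eta_val.
move: pz; rewrite -{1}(eta_val z) -raddfB red_mapE => /eta_eq0.
by rewrite gM.
Qed.

Lemma red_filtered (C : lmodType R -> Prop) (C' : lmodType S -> Prop) (M : lmodType R) :
  (forall N, C N -> C' (red N) \/ forall x : red N, x = 0) ->
  filtered C M -> filtered C' (red M).
Proof.
move=> CC'; elim=> [N N0|X N T f h fh CT _ XF].
  by apply: Filtered0 => x; apply: val_inj; rewrite (N0 (val x)).
have [rfI rfh rhS] := red_short_exact fh.
case: (CC' _ CT) => [C'T|T0]; first exact: FilteredS (And3 rfI rfh rhS) C'T XF.
apply: filtered_iso XF; apply: (isomorphic_bij rfI) => y.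
by apply/rfh; exact: T0.
Qed.

(* A map into red M whose source is fixed by an element a lands in a part of M on
   which the transported action is the original one. *)
Lemma val_linear (M N : lmodType R) (a : R) (f : {linear N -> res q (red M)}) :
  (forall x : N, a *: x = x) -> (forall b, g * (b * a) = 0) ->
  exists h : {linear N -> M}, forall x, h x = val (f x).
Proof.
move=> aN ga.
have fZ b x : val (f (b *: x)) = b *: val (f x) - g *: (b *: val (f x)).
  by rewrite -val_redZ -res_scaleE -linearZZ.
have fa x : val (f x) = a *: val (f x).
  rewrite -{1}(aN x) fZ scalerA (_ : g * a = 0) ?scale0r ?subr0 //.
  by rewrite -[a]mul1r ga.
have fL : linear ((fun x => val (f x)) : N -> M).
  move=> b x y; rewrite linearD val_redD fZ.
  rewrite [X in _ - X](_ : _ = 0) ?subr0 // scalerA fa scalerA -mulrA.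
  by rewrite ga scale0r.
by exists (mk_linear fL).
Qed.
End Reduction.

(** * Induction *)

Section Induction.
Variables (K : fieldType) (A : falgType K) (B : {aspace A}).
Implicit Types (M N : lmodType (subvs_of B)).

Lemma induced_scale N a a' (n : N) :
  a *: (pure a' n : induced N) = pure (a * a') n.
Proof. exact: tensor_scale_pure. Qed.

Lemma induced_ext N (V : zmodType) (f g : {additive induced N -> V}) :
  (forall a n, f (pure a n) = g (pure a n)) -> f =1 g.
Proof. by apply: tensor_ext => x y; rewrite raddfB. Qed.

(** The projection onto the quotient by S vanishes on pure tensors, hence everywhere. *)
Lemma induced_ind N (S : induced N -> Prop) :
  S 0 -> (forall a x y, S x -> S y -> S (a *: x + y)) -> (forall a n, S (pure a n)) ->
  forall x, S x.
Proof.
move=> S0 SD Sp x; have [U [u [_ uS]]] := quotient_type S0 SD; apply/uS.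
move: x; apply: (induced_ext (f := u) (g := lmap_zero _ _)) => a n.
exact/uS.
Qed.

Lemma induced_lift N (V : lmodType A) (f : A -> N -> V) : balanced f ->
  (forall c a n, f (c * a) n = c *: f a n) ->
  exists h : {linear induced N -> V}, forall a n, h (pure a n) = f a n.
Proof.
move=> fB fZ; pose hA := GRing.isZmodMorphism.Build _ _ _ (tensor_liftB fB).
pose h : {additive induced N -> V} := HB.pack (tensor_lift f) hA.
have hE a n : h (pure a n) = f a n by exact: tensor_lift_pure.
have hZ c (x : induced N) : h (c *: x) = c *: h x.
  pose sc (W : lmodType A) := GRing.isZmodMorphism.Build W W ( *:%R c) (scalerBr c).
  pose s1 : {additive induced N -> induced N} := HB.pack ( *:%R c) (sc (induced N)).
  pose s2 : {additive V -> V} := HB.pack ( *:%R c) (sc V).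
  move: x; apply: (@induced_ext _ _ (h \o s1 : {additive _ -> _}) (s2 \o h : {additive _ -> _})).
  move=> a n; rewrite -[RHS]/(c *: h (pure a n)).
  by rewrite -[LHS]/(h (c *: (pure a n : induced N))) induced_scale !hE fZ.
have hL : linear h by move=> c x y; rewrite raddfD hZ.
by exists (mk_linear hL).
Qed.

Lemma induced_map_iso M N : isomorphic M N -> isomorphic (induced M) (induced N).
Proof.
case/isomorphicP=> f [g [fK gK]].
exists (induced_map f); exists (induced_map g).
  apply: (@induced_ext _ _ (lmap_comp (induced_map g) (induced_map f)) (lmap_id _)).
  by move=> a n; rewrite /= !induced_map_pure fK.
apply: (@induced_ext _ _ (lmap_comp (induced_map f) (induced_map g)) (lmap_id _)).
by move=> a n; rewrite /= !induced_map_pure gK.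
Qed.

Lemma induced_map0 M N x : induced_map (lmap_zero M N) x = 0.
Proof.
move: x; apply: (induced_ext (f := induced_map (lmap_zero M N)) (g := lmap_zero _ _)).
move=> a n /=; rewrite induced_map_pure /=.
have [_ pD _] := pure_balanced N.
by apply: (@addrI _ (pure a 0)); rewrite -pD !addr0.
Qed.

Lemma induced0 N : (forall n : N, n = 0) -> forall t : induced N, t = 0.
Proof.
move=> N0; apply: (@induced_ext _ _ (lmap_id _) (lmap_zero _ _)) => a n /=.
have [_ pD _] := pure_balanced N.
rewrite (N0 n); apply: (@addrI _ (pure a 0)).
by rewrite -pD !addr0.
Qed.
End Induction.

Section BaseChange.
Variables (K : fieldType) (A A1 : falgType K) (B : {aspace A}) (B1 : {aspace A1}).
Variables (q : idem_quot A A1) (qB : idem_quot (subvs_of B) (subvs_of B1)).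
Hypothesis qBE : forall b, vsval (qB b) = q (vsval b).
Implicit Types (M N : lmodType (subvs_of B)).

(** Both sides are the tensor product of A1 with M over B, by transitivity of base change. *)
Lemma base_change_exists M :
  exists th : {linear red q (induced M) -> induced (red qB M)},
    bijective th /\ forall a m, th (eta q (pure a m)) = pure (q a) (eta qB m).
Proof.
have [pDl pDr pM] := pure_balanced M.
have [pDl' pDr' pM'] := pure_balanced (red qB M).
have [||h hE] := @induced_lift _ _ _ M (res q (induced (red qB M)))
    (fun a m => pure (q a) (eta qB m)).
- split=> [a a' m|a m m'|a b m].
  + by rewrite raddfD pDl'.
  + by rewrite raddfD pDr'.
  + by rewrite rmorphM /= -qBE pM' etaZ.
- by move=> c a m; rewrite res_scaleE induced_scale rmorphM.
have [th thE] := red_transpose h.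
have thP a m : th (eta q (pure a m)) = pure (q a) (eta qB m) by rewrite thE hE.
pose l := iq_lift q.
have p_ker a m : q a = 0 -> eta q (pure a m : induced M) = 0.
  by move=> qa; rewrite -[a]mulr1 -induced_scale eta_ker.
have p_eq a a' m : q a = q a' -> eta q (pure a m : induced M) = eta q (pure a' m : induced M).
  move=> qa; rewrite -[a](subrK a') pDl raddfD /= p_ker ?add0r //.
  by rewrite rmorphB /= qa subrr.
(* The idempotent of [qB] moves across the tensor sign, where it enters the kernel of q. *)
have p_eta a m : eta q (pure a (val (eta qB m)) : induced M) = eta q (pure a m : induced M).
  rewrite val_eta; apply: (@addIr _ (eta q (pure a (iq_idem qB *: m) : induced M))).
  rewrite -raddfD -pDr subrK -pM [X in _ + X]p_ker ?addr0 //.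
  by rewrite rmorphM /= -qBE iq_map_idem /= mulr0.
(* The inverse uses a chosen lift of a and the representative of x; [p_eq] and [p_eta] say that the
   choices do not matter. *)
have [||k kE] := @induced_lift _ _ _ (red qB M) (red q (induced M))
    (fun a x => eta q (pure (l a) (val x) : induced M)).
- split=> [a a' x|a x x'|a b x].
  + by rewrite -raddfD -pDl; apply: p_eq; rewrite rmorphD /= !iq_liftK.
  + by rewrite val_redD pDr raddfD.
  + rewrite -(iq_liftK qB b) -{2}(eta_val x) -etaZ p_eta -pM; apply: p_eq.
    by rewrite rmorphM /= !iq_liftK -qBE iq_liftK.
- move=> c a x; rewrite -{2}(iq_liftK q c) -etaZ induced_scale; apply: p_eq.
  by rewrite rmorphM /= !iq_liftK.
exists th; split=> //; exists k.
  move=> x; rewrite -(eta_val x); move: (val x) => {x}.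
  apply: (@induced_ext _ _ _ _ _
    (k \o th \o eta q (M:=induced M) : {additive _ -> _}) (eta q (M:=induced M) : {additive _ -> _})).
  move=> a m; rewrite /= thP kE p_eta; apply: p_eq.
  by rewrite iq_liftK.
apply: (@induced_ext _ _ _ _ _ (lmap_comp th k) (lmap_id _)) => a x.
by rewrite /= kE thP iq_liftK eta_val.
Qed.

Definition base_change M : {linear red q (induced M) -> induced (red qB M)} :=
  projT1 (cid (base_change_exists M)).

Lemma base_change_bij M : bijective (base_change M).
Proof. by have [] := projT2 (cid (base_change_exists M)). Qed.

Lemma base_change_pure M a (m : M) :
  base_change M (eta q (pure a m)) = pure (q a) (eta qB m).
Proof. by have [_] := projT2 (cid (base_change_exists M)); exact. Qed.

Lemma base_change_nat M N (f : {linear M -> N}) x :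
  base_change N (red_map q (induced_map f) x)
    = induced_map (red_map qB f) (base_change M x).
Proof.
rewrite -(eta_val x); move: (val x) => {x}.
apply: (@induced_ext _ _ _ _ _
  (base_change N \o red_map q (induced_map f) \o eta q (M:=induced M) : {additive _ -> _})
  (induced_map (red_map qB f) \o base_change M \o eta q (M:=induced M) : {additive _ -> _})).
move=> a m; rewrite /= red_mapE /= induced_map_pure !base_change_pure.
by rewrite induced_map_pure red_mapE.
Qed.

Lemma base_change_iso M : isomorphic (red q (induced M)) (induced (red qB M)).
Proof. by exists (base_change M); exact: base_change_bij. Qed.

Lemma red_induction_exact : induction_exact B1 ->
  forall (X Y Z : lmodType (subvs_of B)) (f : {linear X -> Y}) (h : {linear Y -> Z}),
  fin_dim X -> fin_dim Y -> fin_dim Z -> short_exact f h ->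
  short_exact (red_map q (induced_map f)) (red_map q (induced_map h)).
Proof.
move=> ex X Y Z f h Xf Yf Zf fh.
have [fI' fh' hS'] := ex _ _ _ _ _ (fin_dim_red qB Xf) (fin_dim_red qB Yf)
  (fin_dim_red qB Zf) (red_short_exact qB fh).
have [tX tXK tXK'] := base_change_bij X.
have [tY tYK tYK'] := base_change_bij Y.
have [tZ tZK tZK'] := base_change_bij Z.
split=> [x y xy|y|z].
- by apply/(can_inj tXK)/fI'; rewrite -!base_change_nat xy.
- split=> [hy|[x <-]]; last first.
    apply: (can_inj tZK); rewrite linear0 !base_change_nat.
    by apply/fh'; exists (base_change X x).
  have /fh'[x xE] : induced_map (red_map qB h) (base_change Y y) = 0.
    by rewrite -base_change_nat hy linear0.
  exists (tX x); apply: (can_inj tYK).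
  by rewrite base_change_nat tXK'.
- have [y yE] := hS' (base_change Z z); exists (tY y).
  by apply: (can_inj tZK); rewrite base_change_nat tYK'.
Qed.
End BaseChange.

(** * Fibre products *)

(* R is the fibre product of R1 and R2 over K: the kernels of the quotients
   R -> R1, R -> R2 and R -> K are g1 R, g2 R and (g1 + g2) R. *)
Definition gluing (K : fieldType) (R R1 R2 R0 : falgType K) (q1 : idem_quot R R1)
    (q2 : idem_quot R R2) (q0 : idem_quot R R0) : Prop :=
  [/\ iq_idem q1 * iq_idem q2 = 0, iq_idem q2 * iq_idem q1 = 0 &
      iq_idem q0 = iq_idem q1 + iq_idem q2].

Lemma gluing_sym (K : fieldType) (R R1 R2 R0 : falgType K) (q1 : idem_quot R R1)
    (q2 : idem_quot R R2) (q0 : idem_quot R R0) :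
  gluing q1 q2 q0 -> gluing q2 q1 q0.
Proof. by case=> g12 g21 g0; split; rewrite // addrC. Qed.

Section Gluing.
Variables (K : fieldType) (R R1 R2 R0 : falgType K).
Variables (q1 : idem_quot R R1) (q2 : idem_quot R R2) (q0 : idem_quot R R0).
Hypothesis gl : gluing q1 q2 q0.
Local Notation g1 := (iq_idem q1).
Local Notation g2 := (iq_idem q2).
Implicit Types (M N T X Y Z : lmodType R).

Lemma glue_g12 : g1 * g2 = 0. Proof. by case: gl. Qed.
Lemma glue_g21 : g2 * g1 = 0. Proof. by case: gl. Qed.

Lemma glue_g1M a : g1 * (a * g2) = 0.
Proof.
by rewrite -iq_idemM mulrA glue_g12 mul0r.
Qed.

Lemma eta_inj M (m : M) : eta q1 m = 0 -> eta q2 m = 0 -> m = 0.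
Proof.
move=> /eta_eq0 e1 /eta_eq0 e2.
by rewrite -e1 -e2 scalerA glue_g12 scale0r.
Qed.

Lemma eta0_split M (m : M) : val (eta q0 m) = m - g1 *: m - g2 *: m.
Proof. by rewrite val_eta; case: gl => _ _ ->; rewrite scalerDl opprD addrA. Qed.

(** Together with [eta_inj] this makes T the fibre product of its two reductions. The witness
    replaces the g1-part of t1, which the first reduction does not see, by that of t2. *)
Lemma glue_elt T (t1 t2 : T) : eta q0 t1 = eta q0 t2 ->
  exists t, eta q1 t = eta q1 t1 /\ eta q2 t = eta q2 t2.
Proof.
move/(congr1 val); rewrite !eta0_split => /(congr1 (eta q2 (M := T))).
rewrite !raddfB /= !eta_idem !subr0 => t12.
exists (t1 - g1 *: t1 + g1 *: t2); rewrite !raddfD !raddfN /= !eta_idem.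
by rewrite oppr0 !addr0 t12 subrK.
Qed.

Lemma glue_map M T (h1 : {linear M -> res q1 (red q1 T)})
    (h2 : {linear M -> res q2 (red q2 T)}) :
  (forall x, eta q0 (val (h1 x)) = eta q0 (val (h2 x))) ->
  exists h : {linear M -> T}, forall x, eta q1 (h x) = h1 x /\ eta q2 (h x) = h2 x.
Proof.
move=> h12; have [h hE] := choice (fun x => glue_elt (h12 x)).
have h1E x : eta q1 (h x) = h1 x by have [-> _] := hE x; rewrite eta_val.
have h2E x : eta q2 (h x) = h2 x by have [_ ->] := hE x; rewrite eta_val.
have hL : linear h.
  move=> a x y; apply/eqP; rewrite -subr_eq0; apply/eqP; apply: eta_inj.
    by rewrite raddfB raddfD /= etaZ !h1E linearP subrr.
  by rewrite raddfB raddfD /= etaZ !h2E linearP subrr.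
by exists (mk_linear hL).
Qed.

(** With preimages x1, x2 modulo g1 and g2, the element (1 - g1)x1 + g1 x2 maps to y: the error of
    x1 is fixed by g1, hence removed by 1 - g1, and the error of x2 lies in g2 Y, which g1 kills. *)
Lemma glue_preimage X Y (f : {linear X -> Y}) y :
  (exists x, red_map q1 f x = eta q1 y) -> (exists x, red_map q2 f x = eta q2 y) ->
  exists x, f x = y.
Proof.
move=> [x1 x1E] [x2 x2E].
have /eta_eq0 e1 : eta q1 (f (val x1) - y) = 0.
  by rewrite raddfB /= -red_mapE eta_val x1E subrr.
have /eta_eq0 e2 : eta q2 (f (val x2) - y) = 0.
  by rewrite raddfB /= -red_mapE eta_val x2E subrr.
exists (val x1 - g1 *: val x1 + g1 *: val x2).
have -> : f (val x1 - g1 *: val x1 + g1 *: val x2) =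
    f (val x1) - g1 *: f (val x1) + g1 *: f (val x2).
  by rewrite linearD linearB !linearZ.
have -> : g1 *: f (val x2) = g1 *: y.
  by apply/eqP; rewrite -subr_eq0 -scalerBr -e2 scalerA glue_g12 scale0r.
have -> : f (val x1) - g1 *: f (val x1) = y - g1 *: y.
  by apply/eqP; rewrite subr_eq addrAC -addrA -scalerBr e1 addrC subrK.
by rewrite subrK.
Qed.

Lemma glue_short_exact X Y Z (f : {linear X -> Y}) (h : {linear Y -> Z}) :
  short_exact (red_map q1 f) (red_map q1 h) ->
  short_exact (red_map q2 f) (red_map q2 h) -> short_exact f h.
Proof.
move=> [fI1 fh1 hS1] [fI2 fh2 hS2]; split.
- move=> x y xy; apply/eqP; rewrite -subr_eq0; apply/eqP; apply: eta_inj.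
    by apply: fI1; rewrite red_mapE linearB xy subrr raddf0 linear0.
  by apply: fI2; rewrite red_mapE linearB xy subrr raddf0 linear0.
- move=> y; split=> [hy|[x <-]].
    by apply: glue_preimage; [apply/fh1|apply/fh2]; rewrite red_mapE hy raddf0.
  apply: eta_inj; rewrite -!red_mapE.
    by apply/fh1; exists (eta q1 x).
  by apply/fh2; exists (eta q2 x).
- by move=> z; apply: glue_preimage; [exact: hS1|exact: hS2].
Qed.
End Gluing.

Definition mk_lrmorphism (K : fieldType) (R S : falgType K) (f : R -> S)
    (fL : linear f) (fM : monoid_morphism f) : {lrmorphism R -> S} :=
  HB.pack f (GRing.isLinear.Build K R S *:%R f fL)
    (GRing.isMonoidMorphism.Build R S f fM).

(** Right multiplication on the line eR = Ke is a character of R, and the elements acting as zero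
    form (1 - e)R. *)
Lemma source_quotient (K : fieldType) (R : falgType K) (e : R) :
  e != 0 -> e * e = e -> (forall a, exists k : K, e * a = k *: e) ->
  exists q : idem_quot R (base_alg K),
    iq_idem q = 1 - e /\ forall a, e * a = (q a : K) *: e.
Proof.
move=> e0 ee /choice[l lE].
have eI (k k' : K) : k *: e = k' *: e -> k = k'.
  move/eqP; rewrite -subr_eq0 -scalerBl scaler_eq0 (negbTE e0) orbF subr_eq0.
  by move/eqP.
have lL : linear (l : R -> base_alg K).
  move=> k a b; apply: eI; rewrite -lE mulrDr -scalerAr !lE scalerA.
  by rewrite -scalerDl.
have lM : monoid_morphism (l : R -> base_alg K).
  split=> [|a b]; apply: eI; rewrite -lE ?mulr1 ?scale1r //.
  by rewrite mulrA lE -scalerAl lE scalerA.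
pose f := mk_lrmorphism lL lM.
have fS : surj f.
  move=> k; exists (k *: 1); apply: eI.
  by rewrite -[f _]/(l _) -lE -scalerAr mulr1.
have gg : (1 - e) * (1 - e) = 1 - e.
  by rewrite mulrBl mul1r mulrBr mulr1 ee subrr subr0.
have fker x : f x = 0 <-> (1 - e) * x = x.
  rewrite mulrBl mul1r; split=> [fx|/eqP].
    by rewrite lE -[l x]/(f x) fx scale0r subr0.
  rewrite -subr_eq0 addrAC subrr sub0r oppr_eq0 => /eqP ex.
  by apply: eI; rewrite scale0r -[f x]/(l x) -lE.
by exists (IdemQuot fS gg fker).
Qed.

Lemma vsval_mulE (K : fieldType) (A : falgType K) (B : {aspace A}) (b c : subvs_of B) :
  vsval (b * c) = vsval b * vsval c.
Proof. by []. Qed.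

Lemma vsval1 (K : fieldType) (A : falgType K) (B : {aspace A}) :
  1 \in B -> vsval (1 : subvs_of B) = 1.
Proof. by move=> B1; apply/eqP; rewrite algid_eq1. Qed.

(** * The idempotent of an exact Borel subalgebra at the source *)

Section BorelIdempotent.
Variables (K : fieldType) (A : falgType K) (B : {aspace A}) (q : idem_quot A (base_alg K)).
Hypotheses (B1 : 1 \in B) (exB : induction_exact B).
Local Notation Bt := (subvs_of B).
Local Notation lam b := (q (vsval b)).
Local Notation lamK b := (lam b : K).

Let lamD (b c : Bt) : lam (b + c) = lam b + lam c.
Proof. by rewrite -raddfD; congr (q _). Qed.

Let lamB (b c : Bt) : lam (b - c) = lam b - lam c.
Proof. by rewrite -raddfB; congr (q _). Qed.

Let lamM (b c : Bt) : lam (b * c) = lam b * lam c.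
Proof. by rewrite -rmorphM; congr (q _). Qed.

Let lamA (k : K) : lam (k%:A : Bt) = k.
Proof.
have -> : vsval (k%:A : Bt) = k *: (1 : A).
  by rewrite -[in RHS](vsval1 B1).
by rewrite linearZ /= rmorph1 [_ *: 1]mulr1.
Qed.

(* Tensoring B m -> B with the right A-module (1 - g) A, which is K, kills m;
   exactness then puts m in (ker lam) m. *)
Lemma borel_unit1 (m : Bt) : lam m = 0 -> exists2 u : Bt, lam u = 0 & u * m = m.
Proof.
move=> lm; pose Y : lmodType Bt := Bt^o; pose S (y : Y) := exists b : Bt, y = b * m.
have S0 : S 0 by exists 0; rewrite mul0r.
have SD a x y : S x -> S y -> S (a *: x + y).
  by move=> [b ->] [c ->]; exists (a * b + c); rewrite mulrDl -mulrA.
have [U [u [uI uE]]] := submodule_type S0 SD.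
have [Z [w [wS wE]]] := quotient_type S0 SD.
have uw : short_exact u w by split=> // y; rewrite wE uE.
have Yf : fin_dim Y by exact: fin_dim_regular.
have Uf : fin_dim U.
  have mL : linear ((fun b : Bt => b * m) : Y -> Y).
    by move=> a x y; rewrite mulrDl -mulrA.
  have [r rE] : exists r : {linear Y -> U}, forall b, u (r b) = mk_linear mL b.
    by apply: factor_inj uI _ => x; apply/uE; exists x.
  apply: (fin_dim_surj (f := r)) Yf => y.
  have [|b bE] := (uE (u y)).2; first by exists y.
  by exists b; apply: uI; rewrite rE bE.
have [iu _ _] := exB Uf Yf (fin_dim_surj wS Yf) uw.
have [|m0 m0E] := (uE m).1; first by exists 1; rewrite mul1r.
(* The tensor of e and m0 is zero: its image in A tensor B is that of e and m, equal to that of em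
   and 1, and em = 0 because m lies in gA. Injectivity of [induced_map u] does the rest. *)
pose e := 1 - iq_idem q.
have t0 : (pure e m0 : induced U) = 0.
  have [pDl pDr pM] := pure_balanced Y.
  apply: iu; rewrite linear0 /= induced_map_pure m0E.
  have -> : m = m *: (1 : Y) by rewrite -[RHS]/(m * 1) mulr1.
  rewrite -pM mulrBl mul1r; move/iq_ker: lm => ->; rewrite subrr.
  by apply: (@addrI _ (pure 0 (1 : Y))); rewrite -pDl !addr0.
(* On Bm / (ker lam)m each b acts by the scalar lam b, so sending a, x to q(a) times the class of x
   is balanced. It sends e, m0 to the class of m, as q(e) = 1; so this class is zero. *)
pose T (x : U) := exists2 c : Bt, lam c = 0 & u x = c * m.
have [||W [p [pS pE]]] := @quotient_type _ U T.
- by exists 0; rewrite ?linear0 ?mul0r.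
- move=> a x y [c lc xE] [d ld yE]; exists (a * c + d).
    by rewrite lamD lamM lc ld mulr0 addr0.
  by rewrite linearP xE yE mulrDl -mulrA.
pose f a (x : U) : W := (q a : K)%:A *: p x.
have fB : balanced f.
  split=> [a a' x|a x x'|a b x]; rewrite /f.
  - by rewrite rmorphD -scalerDl -[in RHS]scalerDl.
  - by rewrite linearD scalerDr.
  have pb : p (b *: x) = (lamK b)%:A *: p x.
    apply/eqP; rewrite -subr_eq0 -linearZ -linearB -scalerBl; apply/eqP/pE.
    have [|c cE] := (uE (u x)).2; first by exists x.
    exists ((b - (lamK b)%:A) * c); last by rewrite linearZ cE -[LHS]/(_ * _) mulrA.
    by rewrite lamM lamB lamA subrr mul0r.
  by rewrite pb scalerA -scalerAl mul1r scalerA rmorphM.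
have : p m0 = 0.
  have := tensor_lift_pure fB e m0; rewrite t0.
  have -> : tensor_lift f 0 = 0.
    by have := tensor_liftB fB 0 0; rewrite !subrr.
  by rewrite /f rmorphB /= iq_map_idem rmorph1 subr0 !scale1r.
by move/pE=> [c lc cE]; exists c; rewrite // -cE.
Qed.

(** The units of [borel_unit1] depend on m. Finitely many of them merge into one, and a finite
    spanning set of the kernel suffices. *)
Lemma borel_unit : exists2 u : Bt, lam u = 0 & forall b, lam b = 0 -> u * b = b.
Proof.
have seqU (s : seq Bt) : (forall b, b \in s -> lam b = 0) ->
    exists2 u : Bt, lam u = 0 & forall b, b \in s -> u * b = b.
  elim: s => [|m s IH] ls; first by exists 0; rewrite ?linear0 ?rmorph0.
  have [|u lu uE] := IH; first by move=> b bs; apply: ls; rewrite inE bs orbT.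
  have lm : lam m = 0 by apply: ls; rewrite mem_head.
  have [|w lw wE] := @borel_unit1 (m - u * m); first by rewrite lamB lamM lm mulr0 subr0.
  (* This is 1 - (1 - w)(1 - u): the factor 1 - u kills the elements already treated, and 1 - w
     kills m - u m. *)
  exists (u + w - w * u); first by rewrite lamB lamM lamD lu lw mulr0 addr0 subr0.
  move=> b; rewrite inE => /orP[/eqP ->|/uE ub].
    by rewrite mulrBl mulrDl -addrA -mulrA -mulrBr wE addrC subrK.
  by rewrite mulrBl mulrDl -mulrA ub addrK.
pose bs i : Bt := (vbasis {:Bt})`_i.
(* The projection onto the kernel of lam along the scalars; the images of a basis therefore span
   this kernel. *)
pose cb (b : Bt) : Bt := b - (lamK b)%:A.
have lcb b : lam (cb b) = 0.
  by rewrite lamB lamA subrr.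
have [|u lu uE] := seqU [seq cb b | b <- vbasis {:Bt}].
  by move=> b /mapP[c _ ->].
have cbD : linear cb.
  move=> k b c; rewrite /cb.
  have -> : lam (k *: b + c) = k * lamK b + lamK c by rewrite lamD -mulr_algl lamM lamA.
  by rewrite scalerDl -scalerA opprD addrACA -scalerBr.
exists u => // b lb; have -> : b = mk_linear cbD b.
  by rewrite /= /cb lb scale0r subr0.
rewrite (coord_vbasis (memvf b)) linear_sum mulr_sumr; apply: eq_bigr => i _.
rewrite linearZ /= -scalerAr uE //; apply: map_f.
by apply: mem_nth; rewrite size_tuple.
Qed.

Lemma borel_source : exists qB : idem_quot Bt (base_alg K), forall b, qB b = q (vsval b).
Proof.
have [u lu uE] := borel_unit.
have lL : linear ((fun b => q (vsval b)) : Bt -> base_alg K).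
  by move=> k b c; rewrite lamD -mulr_algl lamM lamA.
have lM : monoid_morphism ((fun b => q (vsval b)) : Bt -> base_alg K).
  by split=> [|b c]; [rewrite vsval1 ?rmorph1 | rewrite lamM].
pose f := mk_lrmorphism lL lM.
have fS : surj f.
  by move=> k; exists k%:A; exact: lamA.
have fker x : f x = 0 <-> u * x = x.
  by split=> [/uE//|<-]; rewrite -[LHS]/(lam (u * x)) lamM lu mul0r.
by exists (IdemQuot fS (uE _ lu) fker).
Qed.
End BorelIdempotent.

Lemma subalgebra_quotient (K : fieldType) (A A1 : falgType K) (B : {aspace A})
    (B1 : {aspace A1}) (q : {lrmorphism A -> A1}) (g : subvs_of B) :
  1 \in B -> 1 \in B1 -> (forall b : subvs_of B, q (vsval b) \in B1) ->
  (forall c : subvs_of B1, exists b : subvs_of B, q (vsval b) = vsval c) ->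
  g * g = g -> (forall b, q (vsval b) = 0 <-> g * b = b) ->
  exists s : idem_quot (subvs_of B) (subvs_of B1),
    iq_idem s = g /\ forall b, vsval (s b) = q (vsval b).
Proof.
move=> oneB oneB1 qB qS gg gker; pose f (b : subvs_of B) := vsproj B1 (q (vsval b)).
have fE b : vsval (f b) = q (vsval b) by rewrite vsprojK.
have fL : linear f by move=> k b c; apply: val_inj; rewrite linearP /= !fE !linearP.
have fM : monoid_morphism f.
  split=> [|b c]; apply: val_inj; rewrite /= fE.
    by rewrite (vsval1 oneB) rmorph1; exact/esym/(vsval1 oneB1).
  by rewrite !vsval_mulE !fE rmorphM.
have fS : surj (mk_lrmorphism fL fM).
  by move=> c; have [b bE] := qS c; exists b; apply: val_inj; rewrite /= fE.
have fker b : mk_lrmorphism fL fM b = 0 <-> g * b = b.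
  rewrite -gker -fE; split=> [/= ->|e]; first exact: linear0.
  by apply: val_inj; rewrite /= e.
by exists (IdemQuot fS gg fker).
Qed.

(** * The fibre product of two subalgebras *)

Section FibreProduct.
Variables (K : fieldType) (A A1 A2 : falgType K).
Variables (q1 : idem_quot A A1) (q2 : idem_quot A A2) (q0 : idem_quot A (base_alg K)).
Hypothesis gl : gluing q1 q2 q0.
Variables (p1 : idem_quot A1 (base_alg K)) (p2 : idem_quot A2 (base_alg K)).
Hypotheses (p1E : forall a, p1 (q1 a) = q0 a) (p2E : forall a, p2 (q2 a) = q0 a).
Variables (B1 : {aspace A1}) (B2 : {aspace A2}).
Hypotheses (oneB1 : 1 \in B1) (oneB2 : 1 \in B2).
Variables (r1 : idem_quot (subvs_of B1) (base_alg K)) (r2 : idem_quot (subvs_of B2) (base_alg K)).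
Hypotheses (r1E : forall b, r1 b = p1 (vsval b)) (r2E : forall b, r2 b = p2 (vsval b)).

Lemma fibre_eq (a b : A) : q1 a = q1 b -> q2 a = q2 b -> a = b.
Proof.
move=> ab1 ab2; apply/eqP; rewrite -subr_eq0; apply/eqP.
have /iq_ker e1 : q1 (a - b) = 0 by rewrite rmorphB /= ab1 subrr.
have /iq_ker e2 : q2 (a - b) = 0 by rewrite rmorphB /= ab2 subrr.
by rewrite -e1 -e2 mulrA (glue_g12 gl) mul0r.
Qed.

Lemma fibre_elt a1 a2 : p1 a1 = p2 a2 -> exists a, q1 a = a1 /\ q2 a = a2.
Proof.
have [b1 <-] := iq_surj q1 a1; have [b2 <-] := iq_surj q2 a2.
(* The correction vanishes under q1. Since q0 kills b1 - b2, this difference equals (g1 + g2)(b1 -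
   b2), so under q2 the correction becomes all of b1 - b2. *)
rewrite p1E p2E => e; exists (b1 - iq_idem q1 * (b1 - b2)).
rewrite !rmorphB !rmorphM /= iq_map_idem mul0r subr0; split=> //.
have /iq_ker : q0 (b1 - b2) = 0 by rewrite rmorphB /= e subrr.
have [_ _ ->] := gl; rewrite mulrDl => /(congr1 q2).
rewrite rmorphD !rmorphM /= iq_map_idem mul0r addr0 => ->.
by rewrite rmorphB /= opprB addrC subrK.
Qed.

Lemma fibre_product : exists B : {aspace A}, 1 \in B /\
  exists (s1 : idem_quot (subvs_of B) (subvs_of B1))
    (s2 : idem_quot (subvs_of B) (subvs_of B2)) (s0 : idem_quot (subvs_of B) (base_alg K)),
  [/\ gluing s1 s2 s0, forall b, vsval (s1 b) = q1 (vsval b),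
      forall b, vsval (s2 b) = q2 (vsval b) & forall b, s0 b = q0 (vsval b)].
Proof.
pose V := ((linfun q1 @^-1: B1) :&: (linfun q2 @^-1: B2))%VS.
have VP a : (a \in V) = (q1 a \in B1) && (q2 a \in B2).
  by rewrite memv_cap -!memv_preim !lfunE.
have V1 : 1 \in V by rewrite VP !rmorph1 oneB1.
have VA : is_aspace V.
  rewrite /is_aspace has_algid1 //=; apply/prodvP => a b.
  rewrite !VP => /andP[a1 a2] /andP[b1 b2].
  by rewrite !rmorphM /= !memvM.
pose B := ASpace VA; have oneB : 1 \in B by [].
have B1P (b : subvs_of B) : q1 (vsval b) \in B1.
  by have := subvsP b; rewrite VP => /andP[].
have B2P (b : subvs_of B) : q2 (vsval b) \in B2.
  by have := subvsP b; rewrite VP => /andP[].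
have Belt (c1 : subvs_of B1) (c2 : subvs_of B2) : r1 c1 = r2 c2 ->
    exists b : subvs_of B, q1 (vsval b) = vsval c1 /\ q2 (vsval b) = vsval c2.
  rewrite r1E r2E => /fibre_elt[a [a1 a2]].
  have aB : a \in B by rewrite VP a1 a2 !subvsP.
  by exists (Subvs aB).
(* The indices cross: the kernel of B -> B1 consists of the pairs (0, c) with c in the kernel of
   [r2], so [g1] comes from the idempotent of [r2]. *)
have [|g1 [g11 g12]] := Belt 0 (iq_idem r2); first by rewrite rmorph0 iq_map_idem.
have [|g2 [g21 g22]] := Belt (iq_idem r1) 0; first by rewrite rmorph0 iq_map_idem.
have r_idem1 : vsval (iq_idem r1) * vsval (iq_idem r1) = vsval (iq_idem r1).
  by rewrite -vsval_mulE iq_idemK.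
have r_idem2 : vsval (iq_idem r2) * vsval (iq_idem r2) = vsval (iq_idem r2).
  by rewrite -vsval_mulE iq_idemK.
have Beq (b c : subvs_of B) : q1 (vsval b) = q1 (vsval c) ->
    q2 (vsval b) = q2 (vsval c) -> b = c.
  by move=> e1 e2; apply: val_inj; exact: fibre_eq.
have qM1 (b c : subvs_of B) : q1 (vsval (b * c)) = q1 (vsval b) * q1 (vsval c).
  by rewrite vsval_mulE rmorphM.
have qM2 (b c : subvs_of B) : q2 (vsval (b * c)) = q2 (vsval b) * q2 (vsval c).
  by rewrite vsval_mulE rmorphM.
have idem1 (b : subvs_of B) : q0 (vsval b) = 0 ->
    vsval (iq_idem r1) * q1 (vsval b) = q1 (vsval b).
  move=> b0; have /iq_ker/(congr1 vsval) : r1 (Subvs (B1P b)) = 0.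
    by rewrite r1E p1E.
  by [].
have idem2 (b : subvs_of B) : q0 (vsval b) = 0 ->
    vsval (iq_idem r2) * q2 (vsval b) = q2 (vsval b).
  move=> b0; have /iq_ker/(congr1 vsval) : r2 (Subvs (B2P b)) = 0.
    by rewrite r2E p2E.
  by [].
have g12_0 : g1 * g2 = 0.
  by apply: Beq; rewrite ?qM1 ?qM2 ?g11 ?g22 !linear0 ?rmorph0 ?mul0r ?mulr0.
have g21_0 : g2 * g1 = 0.
  by apply: Beq; rewrite ?qM1 ?qM2 ?g11 ?g22 !linear0 ?rmorph0 ?mul0r ?mulr0.
have [||||||s1 [s1g s1E]] := @subalgebra_quotient _ _ _ B B1 q1 g1 => //.
(* For surjectivity, c in B1 is paired with the scalar [r1 c] in B2. *)
- move=> c; have rc : r1 c = r2 (r1 c : K)%:A.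
    by rewrite linearZ /= rmorph1 [_ *: 1]mulr1.
  by have [b [bE _]] := Belt _ _ rc; exists b.
- by apply: Beq; rewrite ?qM1 ?qM2 ?g11 ?g12 // linear0 mul0r.
- move=> b; split=> [b0|<-]; last by rewrite qM1 g11 linear0 mul0r.
  apply: Beq; rewrite ?qM1 ?qM2 ?g11 ?g12 ?linear0 ?mul0r ?b0 //.
  by apply: idem2; rewrite -p1E b0 rmorph0.
have [||||||s2 [s2g s2E]] := @subalgebra_quotient _ _ _ B B2 q2 g2 => //.
- move=> c; have rc : r1 (r2 c : K)%:A = r2 c.
    by rewrite linearZ /= rmorph1 [_ *: 1]mulr1.
  by have [b [_ bE]] := Belt _ _ rc; exists b.
- by apply: Beq; rewrite ?qM1 ?qM2 ?g21 ?g22 // linear0 mul0r.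
- move=> b; split=> [b0|<-]; last by rewrite qM2 g22 linear0 mul0r.
  apply: Beq; rewrite ?qM1 ?qM2 ?g21 ?g22 ?linear0 ?mul0r ?b0 //.
  by apply: idem1; rewrite -p2E b0 rmorph0.
pose s0 : {lrmorphism subvs_of B -> base_alg K} := r1 \o s1.
have s0E b : s0 b = q0 (vsval b) by rewrite /= r1E s1E p1E.
have s0S : surj s0.
  by move=> k; have [c <-] := iq_surj r1 k; have [b <-] := iq_surj s1 c; exists b.
have g0 : (g1 + g2) * (g1 + g2) = g1 + g2.
  rewrite mulrDl !mulrDr g12_0 g21_0 addr0 add0r; congr (_ + _).
    by rewrite -s1g iq_idemK.
  by rewrite -s2g iq_idemK.
have s0ker b : s0 b = 0 <-> (g1 + g2) * b = b.
  have qD0 (c d : subvs_of B) : q0 (vsval (c + d)) = q0 (vsval c) + q0 (vsval d).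
    by rewrite -rmorphD; congr (_ _).
  have qD1 (c d : subvs_of B) : q1 (vsval (c + d)) = q1 (vsval c) + q1 (vsval d).
    by rewrite -rmorphD; congr (_ _).
  have qD2 (c d : subvs_of B) : q2 (vsval (c + d)) = q2 (vsval c) + q2 (vsval d).
    by rewrite -rmorphD; congr (_ _).
  rewrite s0E; split=> [b0|<-]; last first.
    rewrite mulrDl qD0 -{1}p1E -p2E qM1 qM2 g11 g22.
    by rewrite !linear0 !mul0r !rmorph0 addr0.
  apply: Beq; rewrite mulrDl ?qD1 ?qD2 ?qM1 ?qM2 ?g11 ?g12 ?g21 ?g22.
    by rewrite linear0 mul0r add0r idem1.
  by rewrite linear0 mul0r addr0 idem2.
exists B; split=> //; exists s1, s2, (IdemQuot s0S g0 s0ker).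
by split=> //; split; rewrite ?s1g ?s2g.
Qed.
End FibreProduct.

(** * Extensions *)

Section LinearExtension.
Variables (K : fieldType) (Z N : lmodType K).

Let linear_graph (G : Z -> N -> Prop) : Prop :=
  [/\ G 0 0, forall a z z' n n', G z n -> G z' n' -> G (a *: z + z') (a *: n + n') &
      forall n, G 0 n -> n = 0].

(** Partial linear maps are handled as graphs and enlarged by one generator at a time, so no basis
    or complement has to be chosen. *)
Let graph_extend (G : Z -> N -> Prop) (s : seq Z) : linear_graph G ->
  exists G', [/\ linear_graph G', forall z n, G z n -> G' z n &
    forall z, z \in s -> exists n, G' z n].
Proof.
elim: s => [|z0 s IH] GL; first by exists G.
have [G' [[G0 GD GF] GG' Gs]] := IH GL.
have [[n0 z0n]|nz0] := pselect (exists n, G' z0 n).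
  exists G'; split=> // z; rewrite inE => /orP[/eqP ->|]; first by exists n0.
  exact: Gs.
(* The new generator is sent to 0. It lies outside the old domain, which keeps the graph
   single-valued. *)
exists (fun z n => exists c : K, G' (z - c *: z0) n); split.
- split=> [|a z z' n n' [c zn] [c' zn']|n [c]].
  + by exists 0; rewrite scale0r subr0.
  + exists (a * c + c').
    have -> : a *: z + z' - (a * c + c') *: z0 = a *: (z - c *: z0) + (z' - c' *: z0).
      by rewrite scalerBr scalerDl scalerA addrACA opprD.
    exact: GD.
  + rewrite sub0r; have [-> |c0] := eqVneq c 0.
      by rewrite scale0r oppr0; exact: GF.
    move=> z0n; case: nz0; exists (- c^-1 *: n).
    have := GD (- c^-1) _ _ _ _ z0n G0.
    by rewrite !addr0 scalerN -scaleNr opprK scalerA mulVf // scale1r.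
- by move=> z n zn; exists 0; rewrite scale0r subr0; exact: GG'.
- move=> z; rewrite inE => /orP[/eqP ->|/Gs[n zn]].
    by exists 0, 1; rewrite scale1r subrr.
  by exists n, 0; rewrite scale0r subr0.
Qed.

Lemma linear_extension (Y : lmodType K) (w : {linear Y -> Z}) (f : {linear Y -> N})
    (s : seq Z) :
  (forall z, exists c : 'I_(size s) -> K, z = \sum_(i < size s) c i *: s`_i) ->
  (forall y, w y = 0 -> f y = 0) -> exists k : {linear Z -> N}, forall y, k (w y) = f y.
Proof.
move=> sZ wf; pose G z n := exists2 y, z = w y & n = f y.
have GL : linear_graph G.
  split=> [|a z z' n n' [y -> ->] [y' -> ->]|n [y /esym/wf fy ->]] //.
    by exists 0; rewrite linear0.
  by exists (a *: y + y'); rewrite linearP.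
have [G' [[G0 GD GF] GG' Gs]] := graph_extend s GL.
have GU z n n' : G' z n -> G' z n' -> n = n'.
  move=> zn zn'; apply/eqP; rewrite -subr_eq0; apply/eqP/GF.
  have := GD (-1) _ _ _ _ zn' zn.
  by rewrite !scaleN1r addNr addrC.
have /choice[k kE] : forall z, exists n, G' z n.
  move=> z; have [c ->] := sZ z.
  elim/big_ind: _ => [|z1 z2 [n1 zn1] [n2 zn2]|i _]; first by exists 0.
    by exists (n1 + n2); rewrite -[z1]scale1r -[n1]scale1r; exact: GD.
  have [n sn] := Gs _ (mem_nth 0 (ltn_ord i)).
  by exists (c i *: n); have := GD (c i) _ _ _ _ sn G0; rewrite !addr0.
have kL : linear k by move=> a z z'; apply: GU (kE _) _; exact: GD.
by exists (mk_linear kL) => y; apply: GU (kE _) _; apply: GG'; exists y.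
Qed.
End LinearExtension.

(** Injectivity of all modules, relative to finite-dimensional Z. As w need not be injective, it can
    be a differential of a resolution. *)
Definition linear_maps_extend (K : fieldType) (S : falgType K) : Prop :=
  forall (Y Z N : lmodType S) (w : {linear Y -> Z}) (f : {linear Y -> N}),
  fin_dim Z -> (forall y, w y = 0 -> f y = 0) ->
  exists k : {linear Z -> N}, forall y, k (w y) = f y.

Lemma base_alg_extend (K : fieldType) : linear_maps_extend (base_alg K).
Proof.
move=> Y Z N w f [s sZ] wf.
apply: (@linear_extension K (Z : lmodType K) (N : lmodType K) (Y : lmodType K) w f s) wf.
move=> z; have [c ->] := sZ z; exists c; apply: eq_bigr => i _.
by congr (_ *: _); exact: mulr1.
Qed.

(* The simple module at a source is injective. *)
Lemma injective_source (K : fieldType) (R S : falgType K) (q : idem_quot R S)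
    (Y Z N : lmodType R) (w : {linear Y -> Z}) (f : {linear Y -> N}) :
  linear_maps_extend S -> fin_dim Z -> (forall x : N, iq_idem q *: x = 0) ->
  (forall y, w y = 0 -> f y = 0) -> exists k : {linear Z -> N}, forall y, k (w y) = f y.
Proof.
move=> Sx Zf gN wf.
have [|k kE] := Sx _ _ _ (red_map q w) (red_map q f) (fin_dim_red q Zf).
  by move=> y wy; apply: val_inj; rewrite val_red_map wf // -val_red_map wy.
have [K1 K1E] := red_untranspose k.
have [U UE] : exists U : {linear N -> res q (red q N)}, forall x, U x = eta q x.
  by exists (unit_map q N).
have UI : injective U by move=> x y; rewrite !UE => /(eta_iq_inj gN).
have [k' k'E] : exists k' : {linear Z -> N}, forall z, U (k' z) = K1 z.
  by apply: factor_inj UI _ => z; exists (val (K1 z)); rewrite UE eta_val.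
by exists k' => y; apply: UI; rewrite k'E K1E UE -[RHS]red_mapE -kE red_mapE.
Qed.

(** Projectivity used at an exact spot: h lands in the kernel of w, onto which X maps. Finite
    dimension enters because [projective] tests only such modules. *)
Lemma projective_lift (K : fieldType) (R : falgType K) (P X Y Z : lmodType R)
    (u : {linear X -> Y}) (w : {linear Y -> Z}) (h : {linear P -> Y}) :
  projective P -> fin_dim X -> exact_at u w -> (forall x, w (h x) = 0) ->
  exists h' : {linear P -> X}, forall x, u (h' x) = h x.
Proof.
move=> [_ Pp] Xf uw wh; have [U [i [iI iE]]] := kernel_type w.
have [p pE] : exists p : {linear X -> U}, forall x, i (p x) = u x.
  by apply: factor_inj iI _ => x; apply/iE/uw; exists x.
have [k kE] : exists k : {linear P -> U}, forall x, i (k x) = h x.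
  by apply: factor_inj iI _ => x; apply/iE; exact: wh.
have pS : surj p.
  move=> y; have /uw[x xE] : w (i y) = 0 by apply/iE; exists y.
  by exists x; apply: iI; rewrite pE.
have [h' hE] := Pp _ _ p k Xf (fin_dim_surj pS Xf) pS.
by exists h' => x; rewrite -pE hE kE.
Qed.

(** A projective resolution of zero splits: some t satisfies dtd = d. Then x - t(dx) is a boundary,
    so a cocycle f equals ftd. *)
Lemma contractible (K : fieldType) (R : falgType K) (M N : lmodType R)
    (P : resolution M) m (f : {linear res_mod P m.+1 -> N}) :
  (forall x : M, x = 0) -> cocycle f -> coboundary f.
Proof.
move=> M0 fc; have Pf k : fin_dim (res_mod P k) by have [] := res_projective P k.
pose d k := res_diff P k.
have [t tE] : exists t : {linear res_mod P m -> res_mod P m.+1},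
    forall x, d m (t (d m x)) = d m x.
  elim: m {f fc} => [|m [t tE]].
    have [t tE] := projective_lift (h := lmap_id _) (res_projective P 0)
      (Pf 1) (@res_exact0 _ _ _ P) (fun x => M0 _).
    by exists t => x; rewrite tE.
  (* By the previous stage 1 - td takes values in the kernel of d, so it lifts through the next
     differential. *)
  pose h : {linear res_mod P m.+1 -> res_mod P m.+1} := lmap_id _ \- lmap_comp t (d m).
  have [|t' tE'] := projective_lift (h := h) (res_projective P m.+1)
      (Pf m.+2) (@res_exactS _ _ _ P m).
    by move=> x; rewrite /= linearB tE subrr.
  have dd x : d m (d m.+1 x) = 0 by apply/(@res_exactS _ _ _ P m); exists x.
  by exists t' => x; rewrite tE' /= dd linear0 subr0.
exists (lmap_comp f t) => x.
have /(@res_exactS _ _ _ P m)[y yE] : d m (t (d m x) - x) = 0.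
  by rewrite linearB tE subrr.
have : f (t (d m x) - x) = 0 by rewrite -yE; exact: fc.
by rewrite linearB => /eqP; rewrite subr_eq0 => /eqP <-.
Qed.

(** * Transport of the Ext condition *)

Section ExtTransport.
Variables (K : fieldType) (A : falgType K) (B : {aspace A}).
Implicit Types (M N : lmodType (subvs_of B)).

Lemma ext_zero M N : (forall x : M, x = 0) -> ext_induction_iso M N.
Proof.
move=> M0 P R phi phi0 phiS m; split=> [f fc _|g gc]; first exact: contractible.
have [h hE] := contractible (induced0 M0) gc.
exists (lmap_zero _ _); split=> //; exists h => x.
by rewrite hE induced_map0 subr0.
Qed.

(** Only the augmentations change with M: composed with the isomorphism, resolutions of M' become
    resolutions of M with the same chain map. *)
Lemma ext_transport M M' N N' : isomorphic M M' -> isomorphic N N' ->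
  ext_induction_iso M N -> ext_induction_iso M' N'.
Proof.
move=> /isomorphicP[h [k [hK kK]]] /isomorphicP[h' [k' [hK' kK']]] MN P R phi phi0 phiS.
have indK (X Y : lmodType (subvs_of B)) (u : {linear X -> Y}) (w : {linear Y -> X}) :
    cancel u w -> cancel (induced_map u) (induced_map w).
  move=> uK; apply: (@induced_ext _ _ _ _ _ (lmap_comp (induced_map w) (induced_map u)) (lmap_id _)).
  by move=> a n; rewrite /= !induced_map_pure uK.
have ind_comp (X Y Z : lmodType (subvs_of B)) (u : {linear X -> Y}) (w : {linear Y -> Z}) x :
    induced_map (lmap_comp w u) x = induced_map w (induced_map u x).
  move: x; apply: (@induced_ext _ _ _ _ _ (induced_map (lmap_comp w u))
    (lmap_comp (induced_map w) (induced_map u))).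
  by move=> a n; rewrite /= !induced_map_pure.
have PS : surj (lmap_comp k (res_aug P)).
  by move=> x; have [y yE] := res_aug_surj P (h x); exists y; rewrite /= yE hK.
have P0 : exact_at (res_diff P 0%N) (lmap_comp k (res_aug P)).
  move=> y; rewrite -(@res_exact0 _ _ _ P y) /=; split=> [e|->]; last exact: linear0.
  by rewrite -[LHS]kK e linear0.
pose P' := Resolution (res_projective P) PS P0 (@res_exactS _ _ _ P).
have RS : surj (lmap_comp (induced_map k) (res_aug R)).
  move=> x; have [y yE] := res_aug_surj R (induced_map h x).
  by exists y; rewrite /= yE (indK _ _ _ _ hK).
have R0 : exact_at (res_diff R 0%N) (lmap_comp (induced_map k) (res_aug R)).
  move=> y; rewrite -(@res_exact0 _ _ _ R y) /=; split=> [e|->]; last exact: linear0.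
  by rewrite -[LHS](indK _ _ _ _ kK) e linear0.
pose R' := Resolution (res_projective R) RS R0 (@res_exactS _ _ _ R).
have e x : induced_map (res_aug P') (phi 0%N x) = res_aug R' x.
  by rewrite /= ind_comp phi0.
move=> m; have [inj sur] := MN P' R' phi e phiS m; split=> [f fc [w wE]|g gc].
  have [||u uE] := inj (lmap_comp k' f).
  - by move=> x; rewrite /= fc linear0.
  - by exists (lmap_comp (induced_map k') w) => x; rewrite ind_comp wE.
  by exists (lmap_comp h' u) => x; rewrite /= -uE /= kK'.
have [|f [fc [w wE]]] := sur (lmap_comp (induced_map k') g).
  by move=> x; rewrite /= gc linear0.
exists (lmap_comp h' f); split; first by move=> x; rewrite /= fc linear0.
exists (lmap_comp (induced_map h') w) => x.
by rewrite /= -wE linearB /= (indK _ _ _ _ kK') ind_comp.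
Qed.
End ExtTransport.

Definition red_resolution (K : fieldType) (R S : falgType K) (q : idem_quot R S)
    (M : lmodType R) (P : resolution M) : resolution (red q M) :=
  Resolution (fun k => red_projective q (res_projective P k))
    (red_surj (q := q) (@res_aug_surj _ _ _ P))
    (red_exact (q := q) (@res_exact0 _ _ _ P))
    (fun k => red_exact (q := q) (@res_exactS _ _ _ P k)).

(** Left transparent, since [res_mod] of the result must reduce to that of P. *)
Definition iso_resolution (K : fieldType) (R : falgType K) (M N : lmodType R)
    (P : resolution M) (f : {linear M -> N}) (fB : bijective f) : resolution N.
Proof.
apply: (@Resolution _ _ N (res_mod P) (@res_diff _ _ _ P) (lmap_comp f (res_aug P))
  (res_projective P) _ _ (@res_exactS _ _ _ P)).
- have [g fK gK] := fB => y; have [x xE] := @res_aug_surj _ _ _ P (g y).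
  by exists x; rewrite /= xE gK.
- move=> y; rewrite -(@res_exact0 _ _ _ P y) /=; split=> [e|->]; last exact: linear0.
  by apply: (bij_inj fB); rewrite e linear0.
Defined.

Section ExtReduction.
Variables (K : fieldType) (A A1 : falgType K) (B : {aspace A}) (B1 : {aspace A1}).
Variables (q : idem_quot A A1) (s : idem_quot (subvs_of B) (subvs_of B1)).
Hypothesis sE : forall b, vsval (s b) = q (vsval b).
Variables (M N : lmodType (subvs_of B)).
Hypothesis MN : ext_induction_iso (red s M) (red s N).
Variables (P : resolution M) (R : resolution (induced M)).
Variable phi : forall k, {linear res_mod R k -> induced (res_mod P k)}.
Hypothesis phi0 : forall x, induced_map (res_aug P) (phi 0%N x) = res_aug R x.
Hypothesis phiS : forall k x,
  induced_map (res_diff P k) (phi k.+1 x) = phi k (res_diff R k x).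
Local Notation bc := (base_change sE).

Let P1 := red_resolution s P.
Let R1 := iso_resolution (red_resolution q R) (base_change_bij sE M).
(** Through base change the reduction of [phi] becomes a comparison map over A1, to which the Ext
    condition for the reduced modules applies. *)
Let phi1 k : {linear res_mod R1 k -> induced (res_mod P1 k)} :=
  lmap_comp (bc (res_mod P k)) (red_map q (phi k)).

Let phi1_0 x : induced_map (res_aug P1) (phi1 0%N x) = res_aug R1 x.
Proof.
rewrite -[x in LHS]eta_val -[x in RHS]eta_val /= -base_change_nat !red_mapE.
by rewrite -phi0.
Qed.

Let phi1_S k x : induced_map (res_diff P1 k) (phi1 k.+1 x) = phi1 k (res_diff R1 k x).
Proof.
rewrite -[x in LHS]eta_val -[x in RHS]eta_val /= -base_change_nat !red_mapE.
by rewrite -phiS.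
Qed.

Lemma red_cocycle_lift m (f : {linear res_mod P m.+1 -> N}) : cocycle f ->
  coboundary (fun x => induced_map f (phi m.+1 x)) ->
  exists k : {linear red s (res_mod P m) -> red s N},
    forall x, eta s (f x) = k (eta s (res_diff P m x)).
Proof.
move=> fc [h hE]; have [inj _] := MN phi1_0 phi1_S m.
have [||k kE] := inj (red_map s f).
- by move=> x; rewrite -(eta_val x) /= !red_mapE fc raddf0.
- exists (lmap_comp (bc N) (red_map q h)) => x.
  rewrite -(eta_val x) /= !red_mapE -base_change_nat red_mapE.
  by rewrite -hE.
by exists k => x; rewrite -red_mapE kE /= red_mapE.
Qed.

(** The conclusion stays on the reduced side: lifting f and h back requires the idempotents to kill
    N and its induced module, and the latter may fail at the source. *)
Lemma red_cocycle_surj m (g : {linear res_mod R m.+1 -> induced N}) : cocycle g ->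
  exists (f : {linear red s (res_mod P m.+1) -> red s N})
    (h : {linear red q (res_mod R m) -> induced (red s N)}),
  (forall x, f (eta s (res_diff P m.+1 x)) = 0) /\
  (forall x, bc N (eta q (g x)) =
    induced_map f (bc _ (eta q (phi m.+1 x))) + h (eta q (res_diff R m x))).
Proof.
move=> gc; have [_ sur] := MN phi1_0 phi1_S m.
have [|f [fc [h hE]]] := sur (lmap_comp (bc N) (red_map q g)).
  by move=> x; rewrite -(eta_val x) /= !red_mapE gc raddf0 linear0.
exists f, h; split=> x; first by rewrite -red_mapE fc.
have := hE (eta q x); rewrite /= !red_mapE => <-.
by rewrite addrC subrK.
Qed.

Hypothesis N0 : forall x : N, iq_idem s *: x = 0.

(** As N is killed by the idempotent, it embeds in its reduction by [unit_map], and a primitive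
    found after reduction factors through this embedding. *)
Lemma ext_injective m (f : {linear res_mod P m.+1 -> N}) : cocycle f ->
  coboundary (fun x => induced_map f (phi m.+1 x)) -> coboundary f.
Proof.
move=> fc /(red_cocycle_lift fc)[k kE].
have etaI : injective (unit_map s N) := eta_iq_inj N0.
have [k' k'E] := factor_inj etaI (f := lmap_comp (res_map s k) (unit_map s _))
  (fun z => ex_intro _ _ (eta_val _)).
exists k' => x; apply: etaI.
by rewrite k'E /= res_mapE -[RHS]kE.
Qed.

Lemma ext_surjective m (g : {linear res_mod R m.+1 -> induced N}) :
  (forall x : induced N, iq_idem q *: x = 0) -> cocycle g ->
  exists f : {linear res_mod P m.+1 -> N}, cocycle f /\
    coboundary (fun x => g x - induced_map f (phi m.+1 x)).
Proof.
move=> T0 /red_cocycle_surj[f [h [fc gE]]].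
have etaI : injective (unit_map s N) := eta_iq_inj N0.
have [f' f'E] := factor_inj etaI (f := lmap_comp (res_map s f) (unit_map s _))
  (fun z => ex_intro _ _ (eta_val _)).
have f'red : forall x, f x = red_map s f' x.
  move=> x; rewrite -(eta_val x) red_mapE; have := f'E (val x).
  by rewrite /= res_mapE.
have fE : forall x, induced_map f x = induced_map (red_map s f') x.
  apply: (@induced_ext _ _ _ _ _ (induced_map f) (induced_map (red_map s f'))).
  by move=> a n /=; rewrite !induced_map_pure f'red.
exists f'; split.
  by move=> x; apply: etaI; rewrite f'E /= res_mapE fc raddf0.
have bcI : injective (bc N) by exact/bij_inj/base_change_bij.
have [bu buE] := red_untranspose (bc N).
have [hu huE] := red_untranspose h.
have buI : injective bu.
  by move=> x y; rewrite !buE => /bcI/(eta_iq_inj T0).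
have [h' h'E] : exists h' : {linear res_mod R m -> induced N},
    forall x, bu (h' x) = hu x.
  apply: factor_inj buI _ => x; have [b bK bK'] := base_change_bij sE N.
  by exists (val (b (h (eta q x)))); rewrite buE eta_val bK' huE.
exists h' => x; apply: buI; rewrite h'E huE buE raddfB linearB gE fE.
by rewrite -base_change_nat red_mapE addrC addKr.
Qed.
End ExtReduction.

Lemma ext_one_side (K : fieldType) (A A1 : falgType K) (B : {aspace A})
    (B1 : {aspace A1}) (q : idem_quot A A1) (s : idem_quot (subvs_of B) (subvs_of B1))
    (M N : lmodType (subvs_of B)) :
  (forall b, vsval (s b) = q (vsval b)) ->
  ext_induction_iso (red s M) (red s N) -> (forall x : N, iq_idem s *: x = 0) ->
  (forall x : induced N, iq_idem q *: x = 0) -> ext_induction_iso M N.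
Proof.
move=> sE MN N0 T0 P R phi phi0 phiS m; split=> f fc.
  exact: (ext_injective sE MN phi0 phiS N0 fc).
exact: (ext_surjective sE MN phi0 phiS N0 T0 fc).
Qed.

Section SourceReduction.
Variables (K : fieldType) (A A1 : falgType K) (B : {aspace A}) (B1 : {aspace A1}).
Variables (q : idem_quot A A1) (s : idem_quot (subvs_of B) (subvs_of B1)).
Hypothesis sE : forall b, vsval (s b) = q (vsval b).
Variables (M N : lmodType (subvs_of B)).
Hypothesis MN : ext_induction_iso (red s M) (red s N).
Variables (P : resolution M) (R : resolution (induced M)).
Variable phi : forall k, {linear res_mod R k -> induced (res_mod P k)}.
Hypothesis phi0 : forall x, induced_map (res_aug P) (phi 0%N x) = res_aug R x.
Hypothesis phiS : forall k x,
  induced_map (res_diff P k) (phi k.+1 x) = phi k (res_diff R k x).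
Variables (R0 : falgType K) (s0 : idem_quot (subvs_of B) R0).
Hypothesis R0x : linear_maps_extend R0.
Hypothesis N0 : forall x : N, iq_idem s0 *: x = 0.
Local Notation bc := (base_change sE).

(** N is relatively injective over B, so f extends along the differential of P. Hence its
    contribution to g is itself a coboundary, and so is the reduction of g. *)
Lemma source_cocycle m (g : {linear res_mod R m.+1 -> induced N}) : cocycle g ->
  exists h : {linear red q (res_mod R m) -> red q (induced N)},
    forall x, eta q (g x) = h (eta q (res_diff R m x)).
Proof.
case/(red_cocycle_surj sE MN phi0 phiS)=> f [h [fc gE]].
have [F FE] := red_untranspose f.
have [|||k kE] := @injective_source _ _ _ s0 _ _ _ (res_diff P m) F R0x.
- by have [] := res_projective P m.
- move=> y; rewrite res_scaleE -(eta_val y) -etaZ N0; exact: raddf0.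
- by move=> y /(@res_exactS _ _ _ P m)[x <-]; rewrite FE fc.
have [k' k'E] := red_transpose k.
have fE x : f x = k' (red_map s (res_diff P m) x).
  by rewrite -(eta_val x) red_mapE k'E kE FE.
have indE x : induced_map f x = induced_map k' (induced_map (red_map s (res_diff P m)) x).
  move: x; apply: (@induced_ext _ _ _ _ _ (induced_map f)
    (lmap_comp (induced_map k') (induced_map (red_map s (res_diff P m))))).
  by move=> a n; rewrite /= !induced_map_pure fE.
have [b bK bK'] := base_change_bij sE N.
have [b' b'E] := factor_inj (can_inj bK) (f := lmap_id _)
  (fun x => ex_intro _ (b x) (bK' x)).
exists (lmap_comp b' (lmap_comp (induced_map k') (lmap_comp (bc _) (red_map q (phi m))) \+ h)).
move=> x; apply: (can_inj bK); rewrite b'E /= gE indE -base_change_nat !red_mapE.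
by rewrite /= phiS.
Qed.
End SourceReduction.

(** * Ext into the simple module at the source *)

Section ExtSource.
Variables (K : fieldType) (A A1 A2 R0 : falgType K).
Variables (B : {aspace A}) (B1 : {aspace A1}) (B2 : {aspace A2}).
Variables (q1 : idem_quot A A1) (q2 : idem_quot A A2) (q0 : idem_quot A R0).
Hypothesis gl : gluing q1 q2 q0.
Variables (s1 : idem_quot (subvs_of B) (subvs_of B1)).
Variables (s2 : idem_quot (subvs_of B) (subvs_of B2)) (s0 : idem_quot (subvs_of B) R0).
Hypotheses (s1E : forall b, vsval (s1 b) = q1 (vsval b)).
Hypotheses (s2E : forall b, vsval (s2 b) = q2 (vsval b)).

Lemma glue_q0_idem1 : q0 (iq_idem q1) = 0.
Proof. by apply/iq_ker; have [_ g21 ->] := gl; rewrite mulrDl iq_idemK g21 addr0. Qed.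

Lemma eta0_eta1 (T : lmodType A) (t : T) : eta q0 (val (eta q1 t)) = eta q0 t.
Proof. by rewrite val_eta raddfB /= eta_ker ?subr0 ?glue_q0_idem1. Qed.

Lemma red_to_source (M T : lmodType A) (h : {linear M -> res q1 (red q1 T)}) :
  exists t : {linear M -> res q0 (red q0 T)}, forall x, t x = eta q0 (val (h x)).
Proof.
have tL : linear ((fun x => eta q0 (val (h x))) : M -> res q0 (red q0 T)).
  move=> a x y; rewrite linearP res_scaleE -{1}(eta_val (h x)) -etaZ val_redD.
  by rewrite raddfD /= eta0_eta1 etaZ.
by exists (mk_linear tL).
Qed.
End ExtSource.

Lemma ext_source (K : fieldType) (A A1 A2 R0 : falgType K)
    (B : {aspace A}) (B1 : {aspace A1}) (B2 : {aspace A2})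
    (q1 : idem_quot A A1) (q2 : idem_quot A A2) (q0 : idem_quot A R0)
    (s1 : idem_quot (subvs_of B) (subvs_of B1))
    (s2 : idem_quot (subvs_of B) (subvs_of B2)) (s0 : idem_quot (subvs_of B) R0)
    (M N : lmodType (subvs_of B)) :
  linear_maps_extend R0 -> gluing q1 q2 q0 -> (forall b, vsval (s1 b) = q1 (vsval b)) ->
  (forall b, vsval (s2 b) = q2 (vsval b)) ->
  ext_induction_iso (red s1 M) (red s1 N) -> ext_induction_iso (red s2 M) (red s2 N) ->
  (forall x : N, iq_idem s1 *: x = 0) -> (forall x : N, iq_idem s0 *: x = 0) ->
  fin_dim (induced N) ->
  (forall e : {linear induced M -> res q0 (red q0 (induced N))},
    exists h : {linear induced M -> induced N}, forall x, eta q0 (h x) = e x) ->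
  ext_induction_iso M N.
Proof.
move=> R0x gl s1E s2E MN1 MN2 N1 N0 Tf lift0 P R phi phi0 phiS m; split=> [f fc|g gc].
  exact: (ext_injective s1E MN1 phi0 phiS N1 fc).
(* Ext into the module induced from N is shown to vanish, so the zero cocycle serves for every g. *)
exists (lmap_zero _ _); split=> //.
suff [h hE] : coboundary g.
  by exists h => x; rewrite hE induced_map0 subr0.
have [h1 h1E] := source_cocycle s1E MN1 phi0 phiS R0x N0 gc.
have [h2 h2E] := source_cocycle s2E MN2 phi0 phiS R0x N0 gc.
have [H1 H1E] := red_untranspose h1; have [H2 H2E] := red_untranspose h2.
have [t1 t1E] := red_to_source gl H1; have [t2 t2E] := red_to_source (gluing_sym gl) H2.
(* The primitives on the two sides glue only if they agree in the reduction at [q0]. The defect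
   [del] vanishes on boundaries, where both agree with g. *)
pose del := lmap_sub t1 t2; have delE := lmap_subE t1 t2.
rewrite -/del in delE; move: del delE => del delE.
have t1d x : t1 (res_diff R m x) = eta q0 (g x).
  rewrite t1E H1E -h1E (eta0_eta1 gl); reflexivity.
have t2d x : t2 (res_diff R m x) = eta q0 (g x).
  rewrite t2E H2E -h2E (eta0_eta1 (gluing_sym gl)); reflexivity.
have del0 x : del (res_diff R m x) = 0 by rewrite delE t1d t2d; exact: subrr.
(* Subtracting such an H from the first primitive removes the defect and changes nothing on
   boundaries. *)
have [H [HE H0]] : exists H : {linear res_mod R m -> induced N},
    (forall x, eta q0 (H x) = del x) /\ forall x, H (res_diff R m x) = 0.
  move: del del0 {delE}; clear -lift0 Tf R0x; case: m => [|m] del del0.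
    (* In the lowest degree the defect descends to the module induced from M and is lifted there by
       [lift0]. *)
    have [|e eE] := factor_surj (f := del) (@res_aug_surj _ _ _ R).
      by move=> x /(@res_exact0 _ _ _ R)[y <-].
    have [h hE] := lift0 e; exists (lmap_comp h (res_aug R)); split=> x /=.
      by rewrite hE eE.
    rewrite [res_aug R _](_ : _ = 0) ?linear0 //.
    by apply/(@res_exact0 _ _ _ R); exists x.
  (* Otherwise the defect extends along the next differential by injectivity of its target, and the
     extension lifts to the module induced from N by projectivity of [res_mod R m]. *)
  have [|||e eE] := @injective_source _ _ _ q0 _ _ _ (res_diff R m) del R0x.
  - by have [] := res_projective R m.
  - exact: res_idem0.
  - by move=> y /(@res_exactS _ _ _ R m)[x <-].
  have [_ Rp] := res_projective R m.
  have [||h hE] := Rp _ _ (unit_map q0 (induced N)) e Tf.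
  - by apply: (fin_dim_surj (f := unit_map q0 _)) Tf; exact: eta_surj.
  - exact: eta_surj.
  exists (lmap_comp h (res_diff R m)); split=> x /=.
    by rewrite -eE -hE.
  rewrite [res_diff R m _](_ : _ = 0) ?linear0 //.
  by apply/(@res_exactS _ _ _ R m); exists x.
pose H' := lmap_comp (unit_map q1 _) H.
have H'E x : H' x = eta q1 (H x) by reflexivity.
pose H1' := lmap_sub H1 H'; have H1'E := lmap_subE H1 H'.
rewrite -/H1' in H1'E; move: H1' H1'E => H1' H1'E.
have H1'0 x : eta q0 (val (H1' x)) = t2 x.
  have -> : eta q0 (val (H1' x)) =
      eta q0 (val (H1 x)) - eta q0 (val (eta q1 (H x))).
    rewrite H1'E val_resB raddfB H'E; reflexivity.
  rewrite (eta0_eta1 gl) HE delE -t1E.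
  rewrite opprB addrC.
  exact: subrK.
have [|h hE] := glue_map gl (h1 := H1') (h2 := H2).
  move=> x; rewrite H1'0 t2E; reflexivity.
exists h => x; have [e1 e2] := hE (res_diff R m x).
apply/eqP; rewrite -subr_eq0; apply/eqP; apply: (eta_inj gl).
  rewrite etaB e1 H1'E H'E H0 H1E -h1E raddf0 subr0; exact: subrr.
rewrite etaB e2 H2E -h2E; exact: subrr.
Qed.

(** * Standard and simple modules of a fibre product *)

(* The family M restricted to V comes from M1 by restriction along q, and the
   remaining members of M are killed by reduction. *)
Definition supported_on (K : fieldType) (A A1 : falgType K) (q : idem_quot A A1)
    (I : finType) (V : {set I}) (M : I -> lmodType A)
    (M1 : {x : I | x \in V} -> lmodType A1) : Prop :=
  (forall x, isomorphic (M (val x)) (res q (M1 x))) /\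
  (forall x, x \notin V -> forall m : M x, iq_idem q *: m = m).

Section Support.
Variables (K : fieldType) (A A1 : falgType K) (q : idem_quot A A1).
Variables (I : finType) (V : {set I}) (M : I -> lmodType A).
Variable M1 : {x : I | x \in V} -> lmodType A1.
Hypothesis MV : supported_on q M M1.

Lemma supported_red x : isomorphic (red q (M (val x))) (M1 x).
Proof. exact: isomorphic_trans (red_iso q (MV.1 x)) (red_res q (M1 x)). Qed.

Lemma supported_red0 x : x \notin V -> forall m : red q (M x), m = 0.
Proof. by move=> xV; apply: red_eq0; exact: MV.2. Qed.

Lemma supported_idem0 x : x \in V -> forall m : M x, iq_idem q *: m = 0.
Proof.
move=> xV m; have [f [g [fK gK]]] := isomorphicP (MV.1 (Sub x xV)).
by apply: (can_inj fK); rewrite (linearZZ f) res_idem0 linear0.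
Qed.

Variable le : rel I.

Lemma factors_below_res x (N : lmodType A1) :
  factors_below M1 (relpre val le) x N -> factors_below M le (val x) (res q N).
Proof.
apply: res_filtered => S [j ji Sj]; exists (val j) => //.
exact: isomorphic_trans (res_iso q Sj) (isomorphic_sym (MV.1 j)).
Qed.

Lemma factors_below_red x (N : lmodType A) :
  factors_below M le (val x) N -> factors_below M1 (relpre val le) x (red q N).
Proof.
apply: red_filtered => S [j ji Sj].
have [jV|jV] := boolP (j \in V); last first.
  right=> y; have [f [g [fK gK]]] := isomorphicP (red_iso q Sj).
  by apply: (can_inj fK); rewrite linear0; exact: supported_red0.
left; exists (Sub j jV) => //.
exact: isomorphic_trans (red_iso q Sj) (supported_red (Sub j jV)).
Qed.
End Support.

Section Side.
Variables (K : fieldType) (A A1 : falgType K) (B : {aspace A}) (B1 : {aspace A1}).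
Variables (q : idem_quot A A1) (s : idem_quot (subvs_of B) (subvs_of B1)).
Hypothesis sE : forall b, vsval (s b) = q (vsval b).
Variables (I : finType) (V : {set I}).
Variable LB : I -> lmodType (subvs_of B).
Variable LB1 : {x : I | x \in V} -> lmodType (subvs_of B1).
Hypothesis LBV : supported_on s LB LB1.

Lemma red_induced_standard (L1 : {x : I | x \in V} -> lmodType A1) le x :
  (exists2 D, standard_module L1 le x D & isomorphic (induced (LB1 x)) D) ->
  standard_module L1 le x (red q (induced (LB (val x)))).
Proof.
move=> [D Dst LD]; apply: standard_module_iso Dst; apply: isomorphic_sym.
apply: isomorphic_trans (base_change_iso sE _) (isomorphic_trans _ LD).
exact/induced_map_iso/supported_red.
Qed.

Lemma red_induced0 x : x \notin V -> forall t : red q (induced (LB x)), t = 0.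
Proof.
move=> xV t; have [f [g [fK gK]]] := isomorphicP (base_change_iso sE (LB x)).
apply: (can_inj fK); rewrite linear0.
exact: (induced0 (supported_red0 LBV xV) (f t)).
Qed.

Lemma ext_red i j : (forall i j, ext_induction_iso (LB1 i) (LB1 j)) -> j \in V ->
  ext_induction_iso (red s (LB i)) (red s (LB j)).
Proof.
move=> ext jV; have [iV|iV] := boolP (i \in V); last first.
  exact/ext_zero/(supported_red0 LBV iV).
apply: ext_transport (ext (Sub i iV) (Sub j jV)).
  exact/isomorphic_sym/(supported_red LBV (Sub i iV)).
exact/isomorphic_sym/(supported_red LBV (Sub j jV)).
Qed.
End Side.

Lemma scalar_comm (K : fieldType) (A : falgType K) (k : K) (a : A) : k%:A * a = a * k%:A.
Proof. by rewrite mulr_algl mulr_algr. Qed.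

Lemma scale_map (K : fieldType) (A : falgType K) (M : lmodType A) (k : K) :
  k != 0 -> exists f : {linear M -> M}, bijective f /\ forall x, f x = k%:A *: x.
Proof.
have fL (c : K) : linear (fun x : M => c%:A *: x).
  by move=> a x y; rewrite scalerDr !scalerA scalar_comm.
move=> k0; exists (mk_linear (fL k)); split=> //.
exists (mk_linear (fL k^-1)) => x /=; rewrite scalerA mulr_algl scalerA.
  by rewrite mulVf // !scale1r.
by rewrite mulfV // !scale1r.
Qed.

(* The reduction r of a map out of the projective cover of L i is standard, or
   i is not a vertex of this side and everything vanishes. *)
Definition side_standard (K : fieldType) (A A1 : falgType K) (q : idem_quot A A1)
    (I : finType) (V : {set I}) (le : rel I) (L1 : {x : I | x \in V} -> lmodType A1)
    (i : I) (P T : lmodType A) (r : {linear red q P -> red q T}) : Prop :=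
  (forall iV : i \in V, standard_quotient L1 (relpre val le) (Sub i iV) r) /\
  (i \notin V -> (forall x : red q P, x = 0) /\ forall t : red q T, t = 0).

Lemma side_standard_exists (K : fieldType) (A A1 : falgType K) (q : idem_quot A A1)
    (I : finType) (V : {set I}) (le : rel I) (L : I -> lmodType A)
    (L1 : {x : I | x \in V} -> lmodType A1) (i : I) (P T : lmodType A)
    (p : {linear P -> L i}) :
  supported_on q L L1 -> projective_cover p ->
  (forall iV : i \in V, standard_module L1 (relpre val le) (Sub i iV) (red q T)) ->
  (i \notin V -> forall t : red q T, t = 0) ->
  exists r : {linear red q P -> red q T}, side_standard le L1 i r.
Proof.
move=> LV cp Tst T0; have [iV|iV] := boolP (i \in V).
  have [f fB] := supported_red LV (Sub i iV).
  have cp1 := cover_iso fB (red_cover (supported_idem0 LV iV) cp).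
  have [r rst] := standard_module_cover (Tst iV) cp1.
  exists r; split=> [iV'|]; last by rewrite iV.
  by rewrite (bool_irrelevance iV' iV).
exists (lmap_zero _ _); split=> [iV'|_]; first by rewrite iV' in iV.
split; last exact: T0.
(* Outside V the idempotent g acts as 1 on [L i], so gP + ker p = P, and superfluity gives gP =
   P. *)
apply: red_eq0; apply: (cover_superfluous cp) => [|a x y gx gy|x].
- exact: scaler0.
- exact: idem_fixedP.
- exists (iq_idem q *: x); first by rewrite scalerA iq_idemK.
  by rewrite linearB (linearZZ p) (LV.2 _ iV) subrr.
Qed.

(** * Gluing standard modules *)

Section GluedStandard.
Variables (K : fieldType) (A A1 A2 R0 : falgType K).
Variables (q1 : idem_quot A A1) (q2 : idem_quot A A2) (q0 : idem_quot A R0).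
Hypothesis gl : gluing q1 q2 q0.
Variables (I : finType) (V1 V2 : {set I}) (le : rel I).
Variables (L : I -> lmodType A).
Variables (L1 : {x : I | x \in V1} -> lmodType A1) (L2 : {x : I | x \in V2} -> lmodType A2).
Hypotheses (LV1 : supported_on q1 L L1) (LV2 : supported_on q2 L L2).
Hypothesis L_simple : forall x, simple_module (L x).

(** Surjectivity, composition factors and the universal property are each checked on the two
    reductions, which together determine a module. *)
Lemma glued_standard_quotient i (P T : lmodType A) (h : {linear P -> T})
    (r1 : {linear red q1 P -> red q1 T}) (r2 : {linear red q2 P -> red q2 T}) :
  (forall x, eta q1 (h x) = r1 (eta q1 x)) -> (forall x, eta q2 (h x) = r2 (eta q2 x)) ->
  side_standard le L1 i r1 -> side_standard le L2 i r2 -> standard_quotient L le i h.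
Proof.
move=> h1 h2 [st1 z1] [st2 z2]; split.
- move=> y; apply: (glue_preimage gl).
    have [iV|/z1[_ T0]] := boolP (i \in V1); last by exists 0; exact: etrans (T0 _) (esym (T0 _)).
    have [rS _ _] := st1 iV; have [x xE] := rS (eta q1 y); exists x.
    by rewrite -xE -(eta_val x) red_mapE h1.
  have [iV|/z2[_ T0]] := boolP (i \in V2); last by exists 0; exact: etrans (T0 _) (esym (T0 _)).
  have [rS _ _] := st2 iV; have [x xE] := rS (eta q2 y); exists x.
  by rewrite -xE -(eta_val x) red_mapE h2.
(* T is an extension of its first reduction by a kernel that embeds in the second one. *)
- have [X [u [uI uE]]] := kernel_type (unit_map q1 T).
  have T1F : factors_below L le i (res q1 (red q1 T)).
    have [iV|/z1[_ T0]] := boolP (i \in V1); last exact: Filtered0.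
    by have [_ F _] := st1 iV; exact (factors_below_res LV1 F).
  have T2F : factors_below L le i (res q2 (red q2 T)).
    have [iV|/z2[_ T0]] := boolP (i \in V2); last exact: Filtered0.
    by have [_ F _] := st2 iV; exact (factors_below_res LV2 F).
  apply: (filtered_extension (f := u) (g := unit_map q1 T)) T1F.
    by split=> //; exact: eta_surj.
  apply: (filtered_submodule _ _ T2F (f := lmap_comp (unit_map q2 T) u)).
  + by move=> S [j _ Sj]; exact: simple_iso (isomorphic_sym Sj) (L_simple j).
  + by move=> S S' SS' [j ji Sj]; exists j => //; exact: isomorphic_trans (isomorphic_sym SS') Sj.
  move=> x y /= xy; apply: uI; apply/eqP; rewrite -subr_eq0 -linearB; apply/eqP.
  apply: (eta_inj gl); first by apply/uE; exists (x - y).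
  rewrite linearB etaB xy; exact: subrr.
- move=> D' q' q'S D'F x hx; apply: (eta_inj gl); rewrite -red_mapE.
    have [iV|/z1[P0 _]] := boolP (i \in V1); last by rewrite (P0 (eta q1 x)) linear0.
    have [_ _ U] := st1 iV; apply: U; first exact: red_surj.
      exact: (factors_below_red LV1 (x := Sub i iV)).
    by rewrite -h1 hx raddf0.
  have [iV|/z2[P0 _]] := boolP (i \in V2); last by rewrite (P0 (eta q2 x)) linear0.
  have [_ _ U] := st2 iV; apply: U; first exact: red_surj.
    exact: (factors_below_red LV2 (x := Sub i iV)).
  by rewrite -h2 hx raddf0.
Qed.

Lemma eta0_valZ (T : lmodType A) a (y : red q1 T) :
  eta q0 (val (q1 a *: y)) = q0 a *: eta q0 (val y).
Proof. by rewrite -{1}(eta_val y) -etaZ (eta0_eta1 gl) etaZ. Qed.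
End GluedStandard.

(** The standard projections on the two sides are chosen independently and need not agree over R0.
    They do after one of them is rescaled, because P is cyclic and R0 consists of scalars. *)
Lemma glued_standard (K : fieldType) (A A1 A2 R0 : falgType K) (q1 : idem_quot A A1)
    (q2 : idem_quot A A2) (q0 : idem_quot A R0) (I : finType) (V1 V2 : {set I})
    (le : rel I) (L : I -> lmodType A) (L1 : {x : I | x \in V1} -> lmodType A1)
    (L2 : {x : I | x \in V2} -> lmodType A2) i (P T : lmodType A) (p : {linear P -> L i}) :
  gluing q1 q2 q0 -> (forall r : R0, exists k : K, r = k%:A) ->
  supported_on q1 L L1 -> supported_on q2 L L2 -> (forall x, simple_module (L x)) ->
  projective_cover p ->
  (forall iV : i \in V1, standard_module L1 (relpre val le) (Sub i iV) (red q1 T)) ->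
  (i \notin V1 -> forall t : red q1 T, t = 0) ->
  (forall iV : i \in V2, standard_module L2 (relpre val le) (Sub i iV) (red q2 T)) ->
  (i \notin V2 -> forall t : red q2 T, t = 0) ->
  standard_module L le i T.
Proof.
move=> gl R0K LV1 LV2 Ls cp T1 T10 T2 T20.
have [r1 st1] := side_standard_exists LV1 cp T1 T10.
have [r2 st2] := side_standard_exists LV2 cp T2 T20.
suff [c [c0 agree]] : exists c : K, c != 0 /\ forall x,
    eta q0 (val (r1 (eta q1 x))) = eta q0 (val (c%:A *: r2 (eta q2 x))).
  have [f [fB fE]] := scale_map (red q2 T) c0.
  have st2' : side_standard le L2 i (lmap_comp f r2).
    split; last exact: st2.2.
    by move=> iV; apply: standard_quotient_iso fB (st2.1 iV).
  have [H1 H1E] := red_untranspose r1; have [H2 H2E] := red_untranspose (lmap_comp f r2).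
  have [|h hE] := glue_map gl (h1 := H1) (h2 := H2).
    move=> x; rewrite H1E H2E agree -fE; reflexivity.
  exists P, p, h; split=> //.
  apply: (glued_standard_quotient gl LV1 LV2 Ls) st1 st2' => x.
    by have [-> _] := hE x.
  by have [_ ->] := hE x.
have [iV1|iV1] := boolP (i \in V1); last first.
  have T00 (t : T) : eta q0 t = 0.
    by rewrite -(eta0_eta1 gl) (T10 iV1 (eta q1 t)) raddf0.
  by exists 1; split=> [|x]; rewrite ?oner_eq0 // !T00.
have [iV2|iV2] := boolP (i \in V2); last first.
  have T00 (t : T) : eta q0 t = 0.
    by rewrite -(eta0_eta1 (gluing_sym gl)) (T20 iV2 (eta q2 t)) raddf0.
  by exists 1; split=> [|x]; rewrite ?oner_eq0 // !T00.
have [_ pS _] := cp; have [[l l0] _] := Ls i; have [p0 p0E] := pS l.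
have gen x : exists a, x = a *: p0.
  apply: (cover_superfluous cp (S := fun x => exists a, x = a *: p0)) => [|a y z|y].
  - by exists 0; rewrite scale0r.
  - by move=> [b ->] [c ->]; exists (a * b + c); rewrite scalerDl scalerA.
  have [a ya] := simple_generator (Ls i) l0 (p y); exists (a *: p0); first by exists a.
  by rewrite linearB (linearZZ p) p0E ya subrr.
pose t1 := eta q0 (val (r1 (eta q1 p0))); pose t2 := eta q0 (val (r2 (eta q2 p0))).
have r1E a : eta q0 (val (r1 (eta q1 (a *: p0)))) = q0 a *: t1.
  by rewrite etaZ linearZZ (eta0_valZ gl).
have r2E c a : eta q0 (val (c%:A *: r2 (eta q2 (a *: p0)))) = q0 a *: (c%:A *: t2).
  have -> : (c%:A : A2) = q2 c%:A by rewrite linearZ /= rmorph1.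
  rewrite etaZ (linearZZ r2) !(eta0_valZ (gluing_sym gl)).
  have -> : q0 c%:A = c%:A by rewrite linearZ /= rmorph1.
  by rewrite !scalerA scalar_comm.
(* Both side projections are onto, so t1 and t2 generate the same R0-module. *)
have t12 : exists r : R0, t1 = r *: t2.
  have [rS _ _] := st2.1 iV2; have [x xE] := rS (eta q2 (val (r1 (eta q1 p0)))).
  have [a aE] := gen (val x); exists (q0 a).
  rewrite /t1 -(eta0_eta1 (gluing_sym gl)) -xE -(eta_val x) aE.
  by rewrite etaZ linearZZ (eta0_valZ (gluing_sym gl)).
have t21 : exists r : R0, t2 = r *: t1.
  have [rS _ _] := st1.1 iV1; have [x xE] := rS (eta q1 (val (r2 (eta q2 p0)))).
  have [a aE] := gen (val x); exists (q0 a).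
  rewrite /t2 -(eta0_eta1 gl) -xE -(eta_val x) aE.
  by rewrite etaZ linearZZ (eta0_valZ gl).
have [k tk] : exists k : K, t1 = k%:A *: t2.
  by have [r ->] := t12; have [k ->] := R0K r; exists k.
(* If t1 = 0 then also t2 = 0, both composites vanish, and the scalar 1 serves. *)
have [k0|k0] := eqVneq k 0.
  exists 1; split=> [|x]; first exact: oner_neq0.
  have t10 : t1 = 0 by rewrite tk k0 scale0r scale0r.
  have t20 : t2 = 0 by have [r ->] := t21; rewrite t10 scaler0.
  by have [a ->] := gen x; rewrite r1E r2E t10 t20 !scaler0.
by exists k; split=> // x; have [a ->] := gen x; rewrite r1E r2E tk.
Qed.

(** Restriction need not preserve projectives. Here P is fixed by an element a with gRa = 0, so by
    [val_linear] maps from P to [red X] lift to X. *)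
Lemma res_cover (K : fieldType) (R S : falgType K) (q : idem_quot R S)
    (P M : lmodType S) (p : {linear P -> M}) (a : R) :
  projective_cover p -> (forall x : P, q a *: x = x) ->
  (forall b, iq_idem q * (b * a) = 0) -> projective_cover (res_map q p).
Proof.
move=> cp aP ga; have [[Pf Pp] pS _] := cp; apply: coverI.
- split=> [|X Y u h Xf Yf uS]; first exact: fin_dim_res Pf.
  have [h1 h1E] : exists h1 : {linear P -> red q Y}, forall x, h1 x = eta q (h x).
    exact: (linear_res (iq_surj q) (lmap_comp (unit_map q Y) h)).
  have [k kE] := Pp _ _ (red_map q u) h1 (fin_dim_red q Xf) (fin_dim_red q Yf) (red_surj uS).
  have [k' k'E] := val_linear (res_map q k) (aP : forall x : res q P, a *: x = x) ga.
  exists k' => x; rewrite k'E res_mapE -val_red_map kE h1E val_eta.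
  have hx : h x = a *: h x by rewrite -linearZZ; congr (h _); exact/esym/aP.
  by rewrite hx scalerA -[a]mul1r ga scale0r subr0.
- by move=> y; have [x xE] := pS y; exists x; rewrite res_mapE.
- move=> T T0 TD Tp; apply: (cover_superfluous cp) => //.
    by move=> s x y; have [b <-] := iq_surj q s; exact: TD.
  by move=> x; have [y Ty py] := Tp x; exists y => //; move: py; rewrite res_mapE.
Qed.

(** * Simple modules and projective covers of a fibre product *)

Section GluedSimples.
Variables (K : fieldType) (R R1 R2 R0 : falgType K).
Variables (q1 : idem_quot R R1) (q2 : idem_quot R R2) (q0 : idem_quot R R0).
Hypothesis gl : gluing q1 q2 q0.
Variables (I : finType) (V1 V2 : {set I}).
Variables (L : I -> lmodType R).
Variables (L1 : {x : I | x \in V1} -> lmodType R1) (L2 : {x : I | x \in V2} -> lmodType R2).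
Hypotheses (LV1 : supported_on q1 L L1) (LV2 : supported_on q2 L L2).
Hypotheses (SL1 : simple_labelling L1) (SL2 : simple_labelling L2).
Hypothesis V12 : forall x, (x \in V1) || (x \in V2).

Lemma glued_simple x : simple_module (L x).
Proof.
have [s1 _ _] := SL1; have [s2 _ _] := SL2.
case/orP: (V12 x) => xV.
  exact: simple_iso (isomorphic_sym (LV1.1 (Sub x xV))) (simple_res (iq_surj q1) (s1 _)).
exact: simple_iso (isomorphic_sym (LV2.1 (Sub x xV))) (simple_res (iq_surj q2) (s2 _)).
Qed.

Lemma supported_inj (S : falgType K) (q : idem_quot R S) (V : {set I})
    (M : {x : I | x \in V} -> lmodType S) x y :
  supported_on q L M -> (forall i j, isomorphic (M i) (M j) -> i = j) ->
  x \in V -> isomorphic (L x) (L y) -> x = y.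
Proof.
move=> LV Minj xV xy; have [yV|yV] := boolP (y \in V).
  have e : isomorphic (M (Sub x xV)) (M (Sub y yV)).
    apply: (iso_res (iq_surj q)).
    exact: isomorphic_trans (isomorphic_sym (LV.1 (Sub x xV)))
      (isomorphic_trans xy (LV.1 (Sub y yV))).
  by have /(congr1 val) := Minj _ _ e.
have [f [g [fK gK]]] := isomorphicP xy.
have [[m m0] _] := glued_simple x; case/eqP: m0; apply: (can_inj fK).
by rewrite linear0 -[f m](LV.2 _ yV) -(linearZZ f) (supported_idem0 LV xV) linear0.
Qed.

Lemma supported_complete (S : falgType K) (q : idem_quot R S) (V : {set I})
    (M : {x : I | x \in V} -> lmodType S) (X : lmodType R) :
  supported_on q L M -> (forall Y : lmodType S, simple_module Y -> exists i, isomorphic Y (M i)) ->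
  simple_module X -> (forall m : X, iq_idem q *: m = 0) -> exists i, isomorphic X (L i).
Proof.
move=> LV Mc sX gX; have XX := res_red gX.
have [i Yi] := Mc _ (res_simple (simple_iso XX sX)).
exists (val i); apply: isomorphic_trans XX (isomorphic_trans (res_iso q Yi) _).
exact: isomorphic_sym (LV.1 i).
Qed.

Lemma glued_labelling : simple_labelling L.
Proof.
have [s1 i1 c1] := SL1; have [s2 i2 c2] := SL2; split.
- exact: glued_simple.
- move=> x y xy; case/orP: (V12 x) => xV; first exact: supported_inj LV1 i1 xV xy.
  exact: supported_inj LV2 i2 xV xy.
move=> X sX.
have [g0|g1] := idem_dichotomy q1 sX; first exact: supported_complete LV1 c1 sX g0.
apply: (supported_complete LV2 c2 sX) => m.
by rewrite -(g1 m) scalerA (glue_g21 gl) scale0r.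
Qed.

Variable le : rel I.

Lemma supported_above (S : falgType K) (q : idem_quot R S) (V : {set I})
    (M : {x : I | x \in V} -> lmodType S) x (X : lmodType S) :
  supported_on q L M -> filtered (strictly_above M (relpre val le) x) X ->
  filtered (strictly_above L le (val x)) (res q X).
Proof.
move=> LV; apply: res_filtered => Y [j [xj nxj Yj]]; exists (val j); split=> //.
exact: isomorphic_trans (res_iso q Yj) (isomorphic_sym (LV.1 j)).
Qed.

(** Away from the source the cover over R is the restricted cover over S: the element a, in practice
    the idempotent of the other quotient, fixes [L x] and hence its cover. *)
Lemma stratified_side (S : falgType K) (q : idem_quot R S) (V : {set I})
    (M : {x : I | x \in V} -> lmodType S) (a : R) (x : {x : I | x \in V}) :
  supported_on q L M -> simple_stratified M (relpre val le) ->
  a * a = a -> (forall b, a * (b * a) = b * a) -> (forall b, iq_idem q * (b * a) = 0) ->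
  (forall m : L (val x), a *: m = m) ->
  exists (P X : lmodType R) (p : {linear P -> L (val x)}) (f : {linear X -> P}),
    [/\ projective_cover p, short_exact f p & filtered (strictly_above L le (val x)) X].
Proof.
move=> LV st aa aba ga aL; have [P [X [p [f [cp fp XF]]]]] := st x.
have [h [k [hK kK]]] := isomorphicP (isomorphic_sym (LV.1 x)).
have aM (m : M x) : q a *: m = m.
  by have := congr1 k (aL (h m)); rewrite -(linearZZ h) !hK.
have aP : forall y : P, q a *: y = y.
  apply: (cover_superfluous cp) => [|s y z ay az|y].
  - exact: scaler0.
  - have [b <-] := iq_surj q s; rewrite scalerDr az -{1}ay !scalerA -!rmorphM -mulrA.
    by rewrite aba rmorphM -scalerA ay.
  - exists (q a *: y); first by rewrite scalerA -rmorphM aa.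
    by rewrite linearB (linearZZ p) aM subrr.
have hB : bijective h by exists k.
exists (res q P), (res q X), (lmap_comp h (res_map q p)), (res_map q f); split.
- exact/(cover_iso hB)/res_cover.
- have [fI fp0 pS] := res_short_exact q fp; split=> // [y|y].
    rewrite /= -fp0; split=> [e|->]; last exact: linear0.
    by apply: (can_inj hK); rewrite e linear0.
  by have [z zE] := pS (k y); exists z; rewrite /= zE kK.
- exact: supported_above LV XF.
Qed.

Variable v : I.
Hypotheses (vV1 : v \in V1) (vV2 : v \in V2).
Hypothesis V12v : forall x, x \in V1 -> x \in V2 -> x = v.
Hypothesis L_source : forall m : L v, iq_idem q0 *: m = 0.
Hypothesis R0K : forall r : R0, exists k : K, r = k%:A.
Hypotheses (st1 : simple_stratified L1 (relpre val le)).
Hypotheses (st2 : simple_stratified L2 (relpre val le)).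

Let e : R := 1 - iq_idem q0.

Let e_scalar a : exists k : K, e * a = k *: e.
Proof.
have [k qa] := R0K (q0 a); exists k.
have /iq_ker : q0 (a - k%:A) = 0 by rewrite rmorphB /= qa linearZ /= rmorph1 subrr.
move=> g0; apply/eqP; rewrite -[k *: e]mulr_algr -subr_eq0 -mulrBr.
by rewrite mulrBl mul1r g0 subrr.
Qed.

Let ee : e * e = e.
Proof. by rewrite mulrBl mul1r mulrBr mulr1 iq_idemK subrr subr0. Qed.

Let e_source (m : L v) : e *: m = m.
Proof. by rewrite scalerBl scale1r L_source subr0. Qed.

(** The cover is the left ideal Re with e = 1 - g0, mapped onto [L v] by b -> bl. If bl = 0, then eb
    = ke with kl = 0, so k = 0 and g0 b = b. *)
Lemma source_cover : exists (P : lmodType R) (p : {linear P -> L v}),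
  projective_cover p /\ forall x, p x = 0 -> iq_idem q0 *: x = x.
Proof.
have [|a x y xe ye|P [i [iI iE]]] := @submodule_type R R^o (fun b => b * e = b).
- exact: mul0r.
- by rewrite mulrDl ye -[a *: x]/(a * x) -mulrA xe.
have [[l l0] _] := glued_simple v.
have pL : linear (fun b : P => (i b : R) *: l).
  by move=> a x y; rewrite linearP scalerDl -[a *: i x]/(a * i x) scalerA.
pose p := mk_linear pL.
have [f fE] := (iE e).1 ee.
have ie x : (i x : R) * e = i x by apply/iE; exists x.
have gen (b : P) : b = (i b : R) *: f.
  by apply: iI; rewrite linearZ /= fE -[RHS]/(_ * _) ie.
have eker (b : P) : p b = 0 -> e *: b = 0.
  move=> pb; apply: iI; rewrite linear0 (linearZZ i) -[LHS]/(e * i b).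
  have [k ek] := e_scalar (i b); rewrite ek.
  have kl : k%:A *: l = 0.
    by rewrite -{1}(e_source l) scalerA mulr_algl -ek -scalerA [i b *: l]pb scaler0.
  have [->|k0] := eqVneq k 0; first by rewrite scale0r.
  case/eqP: l0; rewrite -[l]scale1r -[1](scale1r (1 : R)) -(mulVf k0) -scalerA.
  by rewrite -mulr_algl -scalerA kl scaler0.
exists P, p; split; last first.
  move=> x /eker ex; apply/eqP; rewrite -subr_eq0 -[X in _ - X]scale1r -scalerBl.
  by rewrite -opprB scaleNr ex oppr0.
apply: coverI.
- split=> [|X Y u h Xf Yf uS].
    have mL : linear ((fun b => b * e) : R^o -> R^o).
      by move=> a x y; rewrite mulrDl -[a *: x]/(a * x) -mulrA.
    have [r rE] : exists r : {linear R^o -> P}, forall b, i (r b) = mk_linear mL b.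
      by apply: factor_inj iI _ => x; apply/iE; rewrite /= -mulrA ee.
    apply: (fin_dim_surj (f := r)) (fin_dim_regular R) => y.
    by exists (i y); apply: iI; rewrite rE /= ie.
  have [x0 x0E] := uS (h f).
  have hL : linear (fun b : P => (i b : R) *: x0).
    by move=> a x y; rewrite linearP scalerDl -[a *: i x]/(a * i x) scalerA.
  exists (mk_linear hL) => b; rewrite /= (linearZZ u) x0E -(linearZZ h).
  by rewrite -gen.
- move=> m; have [a ->] := simple_generator (glued_simple v) l0 m; exists (a *: f).
  by rewrite (linearZZ p) /= fE e_source.
- move=> S S0 SD Sp; have [y Sy /eker efy] := Sp f.
  have Sf : S f.
    have -> : f = e *: y + 0; last exact: SD.
    rewrite addr0; apply/eqP; rewrite -subr_eq0.
    have {1}-> : f = e *: f by rewrite {1}(gen f) fE.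
    by rewrite -scalerBr efy.
  by move=> x; rewrite (gen x) -[_ *: f]addr0; exact: SD.
Qed.

(** On X the sum g1 + g2 acts as 1, which makes X an extension of its first reduction by its second.
    Each reduction is the kernel of a cover of the simple at v over that side. *)
Lemma source_kernel_filtered (P X : lmodType R) (p : {linear P -> L v}) (f : {linear X -> P}) :
  projective_cover p -> short_exact f p -> (forall x : X, iq_idem q0 *: x = x) ->
  filtered (strictly_above L le v) X.
Proof.
move=> cp fp g0X.
have side (S : falgType K) (q : idem_quot R S) (V : {set I})
    (M : {x : I | x \in V} -> lmodType S) (vV : v \in V) :
    supported_on q L M -> simple_stratified M (relpre val le) ->
    filtered (strictly_above L le v) (res q (red q X)).
  move=> LV st; have [h hB] := supported_red LV (Sub v vV).
  have cp' := cover_iso hB (red_cover (supported_idem0 LV vV) cp).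
  have [fI fp0 pS] := red_short_exact q fp.
  apply: (supported_above (x := Sub v vV) LV).
  apply: (stratified_any_cover st cp'); split.
  - exact: fI.
  - move=> y; rewrite -fp0 /=; split=> [hy|->]; last exact: linear0.
    by apply: (bij_inj hB); rewrite hy linear0.
  - have [k hK kK] := hB => y; have [z zE] := pS (k y).
    by exists z; rewrite /= zE kK.
have X1 := side _ _ _ _ vV1 LV1 st1; have X2 := side _ _ _ _ vV2 LV2 st2.
have g12 (x : X) : iq_idem q2 *: x = x - iq_idem q1 *: x.
  have [_ _ g0E] := gl; have := g0X x; rewrite g0E scalerDl => {2}<-.
  by rewrite addrC addKr.
have g1N (y : res q2 (red q2 X)) : iq_idem q1 *: y = y.
  rewrite res_scaleE -[y in LHS](eta_val (y : red q2 X)) -etaZ.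
  rewrite -[RHS](eta_val (y : red q2 X)); congr (eta q2 _).
  by apply/esym/eqP; rewrite -subr_eq0 -g12 red_val0.
(* The embedding of the second reduction into X is linear because g1 fixes its source and g2 R g1 =
   0. *)
have [u uE] := val_linear (lmap_id (res q2 (red q2 X))) g1N (glue_g1M (gluing_sym gl)).
apply: (filtered_extension (f := u) (g := unit_map q1 X)) X2 X1; split.
- by move=> x y; rewrite !uE => /val_inj.
- move=> x; rewrite unit_mapE; apply: (iff_trans (eta_eq0 q1 x)); split=> [gx|[y <-]].
    exists (eta q2 x); rewrite uE; transitivity (x - iq_idem q2 *: x) => //.
    by rewrite g12 gx subrr subr0.
  by rewrite -(linearZZ u) g1N.
- exact: eta_surj.
Qed.

Lemma glued_stratified : simple_stratified L le.
Proof.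
move=> x; have [xv|xv] := eqVneq x v.
  rewrite xv; have [P [p [cp p0]]] := source_cover.
  have [X [f [fI fE]]] := kernel_type p.
  have [_ pS _] := cp; have fp : short_exact f p by split.
  exists P, X, p, f; split=> //; apply: (source_kernel_filtered cp fp) => y.
  by apply: fI; rewrite (linearZZ f) p0 //; apply/fE; exists y.
case/orP: (V12 x) => xV.
  have xV2 : x \notin V2 by apply: contra_neqN xv; exact: V12v.
  apply: (stratified_side (a := iq_idem q2) (x := Sub x xV) LV1 st1).
  - exact: iq_idemK.
  - exact: iq_idemM.
  - exact: glue_g1M gl.
  - exact: LV2.2 xV2.
have xV1 : x \notin V1 by apply: contra_neqN xv => xV1; exact: V12v.
apply: (stratified_side (a := iq_idem q1) (x := Sub x xV) LV2 st2).
- exact: iq_idemK.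
- exact: iq_idemM.
- exact: glue_g1M (gluing_sym gl).
- exact: LV1.2 xV1.
Qed.
End GluedSimples.

(** * The simple module at the source *)

Lemma base_scalar (K : fieldType) (r : base_alg K) : exists k : K, r = k%:A.
Proof. by exists r; rewrite -[LHS](mulr1 (r : K)). Qed.

Lemma simple_base (K : fieldType) (M : lmodType (base_alg K)) :
  simple_module M -> isomorphic ((base_alg K)^o : lmodType (base_alg K)) M.
Proof.
move=> sM; have [[l l0] _] := sM.
have fL : linear ((fun k => k *: l) : (base_alg K)^o -> M).
  by move=> a x y; rewrite scalerDl -[a *: x]/(a * x) scalerA.
apply: (isomorphic_bij (f := mk_linear fL)) => [x y /= xy|m]; last first.
  by have [a ->] := simple_generator sM l0 m; exists a.
apply/eqP; rewrite -subr_eq0; apply: contraNT l0 => d0.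
rewrite -[l]scale1r -(mulVf (d0 : (x - y : K) != 0)).
have -> : ((x - y : K)^-1 * (x - y : K)) *: l = ((x - y : K)^-1 : base_alg K) *: ((x - y) *: l).
  by rewrite scalerA.
by rewrite scalerBl xy subrr scaler0.
Qed.

(** A module killed by the idempotent is a K-space, and K has only one simple module. *)
Lemma simple_source_iso (K : fieldType) (R : falgType K) (q : idem_quot R (base_alg K))
    (M : lmodType R) :
  simple_module M -> (forall m : M, iq_idem q *: m = 0) ->
  isomorphic M (res q ((base_alg K)^o : lmodType (base_alg K))).
Proof.
move=> sM gM; have MM := res_red gM.
apply: isomorphic_trans (MM) (res_iso q (isomorphic_sym (simple_base _))).
exact/(res_simple (rho := q))/(simple_iso MM).
Qed.

(* The standard module at the source surjects onto the simple module there, on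
   which B acts through the character of the source. *)
Lemma borel_source_simple (K : fieldType) (A A1 R0 : falgType K) (B : {aspace A})
    (B1 : {aspace A1}) (q : idem_quot A A1) (q0 : idem_quot A R0)
    (s : idem_quot (subvs_of B) (subvs_of B1)) (s0 : idem_quot (subvs_of B) R0)
    (I : finType) (L1 : I -> lmodType A1) (le : rel I) (i : I)
    (N : lmodType (subvs_of B1)) :
  (forall b, vsval (s b) = q (vsval b)) -> (forall b, s0 b = q0 (vsval b)) ->
  reflexive le -> simple_module (L1 i) ->
  (forall m : res q (L1 i), iq_idem q0 *: m = 0) ->
  simple_module N ->
  (exists2 D, standard_module L1 le i D & isomorphic (induced N) D) ->
  forall m : res s N, iq_idem s0 *: m = 0.
Proof.
move=> sE s0E le_refl sL L0 sN [D [P [p [r [cp [rS DF rU]]]]] ND].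
(* Otherwise the idempotent fixes N. It then fixes the tensors of 1 with N, which generate the
   induced module, but kills the quotient [L1 i]; so the surjection onto [L1 i] would be zero. *)
have [//|g1] := idem_dichotomy s0 (simple_res (iq_surj s) sN).
have [h hE] : exists h : {linear D -> L1 i}, forall x, h (r x) = p x.
  apply: factor_surj rS _; apply: rU; first by have [] := cp.
  by apply: filtered1; exists i => //; exact: isomorphic_refl.
have [f [k [fK kK]]] := isomorphicP ND.
have [[l l0] _] := sL; have [_ pS _] := cp; have [x xE] := pS l.
case/eqP: l0; rewrite -xE -hE -[r x]kK.
have killed (y : L1 i) : vsval (s (iq_idem s0)) *: y = 0.
  rewrite sE -[LHS]/(vsval (iq_idem s0) *: (y : res q (L1 i))).
  have /iq_ker <- : q0 (vsval (iq_idem s0)) = 0 by rewrite -s0E iq_map_idem.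
  by rewrite -scalerA L0.
move: (k (r x)) => t; move: t.
apply: (@induced_ext _ _ _ _ _ (lmap_comp h f) (lmap_zero _ _)) => a n.
have [_ _ pM] := pure_balanced N.
have -> : pure a n = a *: (vsval (s (iq_idem s0)) *: (pure 1 n : induced N)).
  by rewrite !induced_scale mulr1 pM; congr pure; exact/esym/g1.
by rewrite /= !(linearZZ f) !(linearZZ h) killed scaler0.
Qed.

(* The reduction of induced N at the source is spanned by one element, so such a
   map is a scalar multiple of the projection. *)
Lemma source_endo (K : fieldType) (A : falgType K) (B : {aspace A})
    (q0 : idem_quot A (base_alg K)) (N : lmodType (subvs_of B)) :
  simple_module N ->
  forall e : {linear induced N -> res q0 (red q0 (induced N))},
  exists h : {linear induced N -> induced N}, forall x, eta q0 (h x) = e x.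
Proof.
move=> sN e; have [[n0 n00] _] := sN.
pose tau : red q0 (induced N) := eta q0 (pure 1 n0).
have gen (x : induced N) : exists r : base_alg K, eta q0 x = r *: tau.
  move: x; apply: induced_ind.
  - by exists 0; rewrite raddf0 scale0r.
  - move=> a x y [r xr] [t yt]; exists (q0 a * r + t).
    by rewrite raddfD /= etaZ xr yt scalerA scalerDl.
  - move=> a n; have [b ->] := simple_generator sN n00 n; exists (q0 (a * vsval b)).
    have [_ _ pM] := pure_balanced N.
    by rewrite -pM /tau -etaZ induced_scale mulr1.
have [e' e'E] := red_transpose e.
have [r tr] := gen (val (e' tau)); have [k rk] := base_scalar r.
have hL : linear (fun x : induced N => k%:A *: x).
  by move=> a x y; rewrite scalerDr !scalerA scalar_comm.
exists (mk_linear hL) => x; rewrite -e'E.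
have [c xc] := gen x; rewrite etaZ xc (linearZZ e').
have -> : e' tau = r *: tau by rewrite -tr eta_val.
rewrite rk; have -> : q0 k%:A = k%:A by rewrite linearZ /= rmorph1.
by rewrite !scalerA scalar_comm.
Qed.

Lemma fin_dim_standard (K : fieldType) (A : falgType K) (I : finType)
    (L : I -> lmodType A) (le : rel I) i D : standard_module L le i D -> fin_dim D.
Proof. by move=> [P [p [q [[[Pf _] _ _] [qS _ _]]]]]; exact: fin_dim_surj qS Pf. Qed.

(** * The glued regular exact Borel subalgebra *)

Section GluedBorel.
Variables (K : fieldType) (A A1 A2 : falgType K).
Variables (q1 : idem_quot A A1) (q2 : idem_quot A A2) (q0 : idem_quot A (base_alg K)).
Hypothesis gl : gluing q1 q2 q0.
Variables (p1 : idem_quot A1 (base_alg K)) (p2 : idem_quot A2 (base_alg K)).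
Hypotheses (p1E : forall a, p1 (q1 a) = q0 a) (p2E : forall a, p2 (q2 a) = q0 a).
Variables (I : finType) (V1 V2 : {set I}) (v : I) (le : rel I).
Hypotheses (le_refl : reflexive le) (le_anti : antisymmetric le).
Hypothesis V12 : forall x, (x \in V1) || (x \in V2).
Hypothesis V12v : forall x, x \in V1 -> x \in V2 -> x = v.
Hypotheses (vV1 : v \in V1) (vV2 : v \in V2).
Variable L : I -> lmodType A.
Variables (L1 : {x : I | x \in V1} -> lmodType A1) (L2 : {x : I | x \in V2} -> lmodType A2).
Hypotheses (LV1 : supported_on q1 L L1) (LV2 : supported_on q2 L L2).
Hypothesis L_simple : forall x, simple_module (L x).
Hypothesis L_source : forall m : L v, iq_idem q0 *: m = 0.
Hypothesis L_cover : forall i, exists (P : lmodType A) (p : {linear P -> L i}),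
  projective_cover p.

Section Fibre.
Variables (B : {aspace A}) (B1 : {aspace A1}) (B2 : {aspace A2}).
Variables (s1 : idem_quot (subvs_of B) (subvs_of B1)).
Variables (s2 : idem_quot (subvs_of B) (subvs_of B2)).
Variable s0 : idem_quot (subvs_of B) (base_alg K).
Hypothesis glB : gluing s1 s2 s0.
Hypotheses (s1E : forall b, vsval (s1 b) = q1 (vsval b)).
Hypotheses (s2E : forall b, vsval (s2 b) = q2 (vsval b)).
Hypotheses (s0E : forall b, s0 b = q0 (vsval b)).
Variables (LB1 : {x : I | x \in V1} -> lmodType (subvs_of B1)).
Variables (LB2 : {x : I | x \in V2} -> lmodType (subvs_of B2)).
Hypotheses (ex1 : exact_borel_with L1 (relpre val le) LB1).
Hypotheses (ex2 : exact_borel_with L2 (relpre val le) LB2).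
Hypotheses (ext1 : forall i j, ext_induction_iso (LB1 i) (LB1 j)).
Hypotheses (ext2 : forall i j, ext_induction_iso (LB2 i) (LB2 j)).

Lemma fibre_regular (LB : I -> lmodType (subvs_of B)) :
  supported_on s1 LB LB1 -> supported_on s2 LB LB2 ->
  (forall m : LB v, iq_idem s0 *: m = 0) ->
  exact_borel_with L le LB /\ forall i j, ext_induction_iso (LB i) (LB j).
Proof.
move=> LBV1 LBV2 LB_source.
have [sl1 [qh1 ss1] ie1 std1] := ex1; have [sl2 [qh2 ss2] ie2 std2] := ex2.
have le1_refl : reflexive (relpre (val : {x | x \in V1} -> I) le) by move=> x; exact: le_refl.
have le2_refl : reflexive (relpre (val : {x | x \in V2} -> I) le) by move=> x; exact: le_refl.
have [s_1 _ _] := sl1; have [s_2 _ _] := sl2.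
have st1 := simple_stratifiedP le1_refl s_1 qh1 ss1.
have st2 := simple_stratifiedP le2_refl s_2 qh2 ss2.
have slB := glued_labelling glB LBV1 LBV2 sl1 sl2 V12.
have [simpB injB _] := slB.
have stB := glued_stratified glB LBV1 LBV2 sl1 sl2 V12 vV1 vV2 V12v LB_source
  (@base_scalar K) st1 st2.
have T1 i (iV : i \in V1) : standard_module L1 (relpre val le) (Sub i iV) (red q1 (induced (LB i))).
  exact: (red_induced_standard s1E LBV1 (std1 (Sub i iV))).
have T2 i (iV : i \in V2) : standard_module L2 (relpre val le) (Sub i iV) (red q2 (induced (LB i))).
  exact: (red_induced_standard s2E LBV2 (std2 (Sub i iV))).
have T10 i (iV : i \notin V1) := red_induced0 s1E LBV1 iV.
have T20 i (iV : i \notin V2) := red_induced0 s2E LBV2 iV.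
have Tst i : standard_module L le i (induced (LB i)).
  have [P [p cp]] := L_cover i.
  exact: (glued_standard gl (@base_scalar K) LV1 LV2 L_simple cp (T1 i) (T10 i) (T2 i) (T20 i)).
split.
  split=> //.
  - exact: (stratified_qh le_refl simpB le_anti injB stB).
  - move=> X Y Z f h Xf Yf Zf fh; apply: (glue_short_exact gl).
      exact: red_induction_exact s1E ie1 _ _ _ _ _ Xf Yf Zf fh.
    exact: red_induction_exact s2E ie2 _ _ _ _ _ Xf Yf Zf fh.
  - by move=> i; exists (induced (LB i)) => //; exact: isomorphic_refl.
have id12 (M : lmodType A) : (forall t : red q2 M, t = 0) -> forall x : M, iq_idem q1 *: x = 0.
  move=> M0 x; have /eta_eq0 <- : eta q2 x = 0 by exact: M0.
  by rewrite scalerA (glue_g12 gl) scale0r.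
have id21 (M : lmodType A) : (forall t : red q1 M, t = 0) -> forall x : M, iq_idem q2 *: x = 0.
  move=> M0 x; have /eta_eq0 <- : eta q1 x = 0 by exact: M0.
  by rewrite scalerA (glue_g21 gl) scale0r.
(* For j other than v, Ext into j is seen entirely on the side containing j; only j = v involves
   both sides. *)
move=> i j; have [jV1|jV1] := boolP (j \in V1); last first.
  have jV2 : j \in V2 by have := V12 j; rewrite (negbTE jV1).
  apply: (ext_one_side s2E (ext_red LBV2 ext2 jV2) (supported_idem0 LBV2 jV2)).
  exact/id21/T10.
have [jV2|jV2] := boolP (j \in V2); last first.
  apply: (ext_one_side s1E (ext_red LBV1 ext1 jV1) (supported_idem0 LBV1 jV1)).
  exact/id12/T20.
rewrite (V12v jV1 jV2).
apply: (ext_source (@base_alg_extend K) gl s1E s2E (ext_red LBV1 ext1 vV1)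
  (ext_red LBV2 ext2 vV2) (supported_idem0 LBV1 vV1) LB_source
  (fin_dim_standard (Tst v))).
have [->|iv] := eqVneq i v; first exact: source_endo.
(* A label other than v misses one side. There the reduction is zero, hence also the one at [q0],
   and the map to be lifted is zero. *)
have q00 (x : induced (LB i)) : eta q0 x = 0.
  have [iV1|iV1] := boolP (i \in V1); last first.
    by rewrite -(eta0_eta1 gl) (T10 i iV1 (eta q1 x)) raddf0.
  have [iV2|iV2] := boolP (i \in V2); first by rewrite (V12v iV1 iV2) eqxx in iv.
  by rewrite -(eta0_eta1 (gluing_sym gl)) (T20 i iV2 (eta q2 x)) raddf0.
move=> e; have [e' e'E] := red_transpose e.
by exists (lmap_zero _ _) => x; rewrite -e'E q00 linear0; exact: raddf0.
Qed.
End Fibre.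

(** If the other idempotent killed this simple, so would that of [s0]. The simple would then be the
    one at the source, against the distinctness of labels. *)
Lemma fibre_side (A' : falgType K) (B : {aspace A}) (B' : {aspace A'}) (R2 : falgType K)
    (s : idem_quot (subvs_of B) (subvs_of B')) (s2 : idem_quot (subvs_of B) R2)
    (s0 : idem_quot (subvs_of B) (base_alg K)) (V : {set I}) (vV : v \in V)
    (LB' : {x : I | x \in V} -> lmodType (subvs_of B')) :
  gluing s s2 s0 -> simple_labelling LB' ->
  (forall m : res s (LB' (Sub v vV)), iq_idem s0 *: m = 0) ->
  forall x : {x : I | x \in V}, val x != v ->
  forall m : res s (LB' x), iq_idem s2 *: m = m.
Proof.
move=> glB [sl il _] LBv x xv m.
have sx := simple_res (iq_surj s) (sl x).
have [g0|//] := idem_dichotomy s2 sx.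
have s0x (n : res s (LB' x)) : iq_idem s0 *: n = 0.
  by have [_ _ ->] := glB; rewrite scalerDl g0 res_idem0 addr0.
case/eqP: xv; suff -> : x = Sub v vV by [].
apply: il; apply: (iso_res (iq_surj s)).
apply: isomorphic_trans (simple_source_iso sx s0x) _.
exact/isomorphic_sym/simple_source_iso/LBv/simple_res/sl/iq_surj.
Qed.

Lemma glued_borel (B1 : {aspace A1}) (B2 : {aspace A2}) :
  regular_exact_borel L1 (relpre val le) B1 -> regular_exact_borel L2 (relpre val le) B2 ->
  exists B : {aspace A}, regular_exact_borel L le B.
Proof.
move=> [oneB1 [LB1 [ex1 ext1]]] [oneB2 [LB2 [ex2 ext2]]].
have [sl1 _ ie1 std1] := ex1; have [sl2 _ ie2 std2] := ex2.
have [r1 r1E] := borel_source p1 oneB1 ie1.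
have [r2 r2E] := borel_source p2 oneB2 ie2.
have [B [oneB [s1 [s2 [s0 [glB s1E s2E s0E]]]]]] :=
  fibre_product gl p1E p2E oneB1 oneB2 r1E r2E.
have L1v m : iq_idem q0 *: (m : res q1 (L1 (Sub v vV1))) = 0.
  have [f [k [fK kK]]] := isomorphicP (LV1.1 (Sub v vV1)).
  by apply: (can_inj kK); rewrite (linearZZ k) L_source linear0.
have L2v m : iq_idem q0 *: (m : res q2 (L2 (Sub v vV2))) = 0.
  have [f [k [fK kK]]] := isomorphicP (LV2.1 (Sub v vV2)).
  by apply: (can_inj kK); rewrite (linearZZ k) L_source linear0.
have sL1 x : simple_module (L1 x).
  exact/(res_simple (rho := q1))/(simple_iso (LV1.1 x))/L_simple.
have sL2 x : simple_module (L2 x).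
  exact/(res_simple (rho := q2))/(simple_iso (LV2.1 x))/L_simple.
have [s_1 _ _] := sl1; have [s_2 _ _] := sl2.
have N1 := borel_source_simple s1E s0E (fun x => le_refl (val x)) (sL1 _) L1v (s_1 _) (std1 _).
have N2 := borel_source_simple s2E s0E (fun x => le_refl (val x)) (sL2 _) L2v (s_2 _) (std2 _).
have id2 := fibre_side glB sl1 N1.
have id1 := fibre_side (gluing_sym glB) sl2 N2.
(* At v the first branch is taken; the second candidate is isomorphic to it, both being the source
   simple. The zero module is never reached, since V1 and V2 cover all vertices. *)
pose LB x : lmodType (subvs_of B) :=
  if insub x is Some i then res s1 (LB1 i)
  else if insub x is Some i then res s2 (LB2 i) else 'rV[subvs_of B]_0.
have LBE1 (x : {x : I | x \in V1}) : LB (val x) = res s1 (LB1 x).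
  by rewrite /LB valK.
have LBE2 (x : {x : I | x \in V2}) : val x != v -> LB (val x) = res s2 (LB2 x).
  move=> xv; rewrite /LB insubN ?valK //.
  by apply: contra_neqN xv => xV1; apply: V12v => //; exact: valP.
have LBV1 : supported_on s1 LB LB1.
  split=> [x|x xV1]; first by rewrite LBE1; exact: isomorphic_refl.
  have xV2 : x \in V2 by have := V12 x; rewrite (negbTE xV1).
  have xv : x != v by apply: contraNneq xV1 => ->.
  rewrite (LBE2 (Sub x xV2) xv); exact: id1.
have LBV2 : supported_on s2 LB LB2.
  split=> [x|x xV2].
    have [xv|xv] := eqVneq (val x) v; last by rewrite LBE2 //; exact: isomorphic_refl.
    have -> : x = Sub v vV2 by apply: val_inj.
    rewrite (LBE1 (Sub v vV1)).
    apply: isomorphic_trans (simple_source_iso (simple_res (iq_surj s1) (s_1 _)) N1) _.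
    exact/isomorphic_sym/(simple_source_iso (simple_res (iq_surj s2) (s_2 _)) N2).
  have xV1 : x \in V1 by have := V12 x; rewrite (negbTE xV2) orbF.
  have xv : x != v by apply: contraNneq xV2 => ->.
  rewrite (LBE1 (Sub x xV1)); exact: (id2 (Sub x xV1) xv).
exists B; split=> //; exists LB.
apply: (fibre_regular glB s1E s2E ex1 ex2 ext1 ext2 LBV1 LBV2).
by rewrite (LBE1 (Sub v vV1)).
Qed.
End GluedBorel.

(** * Quivers *)

Section QuiverAlgebra.
Variables (K : fieldType) (Q : quiver) (A : falgType K).
Variable pi : {lrmorphism path_algebra K Q -> A}.
Hypothesis pi_surj : surj pi.
Local Notation pe p := (pi (path_elt K p)).
Local Notation e x := (pi (vertex_idem K x)).

Lemma quiver_ind (S : A -> Prop) : S 0 ->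
  (forall k x y, S x -> S y -> S (k *: x + y)) -> (forall p, S (pe p)) -> forall a, S a.
Proof.
move=> S0 SD Sp a; have [g <-] := pi_surj a.
rewrite (path_algebraE g) raddf_sum /=; apply: (big_ind S) => // [x y Sx Sy|p _].
  by rewrite -[x]scale1r; exact: SD.
have SZ k : S (k *: pe p) by rewrite -[_ *: _]addr0; exact: SD.
by rewrite linearZ; exact: SZ.
Qed.

Lemma idem_path x p : e x * pe p = if qend p == x then pe p else 0.
Proof.
rewrite -rmorphM /= [vertex_idem K x * _](_ : _ = if qend p == x then path_elt K p else 0).
  by case: ifP => //; rewrite rmorph0.
by rewrite -path_mul_trivial_l; exact: pa_mulUU.
Qed.

Lemma path_idem x p : pe p * e x = if x == qstart p then pe p else 0.
Proof.
rewrite -rmorphM /= [path_elt K p * _](_ : _ = if x == qstart p then path_elt K p else 0).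
  by case: ifP => //; rewrite rmorph0.
by rewrite -path_mul_trivial_r; exact: pa_mulUU.
Qed.

Lemma idem_idem x y : e x * e y = if y == x then e y else 0.
Proof. exact: idem_path. Qed.

Lemma sum_idem : \sum_x e x = 1.
Proof. by rewrite -raddf_sum; exact: rmorph1. Qed.

Definition idem_sum (W : {set vertex Q}) : A := \sum_(x in W) e x.

Lemma idem_sum_path W p : idem_sum W * pe p = if qend p \in W then pe p else 0.
Proof.
rewrite /idem_sum mulr_suml; case: ifP => pW.
  rewrite (bigD1 (qend p)) //= idem_path eqxx big1 ?addr0 // => x /andP[_ /negbTE xp].
  by rewrite idem_path eq_sym xp.
by apply: big1 => x xW; rewrite idem_path; case: eqP => // px; rewrite px xW in pW.
Qed.

Lemma path_idem_sum W p : pe p * idem_sum W = if qstart p \in W then pe p else 0.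
Proof.
rewrite /idem_sum mulr_sumr; case: ifP => pW.
  rewrite (bigD1 (qstart p)) //= path_idem eqxx big1 ?addr0 // => x /andP[_ /negbTE xp].
  by rewrite path_idem xp.
by apply: big1 => x xW; rewrite path_idem; case: eqP => // px; rewrite -px xW in pW.
Qed.

Lemma idem_sumM W W' : idem_sum W * idem_sum W' = idem_sum (W :&: W').
Proof.
rewrite {2}/idem_sum mulr_sumr /idem_sum.
under eq_bigr => x _ do rewrite [_ * _](idem_sum_path W (trivial_path x)).
by rewrite -big_mkcondr; apply: eq_bigl => x; rewrite inE andbC.
Qed.

Lemma idem_sum1 x : idem_sum [set x] = e x.
Proof. by rewrite /idem_sum big_set1. Qed.

Lemma idem_sum0 : idem_sum set0 = 0.
Proof. by rewrite /idem_sum big_set0. Qed.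

Lemma idem_sumC W : idem_sum W + idem_sum (~: W) = 1.
Proof.
rewrite -sum_idem (bigID (mem W)) /=; congr (_ + _).
by apply: eq_bigl => x; rewrite inE.
Qed.

Lemma idem_sumD1 (W : {set vertex Q}) x : x \in W -> idem_sum W = e x + idem_sum (W :\ x).
Proof. by move=> xW; rewrite /idem_sum (big_setD1 x). Qed.

(* Closure under successors makes the right ideal generated by the idempotents of W
   two-sided. *)
Lemma vertex_quotient (A1 : falgType K) (rho : {lrmorphism A -> A1}) (W : {set vertex Q}) :
  (forall a : arrow Q, source a \in W -> target a \in W) ->
  quotient_by rho (ideal_generated (fun a => exists2 u, u \in W & a = e u)) ->
  exists q : idem_quot A A1, iq_idem q = idem_sum W /\ forall a, q a = rho a.
Proof.
move=> Wsucc [rhoS rhoK].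
have WW : idem_sum W * idem_sum W = idem_sum W by rewrite idem_sumM setIid.
have path_succ s x : is_path x s -> x \in W -> path_end x s \in W.
  elim: s x => //= a s IH x /andP[/eqP <- sp] xW; apply: IH sp _.
  exact: Wsucc.
have aW a : idem_sum W * (a * idem_sum W) = a * idem_sum W.
  move: a; apply: quiver_ind => [|k x y xW yW|p].
  - by rewrite mul0r mulr0.
  - by rewrite mulrDl mulrDr -scalerAl -scalerAr xW yW.
  - rewrite path_idem_sum; case: ifP => [pW|]; last by rewrite mulr0.
    by rewrite idem_sum_path path_succ //; exact: (valP p).
(* By [aW] the elements fixed on the left by [idem_sum W] form a two-sided ideal containing the
   generators. Conversely a = [idem_sum W * a] is a sum of multiples of generators. *)
have ker a : rho a = 0 <-> idem_sum W * a = a.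
  rewrite rhoK; split=> [/(_ (fun a => idem_sum W * a = a))|aE J [J0 JD JM] Je].
    apply; last first.
      by move=> _ [u uW ->]; rewrite -(idem_sum1 u) idem_sumM (setIidPr _) // sub1set.
    split=> [|x y xE yE|x y z yE]; first exact: mulr0.
      by rewrite mulrDr xE yE.
    by rewrite -[in LHS]yE !mulrA -[_ * x * _]mulrA aW -[_ * _ * y]mulrA yE.
  rewrite -aE /idem_sum mulr_suml; apply: (big_ind J) => // u uW.
  rewrite -[e u]mul1r; apply: JM; apply: Je; by exists u.
by exists (IdemQuot rhoS WW ker).
Qed.

(** Paths compose like functions, so left multiplication by e_v keeps the paths ending at v; at a
    source only the trivial one does. *)
Lemma source_scalar v : is_source v -> forall a, exists k : K, e v * a = k *: e v.
Proof.
move=> vs; apply: quiver_ind => [|k x y [c xc] [d yd]|p].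
- by exists 0; rewrite mulr0 scale0r.
- by exists (k * c + d); rewrite mulrDr -scalerAr xc yd scalerA scalerDl.
rewrite idem_path; case: eqP => [pv|_]; last by exists 0; rewrite scale0r.
exists 1; rewrite scale1r; congr (pi (path_elt K _)); apply: val_inj.
move: pv; rewrite /qend /qstart /qarrows; case: (val p) => x s /=.
case/lastP: s => [/= -> //|s a]; rewrite -cats1 path_end_cat /= => av.
by have := vs a; rewrite av eqxx.
Qed.
End QuiverAlgebra.

(** * Simple modules at the vertices *)

Section VertexSimples.
Variables (K : fieldType) (Q : quiver) (A : falgType K).
Variable pi : {lrmorphism path_algebra K Q -> A}.
Hypothesis pi_surj : surj pi.
Local Notation e x := (pi (vertex_idem K x)).

Lemma path_elt_cons (a : arrow Q) (p p' : qpath Q) : val p = (source a, a :: qarrows p') ->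
  qstart p' = target a -> path_elt K p = path_elt K p' * arrow_elt K a.
Proof.
move=> pE p'a; apply/esym; apply: etrans (pa_mulUU K p' (arrow_path a)) _.
apply: path_mul_comp; apply/eqP/qcompP; split; first exact/esym.
by rewrite pE.
Qed.

(** M and N are treated at once so that both share the scalar k, which is what makes the map between
    generators linear in [vertex_simple_iso]. *)
Lemma vertex_simple_scalar x (M N : lmodType A) : vertex_simple pi x M ->
  vertex_simple pi x N ->
  forall a, exists k : K, (forall m : M, a *: m = k%:A *: m) /\
    (forall n : N, a *: n = k%:A *: n).
Proof.
have path0 (X : lmodType A) : vertex_simple pi x X ->
    forall p, qarrows p != [::] -> forall m : X, pi (path_elt K p) *: m = 0.
  move=> [_ _ Xa] p; case pE: (val p) => [y [|a s]]; rewrite /qarrows pE //= => _ m.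
  have := valP p; rewrite pE /= => /andP[/eqP ay sp].
  pose p' : qpath Q := exist (fun u => is_path u.1 u.2) (target a, s) sp.
  have -> : path_elt K p = path_elt K p' * arrow_elt K a.
    by apply: path_elt_cons => //; rewrite pE ay.
  by rewrite rmorphM /= -scalerA Xa scaler0.
have path1 (X : lmodType A) : vertex_simple pi x X ->
    forall y (m : X), e y *: m = if y == x then m else 0.
  move=> [_ Xe _] y m; case: eqP => [->|/eqP yx]; first exact: Xe.
  by rewrite -(Xe m) scalerA idem_idem eq_sym (negbTE yx) scale0r.
move=> Mx Nx; apply: (quiver_ind pi_surj) => [|k a b [c [ca ca']] [d [db db']]|p].
- by exists 0; split=> m; rewrite !scale0r.
- have scaleD (X : lmodType A) (m : X) : a *: m = c%:A *: m -> b *: m = d%:A *: m ->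
      (k *: a + b) *: m = (k * c + d)%:A *: m.
    move=> am bm; rewrite !scalerDl bm; congr (_ + _).
    by rewrite -scalerA -[k *: a]mulr_algl -[k *: c%:A]mulr_algl -!scalerA am.
  by exists (k * c + d); split=> m; exact: scaleD.
have [p0|p0] := eqVneq (qarrows p) [::]; last first.
  by exists 0; split=> m; rewrite !scale0r path0.
have -> : path_elt K p = vertex_idem K (qstart p).
  congr path_elt; apply: val_inj => /=; rewrite -p0; exact: surjective_pairing.
exists (if qstart p == x then 1 else 0); split=> m; rewrite path1 //; case: ifP => _.
- by rewrite !scale1r.
- by rewrite !scale0r.
- by rewrite !scale1r.
- by rewrite !scale0r.
Qed.

Lemma vertex_simple_iso x (M N : lmodType A) : vertex_simple pi x M ->
  vertex_simple pi x N -> isomorphic M N.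
Proof.
move=> Mx Nx; have scal := vertex_simple_scalar Mx Nx.
have [[l l0 lM] _ _] := Mx; have [[l' l'0 lN] _ _] := Nx.
have scal_inj (X : lmodType A) (y : X) (c d : K) : y != 0 ->
    c%:A *: y = d%:A *: y -> c = d.
  move=> y0 cd; apply/eqP; rewrite -subr_eq0; apply: contraNT y0 => ncd.
  have : (c - d)%:A *: y = 0 by rewrite !scalerBl cd subrr.
  move/(congr1 ( *:%R ((c - d)^-1)%:A)); rewrite scaler0 scalerA.
  by rewrite mulr_algl scalerA mulVf // !scale1r => ->.
have /choice[f fE] := lM; pose h m := (f m)%:A *: l'.
have hE c : h (c%:A *: l) = c%:A *: l'.
  by congr (_%:A *: _); apply: (scal_inj _ _ _ _ l0); rewrite -fE.
have hL : linear h.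
  move=> a m m'; have [k [ak ak']] := scal a.
  rewrite ak ak' [in LHS](fE m) [in LHS](fE m') scalerA -scalerDl mulr_algl scalerA.
  by rewrite -scalerDl hE scalerDl /h scalerDl scalerA mulr_algl scalerA.
apply: (isomorphic_bij (f := mk_linear hL)) => [m m' /= /(scal_inj _ _ _ _ l'0) mm'|n].
  by rewrite (fE m) (fE m') mm'.
by have [c ->] := lN n; exists (c%:A *: l); exact: hE.
Qed.

Lemma vertex_simple_simple x (M : lmodType A) : vertex_simple pi x M -> simple_module M.
Proof.
move=> [[l l0 lM] _ _]; apply: simple_modI => [|S S0 SD]; first by exists l.
have [[m [Sm m0]]|nS] := pselect (exists m, S m /\ m != 0); last first.
  by left=> m Sm; apply/eqP/negPn/negP => m0; apply: nS; exists m.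
right=> n; have [c mc] := lM m; have [d ->] := lM n.
have c0 : c != 0 by apply: contraNneq m0 => c0; rewrite mc c0 !scale0r.
have -> : d%:A *: l = (d / c)%:A *: m + 0.
  by rewrite addr0 mc scalerA mulr_algl scalerA mulfVK.
exact: SD.
Qed.

Lemma vertex_simple_idem_sum x (M : lmodType A) (W : {set vertex Q}) :
  vertex_simple pi x M -> x \in W -> forall m : M, idem_sum pi W *: m = m.
Proof.
move=> [_ Me _] xW m; rewrite -(Me m) scalerA -(idem_sum1 pi x) idem_sumM.
by rewrite (setIidPr _) // sub1set.
Qed.

Lemma vertex_simple_res (A1 : falgType K) (q : idem_quot A A1) x (M : lmodType A1) :
  vertex_simple (q \o pi) x M -> vertex_simple pi x (res q M).
Proof.
move=> [[l l0 lM] Me Ma]; split=> [|m|a m]; last 1 first.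
- exact: Ma.
- exists l => // m; have [c ->] := lM m; exists c.
  by rewrite res_scaleE linearZ /= rmorph1.
- exact: Me.
Qed.

Lemma vertex_supported (A1 : falgType K) (q : idem_quot A A1) (V : {set vertex Q})
    (L : vertex Q -> lmodType A) (L1 : {x : vertex Q | x \in V} -> lmodType A1) :
  iq_idem q = idem_sum pi (~: V) -> (forall x, vertex_simple pi x (L x)) ->
  (forall x, vertex_simple (q \o pi) (val x) (L1 x)) -> supported_on q L L1.
Proof.
move=> qV Lx L1x; split=> [x|x xV m].
  exact: vertex_simple_iso (Lx _) (vertex_simple_res (L1x x)).
by rewrite qV; apply: vertex_simple_idem_sum (Lx x) _ _; rewrite inE.
Qed.
End VertexSimples.

(** The line spanned by q(e) in A1 satisfies the same source condition as e, and the two characters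
    agree since both are read off from the nonzero vector q(e). *)
Lemma character_descent (K : fieldType) (A A1 : falgType K) (q : idem_quot A A1)
    (q0 : idem_quot A (base_alg K)) (e : A) :
  q e != 0 -> e * e = e -> (forall a, e * a = (q0 a : K) *: e) ->
  exists p : idem_quot A1 (base_alg K), forall a, p (q a) = q0 a.
Proof.
move=> qe ee eA.
have [||p [_ pE]] := source_quotient qe.
- by rewrite -rmorphM ee.
- move=> a1; have [a <-] := iq_surj q a1; exists (q0 a).
  by rewrite -rmorphM /= eA linearZ.
exists p => a; apply/eqP; rewrite -subr_eq0; apply: contraNT qe => d0.
have : (p (q a) - q0 a : K) *: q e = 0.
  by rewrite scalerBl -pE -rmorphM /= eA linearZ subrr.
move/(congr1 ( *:%R ((p (q a) - q0 a : K)^-1))); rewrite scaler0 scalerA mulVf //.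
by rewrite scale1r => ->.
Qed.

Theorem proposition54
  (K : closedFieldType) (Q : quiver)
  (J : path_algebra K Q -> Prop)
  (A : falgType K) (pi : {lrmorphism path_algebra K Q -> A})
  (le : rel (vertex Q)) (L : vertex Q -> lmodType A)
  (V1 V2 : {set vertex Q}) (v : vertex Q)
  (A1 : falgType K) (rho1 : {lrmorphism A -> A1})
  (L1 : {x : vertex Q | x \in V1} -> lmodType A1)
  (A2 : falgType K) (rho2 : {lrmorphism A -> A2})
  (L2 : {x : vertex Q | x \in V2} -> lmodType A2)
  (B1 : {aspace A1}) (B2 : {aspace A2}) :
  quiver_connected Q ->
  admissible J ->
  quotient_by pi J ->
  (forall x, vertex_simple pi x (L x)) ->
  reflexive le -> antisymmetric le -> transitive le ->
  quasi_hereditary L le ->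
  deconcatenation V1 V2 v ->
  is_source v ->
  quotient_by rho1
    (ideal_generated (fun a => exists2 u, u \notin V1 & a = pi (vertex_idem K u))) ->
  (forall x, vertex_simple (rho1 \o pi) (val x) (L1 x)) ->
  quasi_hereditary L1 (relpre val le) ->
  quotient_by rho2
    (ideal_generated (fun a => exists2 u, u \notin V2 & a = pi (vertex_idem K u))) ->
  (forall x, vertex_simple (rho2 \o pi) (val x) (L2 x)) ->
  quasi_hereditary L2 (relpre val le) ->
  regular_exact_borel L1 (relpre val le) B1 ->
  regular_exact_borel L2 (relpre val le) B2 ->
  exists B : {aspace A}, regular_exact_borel L le B.
Proof.
move=> _ _ [pi_surj _] Lx le_refl le_anti _ qh [_ _ V12 V1v noarrow] vs.
move=> rho1J L1x _ rho2J L2x _ reg1 reg2.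
have xV12 x : (x \in V1) || (x \in V2).
  by have := in_setT x; rewrite -V12 inE.
have vV : v \in V1 :&: V2 by rewrite V1v set11.
have /andP[vV1 vV2] : (v \in V1) && (v \in V2) by rewrite inE in vV.
have xV12v x : x \in V1 -> x \in V2 -> x = v.
  by move=> x1 x2; apply/set1P; rewrite -V1v inE x1.
(* An arrow leaving the complement of V1 starts in V2 away from v. It cannot end at the source v,
   nor elsewhere in V1 by deconcatenation. *)
have succ (a : arrow Q) : ((source a \in ~: V1) -> (target a \in ~: V1)) /\
    ((source a \in ~: V2) -> (target a \in ~: V2)).
  have := noarrow a; rewrite !inE (vs a) /= negb_or !negb_and !negbK => /andP[na nb].
  split=> sV; apply/negP => tV.
    have sv : source a != v by apply: contraNneq sV => ->.
    have s2 : source a \in V2 by have := xV12 (source a); rewrite (negbTE sV).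
    by move: nb; rewrite (negbTE sv) s2 tV.
  have sv : source a != v by apply: contraNneq sV => ->.
  have s1 : source a \in V1 by have := xV12 (source a); rewrite (negbTE sV) orbF.
  by move: na; rewrite (negbTE sv) s1 tV.
have idealE (V : {set vertex Q}) (A' : falgType K) (rho : {lrmorphism A -> A'}) :
    quotient_by rho
      (ideal_generated (fun a => exists2 u, u \notin V & a = pi (vertex_idem K u))) ->
    quotient_by rho
      (ideal_generated (fun a => exists2 u, u \in ~: V & a = pi (vertex_idem K u))).
  move=> [rS rJ]; split=> // r; apply: iff_trans (rJ r) _.
  by split=> rI X XI Xu; apply: rI => // y [u uV ->]; apply: Xu; exists u => //; rewrite inE in uV *.
have [q1 [q1i q1E]] := vertex_quotient pi_surj (fun a => (succ a).1) (idealE _ _ _ rho1J).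
have [q2 [q2i q2E]] := vertex_quotient pi_surj (fun a => (succ a).2) (idealE _ _ _ rho2J).
pose e := pi (vertex_idem K v).
have ee : e * e = e by rewrite /e idem_idem eqxx.
have e0 : e != 0.
  have [[l l0 _] Le _] := Lx v; apply: contra_neq l0 => e0.
  by rewrite -(Le l) -/e e0 scale0r.
have [q0 [q0i q0E]] := source_quotient e0 ee (source_scalar pi_surj vs).
have disj : (~: V1) :&: (~: V2) = set0.
  by apply/setP => x; rewrite !inE; case: (x \in V1) (xV12 x) => //= ->.
have gl : gluing q1 q2 q0.
  split; rewrite ?q0i ?q1i ?q2i.
  - by rewrite idem_sumM disj idem_sum0.
  - by rewrite idem_sumM setIC disj idem_sum0.
  (* The vertices other than v are the disjoint union of the complements of V1 and V2. *)
  rewrite -(idem_sumC pi V1) (idem_sumD1 pi vV1) -/e addrAC [e + _]addrC addrK.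
  rewrite addrC; congr (_ + idem_sum pi _); apply/setP => x; rewrite !inE.
  have [->|xv] := eqVneq x v; first by rewrite vV2.
  have := xV12 x; have := xV12v x.
  case: (x \in V1) (x \in V2) => [] [] //= xe _.
  by rewrite xe ?eqxx in xv.
(* If q1 killed e, then e would be fixed by the idempotent of the complement of V1, whose product
   with e is zero as v lies in V1. *)
have q1e : q1 e != 0.
  apply: contra_neq e0 => /iq_ker; rewrite q1i /e -(idem_sum1 pi) idem_sumM => <-.
  apply: etrans (idem_sum0 pi); congr idem_sum; apply/setP => x; rewrite !inE.
  by case: eqP => [->|_]; rewrite ?vV1 ?andbF.
have q2e : q2 e != 0.
  apply: contra_neq e0 => /iq_ker; rewrite q2i /e -(idem_sum1 pi) idem_sumM => <-.
  apply: etrans (idem_sum0 pi); congr idem_sum; apply/setP => x; rewrite !inE.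
  by case: eqP => [->|_]; rewrite ?vV2 ?andbF.
have [p1 p1E] := character_descent q1e ee q0E.
have [p2 p2E] := character_descent q2e ee q0E.
have L1x' x : vertex_simple (q1 \o pi) (val x) (L1 x).
  have [? Le La] := L1x x; split=> // [m|a m]; rewrite /= q1E; [exact: Le|exact: La].
have L2x' x : vertex_simple (q2 \o pi) (val x) (L2 x).
  have [? Le La] := L2x x; split=> // [m|a m]; rewrite /= q2E; [exact: Le|exact: La].
apply: (glued_borel gl p1E p2E le_refl le_anti xV12 xV12v vV1 vV2
  (vertex_supported pi_surj q1i Lx L1x') (vertex_supported pi_surj q2i Lx L2x')
  (fun x => vertex_simple_simple (Lx x)) _ _ reg1 reg2).
- move=> m; rewrite q0i scalerBl scale1r; have [_ Le _] := Lx v.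
  by rewrite Le subrr.
- by move=> i; have [P [D [p [q [r [cp _ _ _ _]]]]]] := qh i; exists P, p.
Qed.
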